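(* Let $d\ge 1$ and $a>0$. There is a constant $C>0$ depending only on $d$ and $a$ such that for every real-valued $h\in(L^1\cap L^2)(\mathbb{R}^d)$ and all sufficiently large $R$, $$\mathrm{Var}\big(N(h,R)\big)\le C\left(R^{d-2}\int_{|\lambda|\le R}|\widehat h(\lambda)|^2|\lambda|^2\,dm_d(\lambda)+R^d\int_{|\lambda|\ge R}|\widehat h(\lambda)|^2\,dm_d(\lambda)\right).$$
   Context: $m_d$ is Lebesgue measure on $\mathbb{R}^d$, and $|\cdot|$, $\langle\cdot,\cdot\rangle$ are the Euclidean norm and inner product. For a fixed $a>0$, $\{\xi_n\}_{n\in\mathbb{Z}^d}$ are independent identically distributed random vectors in $\mathbb{R}^d$ with density $\phi_a(x)=(a\pi)^{-d/2}e^{-|x|^2/a}$ with respect to $m_d$. The point process is $W=\{n+\xi_n: n\in\mathbb{Z}^d\}$, and its linear statistic with test function $h$ and scale $R>0$ is the random variable $N(h,R)=\sum_{w\in W}h(w/R)=\sum_{n\in\mathbb{Z}^d}h\big((n+\xi_n)/R\big)$. The distribution of $N(h,R)$ does not depend on the choice of representative of $h$. The variance is $\mathrm{Var}(X)=\mathbb{E}[(X-\mathbb{E}X)^2]$. The Fourier transform is $\widehat f(\lambda)=\int_{\mathbb{R}^d}f(x)e^{-2\pi i\langle x,\lambda\rangle}\,dm_d(x)$. *)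

(* Defs.v *)
From HB Require Import structures.
From mathcomp Require Import all_boot all_order all_algebra finmap complex.
From mathcomp Require Import all_classical all_reals all_analysis.
Import Order.TTheory GRing.Theory Num.Theory.
Import numFieldNormedType.Exports.

Set Implicit Arguments.
Unset Strict Implicit.
Unset Printing Implicit Defensive.

Local Open Scope classical_set_scope.
Local Open Scope ring_scope.

(* R^d is [d.-tuple R], with the library's product sigma-algebra, which here is
   the Borel sigma-algebra. The 1-dimensional [lebesgue_measure R] lives on
   [measurableTypeR R], which is [R] with the same measurable sets. *)
Section lebesgue_measure_Rd.
Context (R : realType).
Local Open Scope ereal_scope.

Definition tcons d (p : measurableTypeR R * d.-tuple R) : d.+1.-tuple R :=
  [the d.+1.-tuple R of (p.1 : R) :: p.2].

Definition tuncons d (t : d.+1.-tuple R) : measurableTypeR R * d.-tuple R :=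
  (thead t, [tuple of behead t]).

Lemma tconsK d : cancel (@tcons d) (@tuncons d).
Proof. by case=> x t; congr pair; apply/val_inj. Qed.

Lemma measurable_tcons d : measurable_fun setT (@tcons d).
Proof.
apply: (@measurable_cons _ _ _ _ (fst : measurableTypeR R * d.-tuple R -> R)).
  exact: measurable_fst.
exact: measurable_snd.
Qed.

Lemma measurable_tuncons d : measurable_fun setT (@tuncons d).
Proof.
apply/measurable_fun_pairP; split.
  exact: (@measurable_tnth _ R d.+1 ord0).
exact: measurable_behead.
Qed.

Section step.
Context (d : nat) (m : {sigma_finite_measure set (d.-tuple R) -> \bar R}).

Definition lebesgue_step : set (d.+1.-tuple R) -> \bar R :=
  pushforward (@lebesgue_measure R \x m) (@tcons d).

Let mt := @measurable_tcons d.

Let lebesgue_step0 : lebesgue_step set0 = 0.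
Proof. exact: measure0. Qed.

Let lebesgue_step_ge0 A : 0 <= lebesgue_step A.
Proof. exact: measure_ge0. Qed.

Let lebesgue_step_sigma_additive : semi_sigma_additive lebesgue_step.
Proof. exact: measure_semi_sigma_additive. Qed.

HB.instance Definition _ := isMeasure.Build _ _ _ lebesgue_step
  lebesgue_step0 lebesgue_step_ge0 lebesgue_step_sigma_additive.

Let lebesgue_step_sigma_finite : sigma_finite setT lebesgue_step.
Proof.
have /sigma_finiteP[F [TF ndF Foo]] := sigma_finiteT (@lebesgue_measure R).
have /sigma_finiteP[G [TG ndG Goo]] := sigma_finiteT m.
exists (fun n => @tuncons d @^-1` (F n `*` G n)).
  rewrite -preimage_bigcup predeqE => t; split=> // _.
  have [n _ Fn] : (\bigcup_i F i) (tuncons t).1 by rewrite -TF.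
  have [k _ Gk] : (\bigcup_i G i) (tuncons t).2 by rewrite -TG.
  exists (maxn n k) => //; split.
    by move: Fn; exact/subsetPset/ndF/leq_maxl.
  by move: Gk; exact/subsetPset/ndG/leq_maxr.
move=> n; have [mF Fy] := Foo n; have [mG Gy] := Goo n; split.
  by rewrite -[X in measurable X]setTI; apply: measurable_tuncons => //;
    exact: measurableX.
rewrite /lebesgue_step /pushforward (_ : _ @^-1` _ = F n `*` G n); last first.
  by rewrite -comp_preimage (_ : _ \o _ = id)//; apply/funext => p; exact: tconsK.
by rewrite product_measure1E// lte_mul_pinfty// ge0_fin_numE.
Qed.

HB.instance Definition _ := Measure_isSigmaFinite.Build _ _ _ lebesgue_step
  lebesgue_step_sigma_finite.

End step.

(* Lebesgue measure m_d on R^d: m_0 is the unit mass at the empty tuple, and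
   m_(d+1) is the product measure m_1 x m_d transported along
   R x R^d = R^(d+1). *)
Fixpoint lebesgue_measureRd (d : nat) :
    {sigma_finite_measure set (d.-tuple R) -> \bar R} :=
  match d with
  | 0 => \d_([tuple] : 0.-tuple R)
  | d'.+1 => lebesgue_step (lebesgue_measureRd d')
  end.

Lemma lebesgue_measureRd_box d (A : 'I_d -> set R) :
  (forall i, measurable (A i)) ->
  lebesgue_measureRd d [set x | forall i, A i (tnth x i)] =
  \prod_(i < d) lebesgue_measure (A i).
Proof.
elim: d A => [A _|d IHd A mA] /=.
  by rewrite big_ord0 diracE mem_set// => -[].
rewrite /lebesgue_step /pushforward.
rewrite (_ : _ @^-1` _ =
  A ord0 `*` [set x | forall i, A (lift ord0 i) (tnth x i)]); last first.
  apply/seteqP; split => [[x t]/= At|[x t]/= [Ax At] i].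
    split; first exact: (At ord0).
    by move=> i; have := At (lift ord0 i); rewrite tnthS.
  by case: (unliftP ord0 i) => [j ->|->//]; rewrite tnthS; exact: At.
rewrite product_measure1E//.
  by rewrite big_ord_recl -(IHd (fun i => A (lift ord0 i))).
  exact: mA.
rewrite (_ : mkset _ =
    \bigcap_(i in [set: 'I_d]) (@tnth d R ^~ i @^-1` A (lift ord0 i))).
  apply: fin_bigcap_measurable => // i _.
  by rewrite -[X in measurable X]setTI; exact: measurable_tnth.
by apply/seteqP; split => x /= xA => [i _|i]; exact: xA.
Qed.

End lebesgue_measure_Rd.

Section fourier.
Context (R : realType).
Local Open Scope complex_scope.

Definition dotp d (x y : d.-tuple R) : R := \sum_(i < d) tnth x i * tnth y i.

Definition enorm d (x : d.-tuple R) : R := Num.sqrt (dotp x x).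

Definition cintegral disp (T : measurableType disp)
    (mu : {measure set T -> \bar R}) (f : T -> R[i]) : R[i] :=
  (\int[mu]_x complex.Re (f x))%R +i* (\int[mu]_x complex.Im (f x))%R.

Definition expi (t : R) : R[i] := cos t +i* sin t.

Definition fourier d (f : d.-tuple R -> R[i]) (lambda : d.-tuple R) : R[i] :=
  cintegral (lebesgue_measureRd R d)
    (fun x => f x * expi (- (2 * pi * dotp x lambda))).

End fourier.

Section probability.
Context (R : realType) (disp : measure_display) (Omega : measurableType disp).
Context (P : probability Omega R).

Definition mutually_independent (I : choiceType) disp'
    (T : measurableType disp') (X : I -> {RV P >-> T}) : Prop :=
  forall (J : {fset I}) (A : I -> set T), (forall i, measurable (A i)) ->
    P (\bigcap_(i in [set` J]) (X i @^-1` A i)) =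
    (\prod_(i <- J) P (X i @^-1` A i))%E.

Definition has_density disp' (T : measurableType disp')
    (mu : {measure set T -> \bar R}) (X : {RV P >-> T}) (f : T -> R) : Prop :=
  forall A, measurable A ->
    distribution P X A = (\int[mu]_(x in A) (f x)%:E)%E.

End probability.

Section linear_statistic.
Context (R : realType).

Definition gaussian_density (a : R) d (x : d.-tuple R) : R :=
  (a * pi) `^ (- (d%:R / 2)) * expR (- (enorm x ^+ 2 / a)).

(* Sum of an absolutely summable real family, as the sum of the positive parts
   minus the sum of the negative parts; 0 when one of these is infinite. *)
Definition rsum (I : choiceType) (f : I -> R) : R :=
  fine (\esum_(i in [set: I]) (EFin \o f)^\+ i -
        \esum_(i in [set: I]) (EFin \o f)^\- i)%E.

(* N(h, r) = sum over n in Z^d of h ((n + xi_n) / r): the points n + xi_n are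
   counted with multiplicity. When h is integrable and the xi_n have density
   [gaussian_density a], the family is almost surely absolutely summable. *)
Definition linear_statistic d (Omega : Type)
    (xi : d.-tuple int -> Omega -> d.-tuple R) (h : d.-tuple R -> R) (r : R)
    (w : Omega) : R :=
  rsum (fun n : d.-tuple int =>
    h [tuple ((tnth n i)%:~R + tnth (xi n w) i) / r | i < d]).

End linear_statistic.

(* Main.v *)
(* By independence Var N is the sum over n of Var h((n + xi_n)/r), and each of these
   is half of the double integral of (h((n+x)/r) - h((n+y)/r))^2 against the product
   of two Gaussian densities. By the parallelogram law that product, recentred at n,
   is a Gaussian in x - y times a Gaussian in the midpoint minus n; the sum of the
   latter over the lattice is bounded, so Var N is at most a constant times the
   average of r^d ||h(. + v/r) - h||_2^2 over a Gaussian vector v. By Plancherel (only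
   "<=" is needed) the squared norm is bounded by the integral of |h^|^2 times
   2 - 2 cos(2 pi <v/r, l>), which is at most C |v|^2 |l|^2 / r^2 for |l| <= r and at
   most 4 for |l| >= r. *)
Require Import Defs.
From HB Require Import structures.
From mathcomp Require Import all_boot all_order all_algebra finmap complex.
From mathcomp Require Import all_classical all_reals all_analysis.
From mathcomp Require Import measurable_realfun.
From mathcomp Require Import ring lra.
Import Order.TTheory GRing.Theory Num.Theory.
Import numFieldNormedType.Exports.
Import ComplexField.Normc.

Set Implicit Arguments.
Unset Strict Implicit.
Unset Printing Implicit Defensive.

Local Open Scope classical_set_scope.
Local Open Scope complex_scope.
Local Open Scope ring_scope.

(** * Vectors of R^d as tuples and affine changes of variables *)

Section tuple_vectors.
Context {R : realType}.

(** The Plancherel inequality rests on one explicit pair: the product of exp(-|x_i|), whose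
    transform is a product of Cauchy densities and comes from an elementary antiderivative.
    Integrated against the power spectrum, the dilated kernel yields an average of the
    autocorrelation. The kernel is at most 1, so the whole spectrum dominates; as the dilation
    shrinks, continuity of translations in L^2 brings the average to the squared norm. The
    inequality is applied to the increments h(. + u) - h, again in L^1 and L^2. As h is real, its
    transform is treated as a cosine and a sine integral. The spectral integrals stay in the
    extended reals, so their finiteness is never at issue. The other obstacle is the infinite sum,
    which need not converge for every outcome. Sums of the Gaussian density over the lattice are
    bounded, so the sum of the |h((n + xi_n)/r)| has finite mean and the series converges absolutely
    almost surely. The variance bound is proved for finite sets of lattice points, uniformly, and
    then passed to the limit. *)

Definition tadd d (x y : d.-tuple R) : d.-tuple R :=
  [tuple tnth x i + tnth y i | i < d].
Definition tscale d (c : R) (x : d.-tuple R) : d.-tuple R :=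
  [tuple c * tnth x i | i < d].

Lemma tadd_tcons d x y (s t : d.-tuple R) :
  tadd (tcons (x, s)) (tcons (y, t)) = tcons (x + y, tadd s t).
Proof.
apply: eq_from_tnth => i; rewrite tnth_mktuple.
by case: (unliftP ord0 i) => [j ->|->]//; rewrite !tnthS tnth_mktuple.
Qed.

Lemma tscale_tcons d c x (t : d.-tuple R) :
  tscale c (tcons (x, t)) = tcons (c * x, tscale c t).
Proof.
apply: eq_from_tnth => i; rewrite tnth_mktuple.
by case: (unliftP ord0 i) => [j ->|->]//; rewrite !tnthS tnth_mktuple.
Qed.

Lemma dotp_tcons d x y (s t : d.-tuple R) :
  dotp (tcons (x, s)) (tcons (y, t)) = x * y + dotp s t.
Proof.
by rewrite /dotp big_ord_recl; congr +%R; apply: eq_bigr => i _; rewrite !tnthS.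
Qed.

Lemma tcons_ind d (Q : d.+1.-tuple R -> Prop) :
  (forall x t, Q (tcons (x, t))) -> forall t, Q t.
Proof.
move=> H t; have -> : t = tcons (thead t, [tuple of behead t]).
  by rewrite [LHS]tuple_eta; apply/val_inj.
exact: H.
Qed.

Section measurability.
Context {disp : measure_display} {X : measurableType disp} (d : nat).
Implicit Types f g : X -> d.-tuple R.

Lemma measurable_tnth_comp f i :
  measurable_fun setT f -> measurable_fun setT (fun x => tnth (f x) i).
Proof. by move=> /measurable_fun_tnthP; apply. Qed.

Lemma measurable_tadd f g : measurable_fun setT f -> measurable_fun setT g ->
  measurable_fun setT (fun x => tadd (f x) (g x)).
Proof.
move=> mf mg; apply/measurable_fun_tnthP => i.
rewrite (_ : _ \o _ = fun x => tnth (f x) i + tnth (g x) i); last first.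
  by apply/funext => x; rewrite /= tnth_mktuple.
by apply: measurable_funD; exact: measurable_tnth_comp.
Qed.

Lemma measurable_tscale c f : measurable_fun setT f ->
  measurable_fun setT (fun x => tscale c (f x)).
Proof.
move=> mf; apply/measurable_fun_tnthP => i.
rewrite (_ : _ \o _ = fun x => c * tnth (f x) i); last first.
  by apply/funext => x; rewrite /= tnth_mktuple.
by apply: measurable_funM => //; exact: measurable_tnth_comp.
Qed.

Lemma measurable_dotp f g : measurable_fun setT f -> measurable_fun setT g ->
  measurable_fun setT (fun x => dotp (f x) (g x)).
Proof.
move=> mf mg; apply: measurable_sum => i.
by apply: measurable_funM; exact: measurable_tnth_comp.
Qed.

End measurability.

Section lebesgue.
Local Open Scope ereal_scope.
Notation leb := (@lebesgue_measure R).
Notation mu := (lebesgue_measureRd R).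

(** By uniqueness of Lebesgue measure it is enough to compare both sides on half-open intervals. A
    negative [c] moves the closed end to the left, hence the two cases. *)
Lemma lebesgue_affine (c v : R) A : (c != 0)%R -> measurable A ->
  leb A = `|c|%:E * leb [set x | A (c * x + v)%R].
Proof.
move=> c0 mA.
have mf : measurable_fun setT
    ((fun x => c * x + v)%R : measurableTypeR R -> measurableTypeR R).
  by apply: measurable_funD => //; apply: measurable_funM.
have c0' : (0 < `|c|)%R by rewrite normr_gt0.
pose m := mscale (NngNum (ltW c0'))
  (measure_function_pushforward__canonical__measure_function_Measure leb mf).
transitivity (m A) => //.
apply: (@lebesgue_measure_unique R m) => // _ [[a b] _ <-].
transitivity (`|c|%:E * leb [set x | `]a, b]%classic (c * x + v)%R]) => //.
rewrite lebesgue_measure_itv /= lte_fin.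
have [cp|cn|c00] := ltgtP c 0%R.
- rewrite [X in _ * leb X](_ : _ =
    [set` `[((b - v) / c)%R, ((a - v) / c)%R[]); last first.
    apply/seteqP; split => x /=; rewrite !in_itv /=.
      by rewrite ler_ndivrMr// ltr_ndivlMr// => /andP[? ?]; apply/andP; split; lra.
    by rewrite ler_ndivrMr// ltr_ndivlMr// => /andP[? ?]; apply/andP; split; lra.
  rewrite lebesgue_measure_itv /= lte_fin ltr_nM2r ?invr_lt0// ltrD2r.
  case: ifPn => ab; last by rewrite mule0.
  rewrite -!EFinD -EFinM ltr0_norm//; congr EFin; field; exact: ltr0_neq0.
- rewrite [X in _ * leb X](_ : _ =
    [set` `]((a - v) / c)%R, ((b - v) / c)%R]]); last first.
    apply/seteqP; split => x /=; rewrite !in_itv /=.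
      by rewrite ler_pdivlMr// ltr_pdivrMr// => /andP[? ?]; apply/andP; split; lra.
    by rewrite ler_pdivlMr// ltr_pdivrMr// => /andP[? ?]; apply/andP; split; lra.
  rewrite lebesgue_measure_itv /= lte_fin ltr_pM2r ?invr_gt0// ltrD2r.
  case: ifPn => ab; last by rewrite mule0.
  rewrite -!EFinD -EFinM gtr0_norm//; congr EFin; field; exact: lt0r_neq0.
- by rewrite c00 eqxx in c0.
Qed.

Lemma ge0_integral_affine1 (c v : R) (f : measurableTypeR R -> \bar R) : (c != 0)%R ->
  measurable_fun setT f -> (forall x, 0 <= f x) ->
  `|c|%:E * \int[leb]_x f (c * x + v)%R = \int[leb]_x f x.
Proof.
move=> c0 mf f0.
have ma : measurable_fun setT
    ((fun x => c * x + v)%R : measurableTypeR R -> measurableTypeR R).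
  by apply: measurable_funD => //; apply: measurable_funM.
have c0' : (0 < `|c|)%R by rewrite normr_gt0.
pose m := mscale (NngNum (ltW c0'))
  (measure_function_pushforward__canonical__measure_function_Measure leb ma).
rewrite [RHS](eq_measure_integral m); last first.
  by move=> A mA _; exact: (lebesgue_affine v c0 mA).
by rewrite ge0_integral_mscale//= ge0_integral_pushforward.
Qed.

Lemma measurable_tconsr d x :
  measurable_fun setT (fun t : d.-tuple R => tcons (x, t)).
Proof.
by apply: (measurableT_comp (@measurable_tcons R d)); exact: measurable_fun_pair.
Qed.

Lemma measurable_tconsl d t :
  measurable_fun setT (fun x : measurableTypeR R => @tcons R d (x, t)).
Proof.
by apply: (measurableT_comp (@measurable_tcons R d)); exact: measurable_fun_pair.
Qed.

Section tcons_integral.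
Context (d : nat).
Implicit Types f : d.+1.-tuple R -> \bar R.

Lemma ge0_integral_tcons f : measurable_fun setT f -> (forall x, 0 <= f x) ->
  \int[mu d.+1]_x f x = \int[leb]_x \int[mu d]_t f (tcons (x, t)).
Proof.
move=> mf f0 /=.
have mt := @measurable_tcons R d.
rewrite /lebesgue_step ge0_integral_pushforward//.
by rewrite fubini_tonelli1//=; exact: measurableT_comp.
Qed.

(** This order of integration serves when only the first coordinate is shifted. *)
Lemma ge0_integral_tcons2 f : measurable_fun setT f -> (forall x, 0 <= f x) ->
  \int[mu d.+1]_x f x = \int[mu d]_t \int[leb]_x f (tcons (x, t)).
Proof.
move=> mf f0 /=.
have mt := @measurable_tcons R d.
rewrite /lebesgue_step ge0_integral_pushforward//.
by rewrite fubini_tonelli2//=; exact: measurableT_comp.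
Qed.

End tcons_integral.

(** Induction on the dimension, each coordinate contributing one factor [|c|]. Negative [c] is
    allowed because a reflection, [c = -1], is needed for the lattice sums. *)
Lemma ge0_integral_affine d (c : R) (v : d.-tuple R) (f : d.-tuple R -> \bar R) :
  (c != 0)%R -> measurable_fun setT f -> (forall x, 0 <= f x) ->
  (`|c| ^+ d)%:E * \int[mu d]_x f (tadd (tscale c x) v) = \int[mu d]_x f x.
Proof.
move=> c0; elim: d v f => [|d IH] v f mf f0.
  by rewrite expr0 mul1e; apply: eq_integral => x _; rewrite [tadd _ _]tuple0 [x]tuple0.
elim/tcons_ind: v => y v.
have maff n (w : n.-tuple R) :
    measurable_fun setT (fun x : n.-tuple R => tadd (tscale c x) w).
  by apply: measurable_tadd => //; exact: measurable_tscale.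
have mft x : measurable_fun setT (fun t => f (tcons (x, t))).
  by apply: (measurableT_comp mf); exact: measurable_tconsr.
rewrite ge0_integral_tcons//; last exact: (measurableT_comp mf (maff _ _)).
under eq_integral do under eq_integral do rewrite tscale_tcons tadd_tcons.
rewrite [RHS]ge0_integral_tcons//.
have mG : measurable_fun setT
    ((fun x => \int[mu d]_t f (tcons (x, t))) : measurableTypeR R -> \bar R).
  apply: (@measurable_fun_fubini_tonelli_F _ _ _ _ _ _ (f \o @tcons R d)).
    exact: (measurableT_comp mf (@measurable_tcons R d)).
  by move=> p; exact: f0.
have G0 (x : measurableTypeR R) : 0 <= \int[mu d]_t f (tcons (x, t)).
  by apply: integral_ge0 => t _; exact: f0.
rewrite -[RHS](ge0_integral_affine1 y c0 mG G0).
rewrite exprS EFinM -muleA; congr (_ * _).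
rewrite -ge0_integralZl//.
- by apply: eq_integral => x _; rewrite (IH v (fun t => f (tcons (c * x + y, t)%R))).
- apply: (measurable_fun_fubini_tonelli_F
    (fun p => f (tcons (c * p.1 + y, tadd (tscale c p.2) v)%R))) => //.
  apply: (measurableT_comp mf); apply: (measurableT_comp (@measurable_tcons R d)).
  apply: measurable_fun_pair => /=.
    by apply: measurable_funD => //; apply: measurable_funM.
  by apply: measurable_tadd => //; exact: measurable_tscale.
- by move=> x _; apply: integral_ge0.
Qed.

Lemma ge0_integral_tadd d (v : d.-tuple R) (f : d.-tuple R -> \bar R) :
  measurable_fun setT f -> (forall x, 0 <= f x) ->
  \int[mu d]_x f (tadd x v) = \int[mu d]_x f x.
Proof.
move=> mf f0; rewrite -[RHS](@ge0_integral_affine _ 1%R v)//.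
rewrite normr1 expr1n mul1e; apply: eq_integral => x _; congr (f (tadd _ _)).
by apply: eq_from_tnth => i; rewrite tnth_mktuple mul1r.
Qed.

Lemma ge0_integral_tscale d (c : R) (f : d.-tuple R -> \bar R) :
  (0 < c)%R -> measurable_fun setT f -> (forall x, 0 <= f x) ->
  (c ^+ d)%:E * \int[mu d]_x f (tscale c x) = \int[mu d]_x f x.
Proof.
move=> c0 mf f0; rewrite -(@ge0_integral_affine _ c [tuple 0%R | i < d] f)//; last first.
  exact: lt0r_neq0.
rewrite gtr0_norm//; congr (_ * _); apply: eq_integral => x _; congr f.
by apply: eq_from_tnth => i; rewrite !tnth_mktuple addr0.
Qed.

End lebesgue.
End tuple_vectors.

(** * Continuity of translations in L^2 *)

Section ereal_sequences.
Context {R : realType}.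
Local Open Scope ereal_scope.

Lemma cvge0_le (u : nat -> \bar R) : (forall n, 0 <= u n) ->
  (forall e : R, (0 < e)%R -> \forall n \near \oo, u n <= e%:E) ->
  u n @[n --> \oo] --> 0.
Proof.
move=> u0 ue; apply/fine_cvgP; split.
  near=> n; rewrite ge0_fin_numE// (@le_lt_trans _ _ 1%:E) ?ltry//.
  by near: n; exact: ue.
apply/cvgrPdist_le => e e0; near=> n.
rewrite sub0r normrN ger0_norm ?fine_ge0//.
have une : u n <= e%:E by near: n; exact: ue.
by rewrite -lee_fin fineK// ge0_fin_numE// (le_lt_trans une)// ltry.
Unshelve. all: by end_near. Qed.

Lemma cvge0_near (u : nat -> \bar R) (e : R) : (0 < e)%R ->
  u n @[n --> \oo] --> 0 -> \forall n \near \oo, u n <= e%:E.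
Proof.
move=> e0 u0; have H : nbhs (0 : \bar R) [set x | x < e%:E].
  by apply: open_nbhs_nbhs; split; [exact: open_ereal_lt_ereal|rewrite /= lte_fin].
by near=> n; apply: ltW; near: n; exact: (u0 _ H).
Unshelve. all: by end_near. Qed.

(** Takes the place of the triangle inequality, so that L^2 distances can stay squared. The two
    sides differ by the square of [a - 2 * b + c]. *)
Lemma sqrB_le2 (a b c : R) :
  (((a - c) ^+ 2)%R%:E <= 2%:E * ((a - b) ^+ 2)%R%:E + 2%:E * ((b - c) ^+ 2)%R%:E).
Proof. by rewrite -!EFinM -EFinD lee_fin; have := sqr_ge0 (a - 2 * b + c); lra. Qed.

(** Dominated convergence with limit 0. Pointwise convergence is asked only where [G] is finite,
    because the dominating function of a slice is an inner integral that may be infinite on a null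
    set. *)
Lemma cvg_integral0 d (T : measurableType d) (m : {measure set T -> \bar R})
    (g : nat -> T -> \bar R) (G : T -> \bar R) :
  (forall n, measurable_fun setT (g n)) -> measurable_fun setT G ->
  (forall n x, 0 <= g n x <= G x) -> \int[m]_x G x < +oo ->
  (forall x, G x < +oo -> g n x @[n --> \oo] --> 0) ->
  \int[m]_x g n x @[n --> \oo] --> 0.
Proof.
move=> mg mG gG Goo g0.
have G0 x : 0 <= G x by have /andP[/le_trans h /h] := gG 0%N x.
have iG : m.-integrable setT G.
  apply/integrableP; split=> //.
  by under eq_integral do rewrite gee0_abs//.
rewrite -[X in _ --> X](@integral0 _ _ _ m setT).
have [] // := @dominated_convergence _ _ _ m setT _ g (cst 0) G.
- have /= := integrable_ae measurableT iG.
  apply: filterS => x /(_ I) Gx _; apply: g0.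
  by rewrite -ge0_fin_numE.
- apply: aeW => x n _; have /andP[? ?] := gG n x.
  by rewrite gee0_abs.
Qed.

Lemma le_integral_sqrB d (T : measurableType d) (m : {measure set T -> \bar R})
    (f g h : T -> R) :
  measurable_fun setT f -> measurable_fun setT g -> measurable_fun setT h ->
  \int[m]_x ((f x - h x) ^+ 2)%:E <=
  2%:E * \int[m]_x ((f x - g x) ^+ 2)%:E + 2%:E * \int[m]_x ((g x - h x) ^+ 2)%:E.
Proof.
move=> mf mg mh.
have mB (f' g' : T -> R) : measurable_fun setT f' -> measurable_fun setT g' ->
    measurable_fun setT (fun x => ((f' x - g' x) ^+ 2)%:E).
  move=> ? ?; apply/measurable_EFinP; apply: measurable_funX.
  exact: measurable_funB.
have ZE (f' g' : T -> R) : measurable_fun setT f' -> measurable_fun setT g' ->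
    2%:E * \int[m]_x ((f' x - g' x) ^+ 2)%:E =
    \int[m]_x (2%:E * ((f' x - g' x) ^+ 2)%:E).
  move=> ? ?; rewrite ge0_integralZl_EFin//; last exact: mB.
  by move=> x _; rewrite lee_fin sqr_ge0.
rewrite !ZE//.
rewrite -ge0_integralD//; last 4 first.
- by move=> x _; rewrite mule_ge0// lee_fin sqr_ge0.
- by apply: measurable_funeM; exact: mB.
- by move=> x _; rewrite mule_ge0// lee_fin sqr_ge0.
- by apply: measurable_funeM; exact: mB.
apply: ge0_le_integral => //.
- by move=> x _; rewrite lee_fin sqr_ge0.
- exact: mB.
- by apply: emeasurable_funD; apply: measurable_funeM; exact: mB.
- by move=> x _; exact: sqrB_le2.
Qed.

(** Invariance under [phi] is assumed at the level of integrals, so translations of the line and of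
    R^d are covered alike. The constant is 2 + 2, from comparing both functions with 0. *)
Lemma le_integral_shift_sqr d (T : measurableType d) (m : {measure set T -> \bar R})
    (phi : T -> T) (f : T -> R) : measurable_fun setT phi ->
  (forall g : T -> \bar R, measurable_fun setT g -> (forall x, 0 <= g x) ->
     \int[m]_x g (phi x) = \int[m]_x g x) ->
  measurable_fun setT f ->
  \int[m]_x ((f (phi x) - f x) ^+ 2)%:E <= 4%:E * \int[m]_x ((f x) ^+ 2)%:E.
Proof.
move=> mphi inv mf.
have mfphi : measurable_fun setT (fun x => f (phi x)) by exact: measurableT_comp.
apply: (le_trans (@le_integral_sqrB _ _ m _ (fun=> 0%R) f mfphi _ mf)) => //.
under eq_integral do rewrite subr0.
under [X in _ + _ * X]eq_integral do rewrite sub0r sqrrN.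
rewrite (inv (fun x => (f x ^+ 2)%:E)).
- rewrite -ge0_muleDl//.
  by rewrite -EFinD (_ : 2 + 2 = 4)%R//; lra.
- by apply/measurable_EFinP; exact: measurable_funX.
- by move=> x; rewrite lee_fin sqr_ge0.
Qed.

End ereal_sequences.

Section L2_translation_1d.
Context {R : realType}.
Local Open Scope ereal_scope.
Notation leb := (@lebesgue_measure R).
Local Notation T := (measurableTypeR R).

Lemma measurable_addr (s : R) : measurable_fun setT ((fun x => x + s)%R : T -> T).
Proof. exact: measurable_funD. Qed.

Lemma measurable_addr_comp (h : T -> R) (s : R) :
  measurable_fun setT h -> measurable_fun setT (fun x : T => h (x + s)%R).
Proof. by move=> mh; exact: (measurableT_comp mh (measurable_addr s)). Qed.

Lemma ge0_integral_addr (s : R) (f : T -> \bar R) :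
  measurable_fun setT f -> (forall x, 0 <= f x) ->
  \int[leb]_x f (x + s)%R = \int[leb]_x f x.
Proof.
move=> mf f0; rewrite -[RHS](@ge0_integral_affine1 R 1%R s)//.
by rewrite normr1 mul1e; apply: eq_integral => x _; rewrite mul1r.
Qed.

(** Sequential form of continuity at the zero shift, the form that dominated convergence uses. *)
Definition L2_continuous (f : T -> R) := forall s : nat -> R,
  s n @[n --> \oo] --> (0:R)%R ->
  \int[leb]_x ((f (x + s n)%R - f x) ^+ 2)%:E @[n --> \oo] --> 0.

(** Regularity encloses [E] between a compact [V] and an open [U], up to e / 4 on each side. A small
    shift keeps [V] inside [U], so the indicator can change only where x or its shift lies in one of
    the two thin differences: four terms of size e / 4. *)
Lemma L2_continuous_indic (E : set T) : measurable E -> leb E < +oo ->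
  L2_continuous (\1_E).
Proof.
move=> mE Eoo s s0.
apply: cvge0_le; first by move=> n; apply: integral_ge0 => x _; rewrite lee_fin sqr_ge0.
move=> e e0.
have e40 : (0 < e / 4)%R by rewrite divr_gt0.
have [U [oU EU UE]] := lebesgue_regularity_outer mE Eoo e40.
have [V [cV VE EV]] := lebesgue_regularity_inner mE Eoo e40.
have mU : measurable (U `\` E) by apply: measurableD => //; exact: open_measurable.
have mV : measurable (E `\` V) by apply: measurableD => //; exact: compact_measurable.
(* Compactness provides one neighbourhood of 0 that works for all points of [V]. *)
have VU : \forall t \near (0:R)%R, V `<=` [set x | U (x + t)%R].
  move/compact_near_coveringP : cV => /(_ R (nbhs (0:R)%R) (fun t x => U (x + t)%R)).
  apply => x Vx.
  have : (fun p : R * R => p.1 + p.2)%R @ (x, 0%R) --> (x + 0)%R.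
    exact: (@add_continuous R (x, 0%R)).
  move=> /(_ U); apply; rewrite addr0.
  by apply: open_nbhs_nbhs; split => //; exact/EU/VE.
(* Both signs are needed: the point in [V] may be x or x + s n, and the other one must then lie in
   [U]. *)
have ns0 : (- s n)%R @[n --> \oo] --> (0:R)%R by rewrite -oppr0; exact: cvgN.
have sU0 : \forall n \near \oo, V `<=` [set x | U (x + s n)%R] := s0 _ VU.
have sU0' : \forall n \near \oo, V `<=` [set x | U (x - s n)%R] := ns0 _ VU.
near=> n.
have sU : V `<=` [set x | U (x + s n)%R] by near: n.
have sU' : V `<=` [set x | U (x - s n)%R] by near: n.
pose F1 (x : T) : \bar R := (\1_(E `\` V) x)%:E.
pose F2 (x : T) : \bar R := (\1_(U `\` E) x)%:E.
have mF1 : measurable_fun setT F1 by apply/measurable_EFinP; exact: measurable_indic.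
have mF2 : measurable_fun setT F2 by apply/measurable_EFinP; exact: measurable_indic.
have F10 x : 0 <= F1 x by rewrite lee_fin.
have F20 x : 0 <= F2 x by rewrite lee_fin.
have iF1 : \int[leb]_x F1 x <= (e / 4)%:E.
  by rewrite integral_indic// setIT; exact: ltW.
have iF2 : \int[leb]_x F2 x <= (e / 4)%:E.
  by rewrite integral_indic// setIT; exact: ltW.
have mF1s : measurable_fun setT (fun x : T => F1 (x + s n)%R).
  exact: (measurableT_comp mF1 (measurable_addr _)).
have mF2s : measurable_fun setT (fun x : T => F2 (x + s n)%R).
  exact: (measurableT_comp mF2 (measurable_addr _)).
apply: (@le_trans _ _ (\int[leb]_x (F1 x + F2 x + (F1 (x + s n)%R + F2 (x + s n)%R)))).
  apply: ge0_le_integral => //.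
  - by move=> x _; rewrite lee_fin sqr_ge0.
  - apply/measurable_EFinP; apply: measurable_funX; apply: measurable_funB.
      exact: (measurableT_comp (measurable_indic mE) (measurable_addr _)).
    exact: measurable_indic.
  - by apply: emeasurable_funD; exact: emeasurable_funD.
  move=> x _; rewrite /F1 /F2 -!EFinD lee_fin !indicE !in_setD.
  have h2 := sU x; have h1 := sU' (x + s n)%R; rewrite /= addrK in h1; rewrite /= in h2.
  have [xE|xE] := boolP (x \in E); have [yE|yE] := boolP (_ \in E) => /=;
    rewrite ?subrr ?expr0n ?subr0 ?expr1n ?sub0r ?sqrrN ?expr1n ?andbT ?andbF /=.
  - by rewrite !addr_ge0.
  - case: (boolP (x \in V)) => [/set_mem/h2/mem_set ->|_] /=; rewrite ?addr0 ?add0r.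
      by [].
    by rewrite lerDl.
  - case: (boolP ((x + s n)%R \in V)) => [/set_mem/h1/mem_set ->|_] /=; rewrite ?addr0 ?add0r.
      by [].
    by rewrite lerDr.
  - by rewrite !addr_ge0.
rewrite ge0_integralD//; last 4 first.
- by move=> x _; rewrite adde_ge0.
- exact: emeasurable_funD.
- by move=> x _; rewrite adde_ge0.
- exact: emeasurable_funD.
rewrite ge0_integralD// ge0_integralD// (ge0_integral_addr _ mF1)// (ge0_integral_addr _ mF2)//.
rewrite [e in leRHS](_ : _ = e / 4 + e / 4 + (e / 4 + e / 4))%R; last lra.
by rewrite !EFinD !leeD.
Unshelve. all: by end_near. Qed.

Lemma L2_continuousD (f g : T -> R) : measurable_fun setT f -> measurable_fun setT g ->
  L2_continuous f -> L2_continuous g -> L2_continuous (fun x => f x + g x)%R.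
Proof.
move=> mf mg cf cg s s0.
have mfs (h : T -> R) n := @measurable_addr_comp h (s n).
apply: (@squeeze_cvge _ _ _ _ (cst 0) _ (fun n =>
  2%:E * (\int[leb]_x ((f (x + s n)%R - f x) ^+ 2)%:E) +
  2%:E * (\int[leb]_x ((g (x + s n)%R - g x) ^+ 2)%:E))).
- near=> n; rewrite integral_ge0/=; last by move=> x _; rewrite lee_fin sqr_ge0.
  apply: le_trans (@le_integral_sqrB _ _ _ leb _ (fun x => f x + g (x + s n)) _ _ _ _)%R _.
  + by apply: measurable_funD; exact: mfs.
  + by apply: measurable_funD => //; exact: mfs.
  + exact: measurable_funD.
  apply: leeD; rewrite le_eqVlt; apply/orP; left; apply/eqP; congr (_ * _);
    apply: eq_integral => x _; congr (_ ^+ 2)%:E; ring.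
- exact: cvg_cst.
- rewrite -[X in _ --> X](adde0 0); apply: cvgeD => //;
    rewrite -[X in _ --> X](mule0 2%:E); apply: cvgeZl => //; [exact: cf|exact: cg].
Unshelve. all: by end_near. Qed.

Lemma L2_continuousZ (c : R) (f : T -> R) : measurable_fun setT f ->
  L2_continuous f -> L2_continuous (fun x => c * f x)%R.
Proof.
move=> mf cf s s0.
have mfs (h : T -> R) n := @measurable_addr_comp h (s n).
rewrite (_ : (fun n => _) = (fun n => (c ^+ 2)%:E *
  \int[leb]_x ((f (x + s n)%R - f x) ^+ 2)%:E)); last first.
  apply/funext => n; rewrite -ge0_integralZl_EFin ?sqr_ge0//.
  - by apply: eq_integral => x _; rewrite -EFinM; congr EFin; ring.
  - by move=> x _; rewrite lee_fin sqr_ge0.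
  - apply/measurable_EFinP; apply: measurable_funX; apply: measurable_funB => //.
    exact: mfs.
rewrite -[X in _ --> X](mule0 (c ^+ 2)%:E).
by apply: cvgeZl => //; exact: cf.
Qed.

Lemma L2_continuous_sum n (f : 'I_n -> T -> R) : (forall i, measurable_fun setT (f i)) ->
  (forall i, L2_continuous (f i)) -> L2_continuous (fun x => \sum_(i < n) f i x)%R.
Proof.
elim: n f => [|n IH] f mf cf.
  rewrite (_ : (fun x => _) = cst 0%R); last by apply/funext => x; rewrite big_ord0.
  move=> s s0; rewrite (_ : (fun n => _) = cst 0); first exact: cvg_cst.
  by apply/funext => n; under eq_integral do rewrite subrr expr0n/=; exact: integral0.
under eq_fun do rewrite big_ord_recl.
apply: L2_continuousD => //; [exact: measurable_sum|exact: IH].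
Qed.

Lemma L2_continuous_approx (f : T -> R) : measurable_fun setT f ->
  (forall e : R, (0 < e)%R -> exists g : T -> R, [/\ measurable_fun setT g,
     L2_continuous g & \int[leb]_x ((f x - g x) ^+ 2)%:E <= e%:E]) ->
  L2_continuous f.
Proof.
move=> mf H s s0.
have mfs (h : T -> R) n := @measurable_addr_comp h (s n).
apply: cvge0_le; first by move=> n; apply: integral_ge0 => x _; rewrite lee_fin sqr_ge0.
move=> e e0.
(* Two applications of [le_integral_sqrB] give 2c + 2(2c + 2c) = 10c, which is below e = 16c. *)
pose c := (e / 16)%R; have c0 : (0 < c)%R by rewrite divr_gt0.
have [g [mg cg fg]] := H _ c0.
have gs : \forall n \near \oo, \int[leb]_x ((g (x + s n)%R - g x) ^+ 2)%:E <= c%:E.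
  by apply: cvge0_near => //; exact: cg.
near=> n.
have gsn : \int[leb]_x ((g (x + s n)%R - g x) ^+ 2)%:E <= c%:E by near: n.
have fgs : \int[leb]_x ((f (x + s n)%R - g (x + s n)%R) ^+ 2)%:E <= c%:E.
  rewrite (ge0_integral_addr (s n) (f := fun x => ((f x - g x) ^+ 2)%:E))//.
    by apply/measurable_EFinP; apply: measurable_funX; exact: measurable_funB.
  by move=> x; rewrite lee_fin sqr_ge0.
have gf : \int[leb]_x ((g x - f x) ^+ 2)%:E <= c%:E.
  by under eq_integral do rewrite -opprB sqrrN.
apply: le_trans (le_integral_sqrB leb (mfs _ n mf) (mfs _ n mg) mf) _.
apply: (@le_trans _ _ (2 * c + 2 * (2 * c + 2 * c))%R%:E); last first.
  by rewrite lee_fin /c; lra.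
rewrite [leRHS](_ : _ = 2%:E * c%:E + 2%:E * (2%:E * c%:E + 2%:E * c%:E)); last first.
  by rewrite -!(EFinM, EFinD).
apply: leeD; first exact: lee_wpmul2l.
apply: lee_wpmul2l => //.
apply: le_trans (le_integral_sqrB leb (mfs _ n mg) mg mf) _.
by apply: leeD; exact: lee_wpmul2l.
Unshelve. all: by end_near. Qed.

Lemma L2_continuous0 : L2_continuous (fun=> 0%R).
Proof.
move=> s s0; rewrite (_ : (fun n => _) = cst 0); first exact: cvg_cst.
by apply/funext => n; under eq_integral do rewrite subrr expr0n/=; exact: integral0.
Qed.

Import HBNNSimple.

(** A square-integrable simple function has level sets of finite measure at its nonzero values,
    since c^2 times the measure is at most the integral. The zero level may be infinite, but its
    term vanishes. *)
Lemma L2_continuous_nnsfun (g : {nnsfun T >-> R}) :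
  \int[leb]_x ((g x) ^+ 2)%:E < +oo -> L2_continuous g.
Proof.
move=> goo.
pose l := fset_set (g @` setT).
have -> : g = (fun x => \sum_(i < #|` l|) (l`_i * \1_(g @^-1` [set l`_i]) x))%R :> (T -> R).
  by apply/funext => x; exact: fimfunEord.
apply: L2_continuous_sum => i; set c := _`_i; set A := g @^-1` _.
  by apply: measurable_funM => //; apply: measurable_indic; exact: measurable_sfunP.
have mA : measurable A by exact: measurable_sfunP.
have [c0|c0] := eqVneq c 0%R.
  rewrite (_ : (fun x => _) = cst 0%R); first exact: L2_continuous0.
  by apply/funext => x; rewrite c0 mul0r.
apply: L2_continuousZ; first exact: measurable_indic.
apply: L2_continuous_indic => //.
have : (c ^+ 2)%:E * leb A < +oo.
  apply: le_lt_trans goo.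
  rewrite -[A]setIT -integral_indic// -ge0_integralZl_EFin ?sqr_ge0//; last first.
    by apply/measurable_EFinP; exact: measurable_indic.
  apply: ge0_le_integral => //.
  - by move=> x _; rewrite mule_ge0// lee_fin ?sqr_ge0.
  - by apply: measurable_funeM; apply/measurable_EFinP; exact: measurable_indic.
  - by apply/measurable_EFinP; exact: measurable_funX.
  move=> x _; rewrite -EFinM lee_fin indicE.
  have [/set_mem xA|_] := boolP (x \in A); last by rewrite mulr0 sqr_ge0.
  by rewrite mulr1 (_ : g x = c).
apply: contraTT; rewrite -!leNgt !leye_eq => /eqP ->.
by rewrite gt0_muley ?lte_fin ?exprn_even_gt0.
Qed.

(** Simple functions increasing to [f] converge to it in L^2, the squared error being dominated by
    f^2. *)
Lemma L2_continuous_ge0 (f : T -> R) : measurable_fun setT f -> (forall x, 0 <= f x)%R ->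
  \int[leb]_x ((f x) ^+ 2)%:E < +oo -> L2_continuous f.
Proof.
move=> mf f0 foo; apply: L2_continuous_approx => // e e0.
have mEf : measurable_fun setT (EFin \o f) by exact/measurable_EFinP.
pose g := nnsfun_approx measurableT mEf.
have gf n x : (g n x <= f x)%R.
  by rewrite -lee_fin /g nnsfun_approxE; apply: le_approx => // y _; rewrite lee_fin.
have g0 n x : (0 <= g n x)%R by exact: fun_ge0.
have mg n : measurable_fun setT (g n) by [].
have mf2 : measurable_fun setT (fun x => (f x ^+ 2)%:E).
  by apply/measurable_EFinP; exact: measurable_funX.
have : \int[leb]_x ((f x - g n x) ^+ 2)%:E @[n --> \oo] --> 0.
  apply: (cvg_integral0 (G := fun x => ((f x) ^+ 2)%:E)) => //.
  - move=> n; apply/measurable_EFinP; apply: measurable_funX; exact: measurable_funB.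
  - move=> n x; rewrite !lee_fin sqr_ge0/= ler_sqr ?nnegrE ?subr_ge0//.
    by rewrite gerBl.
  - move=> x _; apply: cvg_EFin; first exact: nearW.
    rewrite -[X in _ --> X](_ : (f x - f x) ^+ 2 = 0)%R; last by rewrite subrr expr0n.
    have gx : g n x @[n --> \oo] --> f x.
      have /fine_cvg := @cvg_nnsfun_approx _ _ _ _ measurableT _ mEf
        (fun y _ => f0 y) x I.
      exact.
    by apply: cvgM; apply: cvgB => //; exact: cvg_cst.
move=> /(cvge0_near e0)[N _ /(_ N (leqnn N)) /= gN].
exists (g N); split => //; apply: L2_continuous_nnsfun.
apply: le_lt_trans foo; apply: ge0_le_integral => //.
- by move=> x _; rewrite lee_fin sqr_ge0.
- by apply/measurable_EFinP; exact: measurable_funX.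
- by move=> x _; rewrite lee_fin ler_sqr ?nnegrE.
Qed.

Lemma L2_continuousT (f : T -> R) : measurable_fun setT f ->
  \int[leb]_x ((f x) ^+ 2)%:E < +oo -> L2_continuous f.
Proof.
move=> mf foo.
(* The hypothesis on squares lets one argument treat the positive parts of both f and - f. *)
have H (h : T -> R) : measurable_fun setT h -> (forall x, h x ^+ 2 = f x ^+ 2)%R ->
    L2_continuous (fun x => Num.max (h x) 0)%R.
  move=> mh hf; apply: L2_continuous_ge0.
  - exact: measurable_maxr.
  - by move=> x; rewrite le_max lexx orbT.
  - apply: le_lt_trans foo; apply: ge0_le_integral => //.
    + by move=> x _; rewrite lee_fin sqr_ge0.
    + by apply/measurable_EFinP; apply: measurable_funX; exact: measurable_maxr.
    + by apply/measurable_EFinP; exact: measurable_funX.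
    + move=> x _; rewrite lee_fin -hf; case: (leP (h x) 0%R) => _ //.
      by rewrite expr0n sqr_ge0.
have -> : f = (fun x => Num.max (f x) 0 + -1 * Num.max (- f x) 0)%R.
  apply/funext => x; case: (leP (f x) 0%R) => fx.
    by rewrite max_l ?oppr_ge0// mulrNN mul1r add0r.
  by rewrite max_r ?oppr_le0 1?ltW// mulr0 addr0.
apply: L2_continuousD; [exact: measurable_maxr| |exact: H|apply: L2_continuousZ].
- by apply: measurable_funM => //; apply: measurable_maxr => //; exact: measurableT_comp.
- by apply: measurable_maxr => //; exact: measurableT_comp.
- by apply: (H (fun x => - f x)%R) => [|x]; [exact: measurableT_comp|rewrite sqrrN].
Qed.

End L2_translation_1d.

Section L2_translation.
Context {R : realType}.
Local Open Scope ereal_scope.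
Notation leb := (@lebesgue_measure R).
Notation mu := (lebesgue_measureRd R).

Lemma tadd0 d (x : d.-tuple R) : tadd x [tuple 0%R | i < d] = x.
Proof. by apply: eq_from_tnth => i; rewrite !tnth_mktuple addr0. Qed.

(** Induction on the dimension: a shift is made first in the tail, then in the first coordinate. For
    each of the two, the slices are handled by the induction hypothesis or by the case of the line,
    and dominated convergence integrates over the remaining variables. *)
Lemma L2_translation d (F : d.-tuple R -> R) (v : d.-tuple R) (s : nat -> R) :
  measurable_fun setT F -> \int[mu d]_x ((F x) ^+ 2)%:E < +oo ->
  s n @[n --> \oo] --> (0:R)%R ->
  \int[mu d]_x ((F (tadd x (tscale (s n) v)) - F x) ^+ 2)%:E @[n --> \oo] --> 0.
Proof.
move=> mF Foo s0; elim: d F v mF Foo => [|d IH] F v mF Foo.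
  rewrite (_ : (fun n => _) = cst 0); first exact: cvg_cst.
  apply/funext => n; rewrite (eq_integral (cst 0)) ?integral0// => x _.
  by rewrite [tadd _ _]tuple0 [x]tuple0 subrr expr0n.
elim/(@tcons_ind R): v => y w.
have mFsh (u : d.+1.-tuple R) : measurable_fun setT (fun x => F (tadd x u)).
  by apply: (measurableT_comp mF); exact: measurable_tadd.
have mB (f g : d.+1.-tuple R -> R) : measurable_fun setT f -> measurable_fun setT g ->
    measurable_fun setT (fun x => ((f x - g x) ^+ 2)%:E).
  move=> mf mg; apply/measurable_EFinP; apply: measurable_funX; exact: measurable_funB.
have mF2 : measurable_fun setT (fun x => ((F x) ^+ 2)%:E).
  by apply/measurable_EFinP; exact: measurable_funX.
have F20 x : 0 <= ((F x) ^+ 2)%:E by rewrite lee_fin sqr_ge0.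
have mtc := @measurable_tcons R d.
(* [a] shifts the first coordinate only and [b] the tail only, each with the shifted variable
   innermost. *)
pose a n := \int[mu d]_t \int[leb]_x
  ((F (tcons (x + s n * y, t)%R) - F (tcons (x, t))) ^+ 2)%:E.
pose b n := \int[leb]_x \int[mu d]_t
  ((F (tcons (x, tadd t (tscale (s n) w))) - F (tcons (x, t))) ^+ 2)%:E.
have a0 : a n @[n --> \oo] --> 0.
  apply: (cvg_integral0
      (G := fun t => 4%:E * \int[leb]_x ((F (tcons (x, t))) ^+ 2)%:E)).
  - move=> n; apply: (measurable_fun_fubini_tonelli_G (m1 := leb)
        (fun p : measurableTypeR R * d.-tuple R =>
        ((F (tcons (p.1 + s n * y, p.2)%R) - F (tcons (p.1, p.2))) ^+ 2)%:E)); last first.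
      by move=> p; rewrite lee_fin sqr_ge0.
    apply/measurable_EFinP; apply: measurable_funX; apply: measurable_funB.
      apply: (measurableT_comp mF); apply: (measurableT_comp mtc).
      by apply: measurable_fun_pair => //=; exact: measurable_funD.
    apply: (measurableT_comp mF); apply: (measurableT_comp mtc).
    exact: measurable_fun_pair.
  - apply: measurable_funeM.
    apply: (measurable_fun_fubini_tonelli_G (m1 := leb)
          (fun p : measurableTypeR R * d.-tuple R => ((F (tcons p)) ^+ 2)%:E)) => //.
    exact: (measurableT_comp mF2 mtc).
  - move=> n t; rewrite integral_ge0/=; last by move=> x _; rewrite lee_fin sqr_ge0.
    apply: (@le_integral_shift_sqr R _ (measurableTypeR R) leb
      (fun x => (x + s n * y)%R) (fun x => F (tcons (x, t)))) => //.
    + exact: measurable_addr.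
    + by move=> g mg g0; exact: ge0_integral_addr.
    + by apply: (measurableT_comp mF); exact: measurable_tconsl.
  - rewrite ge0_integralZl_EFin//.
    + by apply: lte_mul_pinfty => //; rewrite -(ge0_integral_tcons2 mF2 F20).
    + by move=> t _; apply: integral_ge0.
    + apply: (measurable_fun_fubini_tonelli_G (m1 := leb)
          (fun p : measurableTypeR R * d.-tuple R => ((F (tcons p)) ^+ 2)%:E)) => //.
      exact: (measurableT_comp mF2 mtc).
  - move=> t toy; apply: (L2_continuousT (f := fun x => F (tcons (x, t)))).
    + by apply: (measurableT_comp mF); exact: measurable_tconsl.
    + by move: toy; apply: contraTT; rewrite -!leNgt !leye_eq => /eqP ->; rewrite gt0_muley.
    + by rewrite -[X in _ --> X](mul0r y); apply: cvgM => //; exact: cvg_cst.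
have b0 : b n @[n --> \oo] --> 0.
  apply: (cvg_integral0
      (G := fun x => 4%:E * \int[mu d]_t ((F (tcons (x, t))) ^+ 2)%:E)).
  - move=> n; apply: (measurable_fun_fubini_tonelli_F (m2 := mu d)
        (fun p : measurableTypeR R * d.-tuple R =>
        ((F (tcons (p.1, tadd p.2 (tscale (s n) w))) - F (tcons (p.1, p.2))) ^+ 2)%:E)); last first.
      by move=> p; rewrite lee_fin sqr_ge0.
    apply/measurable_EFinP; apply: measurable_funX; apply: measurable_funB.
      apply: (measurableT_comp mF); apply: (measurableT_comp mtc).
      by apply: measurable_fun_pair => //=; exact: measurable_tadd.
    apply: (measurableT_comp mF); apply: (measurableT_comp mtc).
    exact: measurable_fun_pair.
  - apply: measurable_funeM.
    apply: (measurable_fun_fubini_tonelli_F (m2 := mu d)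
          (fun p : measurableTypeR R * d.-tuple R => ((F (tcons p)) ^+ 2)%:E)) => //.
    exact: (measurableT_comp mF2 mtc).
  - move=> n x; rewrite integral_ge0/=; last by move=> t _; rewrite lee_fin sqr_ge0.
    apply: (@le_integral_shift_sqr R _ (d.-tuple R) (mu d)
      (fun t => tadd t (tscale (s n) w)) (fun t => F (tcons (x, t)))) => //.
    + exact: measurable_tadd.
    + by move=> g mg g0; exact: ge0_integral_tadd.
    + by apply: (measurableT_comp mF); exact: measurable_tconsr.
  - rewrite ge0_integralZl_EFin//.
    + by apply: lte_mul_pinfty => //; rewrite -(ge0_integral_tcons mF2 F20).
    + by move=> t _; apply: integral_ge0.
    + apply: (measurable_fun_fubini_tonelli_F (m2 := mu d)
          (fun p : measurableTypeR R * d.-tuple R => ((F (tcons p)) ^+ 2)%:E)) => //.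
      exact: (measurableT_comp mF2 mtc).
  - move=> x xoy; apply: (IH (fun t => F (tcons (x, t)))).
    + by apply: (measurableT_comp mF); exact: measurable_tconsr.
    + by move: xoy; apply: contraTT; rewrite -!leNgt !leye_eq => /eqP ->; rewrite gt0_muley.
apply: (@squeeze_cvge _ _ _ _ (cst 0) _ (fun n => 2%:E * a n + 2%:E * b n)).
- near=> n; apply/andP; split.
    by apply: integral_ge0 => x _; rewrite lee_fin sqr_ge0.
  (* The intermediate function has only its tail shifted. *)
  pose u := tcons (0%R : measurableTypeR R, tscale (s n) w).
  apply: (le_trans (@le_integral_sqrB R _ _ (mu d.+1) _ (fun x => F (tadd x u)) F _ _ _)) => //.
  apply: leeD; apply: lee_wpmul2l => //.
    (* The remaining difference is the first-coordinate one evaluated at x + u; translation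
       invariance removes [u]. *)
    pose H x := ((F (tadd x (tcons (s n * y, [tuple 0 | i < d]))%R) - F x) ^+ 2)%:E.
    rewrite (eq_integral (fun x => H (tadd x u))); last first.
      elim/(@tcons_ind R) => x t _; rewrite /H /u tscale_tcons !tadd_tcons addr0 tadd0.
      by [].
    rewrite ge0_integral_tadd//; [|exact: mB|by move=> x; rewrite lee_fin sqr_ge0].
    rewrite ge0_integral_tcons2//; [|exact: mB|by move=> x; rewrite lee_fin sqr_ge0].
    rewrite /H /a; under eq_integral do under eq_integral do rewrite tadd_tcons tadd0.
    by [].
  rewrite ge0_integral_tcons//; [|exact: mB|by move=> x; rewrite lee_fin sqr_ge0].
  by rewrite /u /b; under eq_integral do under eq_integral do rewrite tadd_tcons addr0.
- exact: cvg_cst.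
- rewrite -[X in _ --> X](adde0 0); apply: cvgeD => //;
    rewrite -[X in _ --> X](mule0 2%:E); exact: cvgeZl.
Unshelve. all: by end_near. Qed.

End L2_translation.

(** * The Poisson kernel *)

Section poisson_kernel.
Context {R : realType}.
Local Open Scope ereal_scope.
Notation leb := (@lebesgue_measure R).
Notation mu := (lebesgue_measureRd R).
Local Notation T := (measurableTypeR R).

Definition expabs (x : R) : R := expR (- `|x|).
(** The Fourier transform of [expabs]: the Cauchy density of total mass 1, that is, the Poisson
    kernel of the half-plane at height 1 / (2 pi). *)
Definition poisson (x : R) : R := (2 / (1 + (2 * pi * x) ^+ 2))%R.

Lemma expabs_ge0 x : (0 <= expabs x)%R. Proof. exact: expR_ge0. Qed.

Lemma continuous_expabs : continuous expabs.
Proof.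
move=> x; apply: (@continuous_comp _ _ _ (fun x : R => - `|x|)%R expR).
  by apply: cvgN; exact: norm_continuous.
exact: continuous_expR.
Qed.

Lemma measurable_expabs : measurable_fun setT (expabs : T -> R).
Proof. exact: continuous_measurable_fun continuous_expabs. Qed.

Lemma poisson_ge0 x : (0 <= poisson x)%R.
Proof. by rewrite divr_ge0// addr_ge0// sqr_ge0. Qed.

Lemma is_derive_damped_cos (b x : R) :
  is_derive x (1%R : R)
    (fun x : R => expR (- x) * ((1 + b ^+ 2)^-1 * (b * sin (b * x) - cos (b * x)) - 1))%R
    (expR (- x) * (1 + cos (b * x)))%R.
Proof.
have b0 : (1 + b ^+ 2 != 0)%R by rewrite lt0r_neq0// ltr_pwDl// sqr_ge0.
have dN : is_derive x (1%R : R) (fun x : R => - x)%R (-1)%R by exact: is_deriveN.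
have dE : is_derive x (1%R : R) (fun x : R => expR (- x))%R (- expR (- x))%R.
  by apply: is_derive_eq; rewrite ?mulrN1.
have db : is_derive x (1%R : R) (fun x : R => b * x)%R b.
  by apply: is_derive_eq; rewrite ?mulr1 //= /GRing.scale /= mulr1.
have dS : is_derive x (1%R : R) (fun x : R => sin (b * x))%R (cos (b * x) * b)%R.
  exact: is_derive1_comp.
have dC : is_derive x (1%R : R) (fun x : R => cos (b * x))%R (- sin (b * x) * b)%R.
  exact: is_derive1_comp.
apply: is_derive_eq.
rewrite /GRing.scale /=; field.
exact: b0.
Qed.

(** Adding 1 to the cosine makes the integrand nonnegative, so that the fundamental theorem of
    calculus applies on the half-line. The function is even, hence the factor 2. *)
Lemma integral_damped_cos (b : R) :
  \int[leb]_x (expabs x * (1 + cos (b * x)))%:E = (2 * (1 + (1 + b ^+ 2)^-1))%:E.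
Proof.
have cf : continuous (fun x : R => expabs x * (1 + cos (b * x)))%R.
  move=> x; apply: cvgM; first exact: continuous_expabs.
  apply: cvgD; first exact: cvg_cst.
  apply: (@continuous_comp _ _ _ (fun x : R => b * x)%R cos).
    by apply: cvgM; [exact: cvg_cst|exact: cvg_id].
  exact: continuous_cos.
have f0 x : (0 <= expabs x * (1 + cos (b * x)))%R.
  by rewrite mulr_ge0 ?expabs_ge0// -lerBlDl sub0r cos_geN1.
rewrite ge0_symfun_integralT//; last first.
  by move=> x /=; rewrite /expabs normrN mulrN cosN.
pose F (x : R) : R := (expR (- x) * ((1 + b ^+ 2)^-1 * (b * sin (b * x) - cos (b * x)) - 1))%R.
rewrite -set_itvcy (@ge0_continuous_FTC2y R _ F 0%R 0%R)//.
- rewrite /F oppr0 expR0 mulr0 sin0 cos0 -EFinB -EFinM; congr EFin.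
  by rewrite mulr0 sub0r; ring.
- exact: continuous_subspaceT.
- apply/cvgr0Pnorm_le => e e0.
  have c0 : (0 <= (1 + b ^+ 2)^-1)%R by rewrite invr_ge0 addr_ge0// sqr_ge0.
  pose M : R := ((1 + b ^+ 2)^-1 * (`|b| + 1) + 1)%R.
  have M0 : (0 < M)%R by rewrite ltr_pwDr// mulr_ge0// addr_ge0.
  have := @cvgr_expR R; move/cvgr0Pnorm_le => /(_ (e / M)%R (divr_gt0 e0 M0)).
  apply: filterS => x; rewrite ger0_norm ?expR_ge0// ler_pdivlMr// => h.
  rewrite /F normrM ger0_norm ?expR_ge0//; apply: le_trans h.
  rewrite ler_wpM2l ?expR_ge0//.
  rewrite (le_trans (ler_normB _ _))// normr1 lerD2r normrM ger0_norm//.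
  rewrite ler_wpM2l// (le_trans (ler_normB _ _))// lerD//.
    by rewrite normrM ler_piMr// sin_max.
  exact: cos_max.
- have := is_derive_damped_cos b 0%R => -[dF _].
  apply: cvg_at_right_filter; apply: differentiable_continuous.
  exact/derivable1_diffP.
- move=> x; rewrite in_itv /= andbT => x0; rewrite derive1E.
  rewrite (@derive_val _ _ _ _ _ _ _ (is_derive_damped_cos b x)).
  by rewrite /expabs gtr0_norm.
Qed.

Lemma integral_expabs : \int[leb]_x (expabs x)%:E = 2%:E.
Proof.
have := integral_damped_cos 0%R.
under eq_integral do rewrite mul0r cos0 EFinM muleC.
rewrite expr0n/= addr0 invr1 ge0_integralZl_EFin//; last 2 first.
- by move=> x _; rewrite lee_fin expabs_ge0.
- by apply/measurable_EFinP; exact: measurable_expabs.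
move=> h.
have : (2^-1)%:E * ((1 + 1)%:E * \int[leb]_x (expabs x)%:E) = (2^-1)%:E * (2 * (1 + 1))%:E.
  by rewrite h.
rewrite muleA -!EFinM (_ : 2^-1 * (1 + 1) = 1)%R; last by field.
by rewrite mul1e => ->; congr EFin; field.
Qed.

Lemma integrable_expabs : leb.-integrable setT (EFin \o (expabs : T -> R)).
Proof.
apply/integrableP; split; first by apply/measurable_EFinP; exact: measurable_expabs.
under eq_integral do rewrite gee0_abs ?lee_fin ?expabs_ge0//.
by rewrite integral_expabs ltry.
Qed.

Lemma measurable_cos_scale b : measurable_fun setT ((fun x => cos (b * x)%R) : T -> R).
Proof.
apply: (@measurableT_comp _ _ _ _ _ _ (@cos R)); last exact: measurable_funM.
exact: continuous_measurable_fun (@continuous_cos R).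
Qed.

Lemma measurable_sin_scale b : measurable_fun setT ((fun x => sin (b * x)%R) : T -> R).
Proof.
apply: (@measurableT_comp _ _ _ _ _ _ (@sin R)); last exact: measurable_funM.
exact: continuous_measurable_fun (@continuous_sin R).
Qed.

Lemma integrable_expabsM (g : T -> R) : measurable_fun setT g -> (forall x, `|g x| <= 1)%R ->
  leb.-integrable setT (fun x => (expabs x * g x)%:E).
Proof.
move=> mg g1; apply: (le_integrable measurableT _ _ integrable_expabs).
  by apply/measurable_EFinP; apply: measurable_funM => //; exact: measurable_expabs.
move=> x _ /=; rewrite lee_fin normrM ler_piMr//.
Qed.

(** Subtracting the integral of [expabs] undoes the addition of 1 to the cosine. *)
Lemma integral_expabs_cos v :
  \int[leb]_x (expabs x * cos (2 * pi * v * x))%:E = (poisson v)%:E.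
Proof.
have := integral_damped_cos (2 * pi * v)%R.
under eq_integral do rewrite mulrDr mulr1 EFinD.
rewrite integralD//; [|exact: integrable_expabs|]; last first.
  apply: integrable_expabsM; first exact: measurable_cos_scale.
  by move=> x; exact: cos_max.
rewrite integral_expabs => h.
rewrite /poisson.
have -> : (2 / (1 + (2 * pi * v) ^+ 2))%:E =
  (2 * (1 + (1 + (2 * pi * v) ^+ 2)^-1))%:E - 2%:E by rewrite -EFinB; congr EFin; ring.
by rewrite -h addeAC -EFinB subrr add0e.
Qed.

Lemma integral_expabs_sin b :
  \int[leb]_x (expabs x * sin (b * x))%:E = 0.
Proof.
have ig : leb.-integrable setT (fun x : T => (expabs x * sin (b * x))%:E).
  apply: integrable_expabsM; first exact: measurable_sin_scale.
  by move=> x; exact: sin_max.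
set g := (fun x : T => _) in ig.
have mg := measurable_int _ ig.
(* The reflection exchanges the positive and negative parts of the odd function [g]; both have the
   same integral, finite by integrability. *)
have gN x : g (-1 * x + 0)%R = - g x.
  by rewrite /g addr0 mulN1r /expabs normrN mulrN sinN mulrN.
rewrite integralE -[X in X - _](@ge0_integral_affine1 R (-1)%R 0%R)//; last first.
  exact: measurable_funepos.
rewrite normrN normr1 mul1e [X in X - _](eq_integral (fun x => g^\- x)); last first.
  move=> x _; transitivity (g^\+ (-1 * x + 0)%R) => //.
  by rewrite funeposE gN funenegE.
apply: subee; apply: integrable_neg_fin_num => //.
Qed.

Lemma integral_poisson : \int[leb]_x (poisson x)%:E = 1.
Proof.
have cf : continuous (fun x : R => (oneDsqr x)^-1)%R by exact: continuous_oneDsqrV.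
have f0 x : (0 <= (oneDsqr x : R)^-1)%R by rewrite invr_ge0.
have h : \int[leb]_x ((oneDsqr (x : R))^-1)%:E = pi%:E.
  rewrite ge0_symfun_integralT//; last by move=> x /=; rewrite /oneDsqr sqrrN.
  by rewrite -set_itvcy integral0y_oneDsqr -EFinM mulrC divfK.
have p0 : (0 < 2 * pi :> R)%R by rewrite mulr_gt0// pi_gt0.
rewrite -(@ge0_integral_affine1 R (2 * pi)%R 0%R) in h; last 3 first.
- exact: lt0r_neq0.
- by apply/measurable_EFinP; exact: continuous_measurable_fun.
- by move=> x; rewrite lee_fin.
rewrite (eq_integral (fun x : T => 2%:E * (oneDsqr (2 * pi * x + 0)%R)^-1%:E)); last first.
  by move=> x _; rewrite addr0.
rewrite ge0_integralZl_EFin//; last first.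
  apply/measurable_EFinP; apply: (@measurableT_comp _ _ _ _ _ _ (fun x : T => (oneDsqr x)^-1)%R).
    exact: continuous_measurable_fun.
  by apply: measurable_funD => //; exact: measurable_funM.
have -> : 2%:E = (pi^-1)%:E * `|(2 * pi : R)|%:E.
  by rewrite gtr0_norm// -EFinM mulrCA mulVf ?mulr1// gt_eqF ?pi_gt0.
by rewrite -muleA h -EFinM mulVf// gt_eqF ?pi_gt0.
Qed.

Lemma measurable_poisson : measurable_fun setT (poisson : T -> R).
Proof.
apply: measurable_funM => //.
apply: (@measurableT_comp _ _ _ _ _ _ (fun x : T => (oneDsqr x)^-1)%R).
  exact: continuous_measurable_fun (@continuous_oneDsqrV R).
exact: measurable_funM.
Qed.

Definition tprod (g : R -> R) d (x : d.-tuple R) : R := (\prod_(i < d) g (tnth x i))%R.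

Lemma tprod_tcons (g : R -> R) d x (t : d.-tuple R) :
  tprod g (tcons (x, t)) = (g x * tprod g t)%R.
Proof.
by rewrite /tprod big_ord_recl; congr *%R; apply: eq_bigr => i _; rewrite tnthS.
Qed.

Lemma tprod_ge0 (g : R -> R) d (t : d.-tuple R) : (forall x, 0 <= g x)%R ->
  (0 <= tprod g t)%R.
Proof. by move=> g0; apply: prodr_ge0. Qed.

Lemma measurable_tprod (g : R -> R) d : measurable_fun setT (g : T -> R) ->
  measurable_fun setT (@tprod g d).
Proof.
move=> mg; apply: measurable_prod => i _.
exact: (measurableT_comp mg (@measurable_tnth _ R d i)).
Qed.

Lemma integral_tprod (g : R -> R) (c : R) d : measurable_fun setT (g : T -> R) ->
  (forall x, 0 <= g x)%R -> \int[leb]_x (g x)%:E = c%:E ->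
  \int[mu d]_x (tprod g x)%:E = (c ^+ d)%:E.
Proof.
move=> mg g0 gc; elim: d => [|d IH].
  rewrite integral_dirac//; last by apply/measurable_EFinP; exact: measurable_tprod.
  by rewrite diracT mul1e /tprod big_ord0.
rewrite ge0_integral_tcons//; last 2 first.
- by apply/measurable_EFinP; exact: measurable_tprod.
- by move=> x; rewrite lee_fin tprod_ge0.
under eq_integral.
  move=> x _.
  under eq_integral do rewrite tprod_tcons EFinM.
  rewrite ge0_integralZl_EFin//; last 2 first.
  - by move=> t _; rewrite lee_fin tprod_ge0.
  - by apply/measurable_EFinP; exact: measurable_tprod.
  rewrite IH muleC.
  over.
rewrite /= ge0_integralZl_EFin//; last 3 first.
- by move=> x _; rewrite lee_fin.
- exact/measurable_EFinP.
- rewrite exprn_ge0// -lee_fin -gc; apply: integral_ge0 => x _; rewrite lee_fin//.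
by rewrite gc -EFinM exprSr.
Qed.

Lemma integral_tcons2 d (f : d.+1.-tuple R -> \bar R) : (mu d.+1).-integrable setT f ->
  \int[mu d.+1]_x f x = \int[mu d]_t \int[leb]_x f (tcons (x, t)).
Proof.
move=> intf; have mf := measurable_int _ intf.
have mt := @measurable_tcons R d.
have mft : measurable_fun setT (f \o @tcons R d) by exact: measurableT_comp.
have ift : (leb \x mu d).-integrable setT (f \o @tcons R d).
  apply/integrable21ltyP => //.
  move/integrableP : intf => [_]; rewrite ge0_integral_tcons2//.
  exact: measurableT_comp.
rewrite /= /lebesgue_step integral_pushforward//.
by rewrite -integral21_prod_meas1.
Qed.

Lemma integrable_tprod_expabs d : (mu d).-integrable setT (EFin \o @tprod expabs d).
Proof.
apply/integrableP; split.
  by apply/measurable_EFinP; apply: measurable_tprod; exact: measurable_expabs.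
rewrite (eq_integral (fun x => (tprod expabs x)%:E)); last first.
  by move=> x _; apply: gee0_abs; rewrite lee_fin; apply: tprod_ge0; exact: expabs_ge0.
rewrite (integral_tprod _ measurable_expabs expabs_ge0 integral_expabs).
by rewrite ltry.
Qed.

Lemma integrable_tprod_expabsM d (g : d.-tuple R -> R) : measurable_fun setT g ->
  (forall x, `|g x| <= 1)%R ->
  (mu d).-integrable setT (fun x => (tprod expabs x * g x)%:E).
Proof.
move=> mg g1; apply: (le_integrable measurableT _ _ (@integrable_tprod_expabs d)).
  apply/measurable_EFinP; apply: measurable_funM => //; apply: measurable_tprod.
  exact: measurable_expabs.
by move=> x _ /=; rewrite lee_fin normrM ler_piMr.
Qed.

(** Induction with the addition formula for the cosine: the product of sines drops out because its
    integral over the first coordinate is that of an odd function. *)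
Lemma integral_tprod_expabs_cos d (v : d.-tuple R) :
  \int[mu d]_l (tprod expabs l * cos (2 * pi * dotp v l))%:E = (tprod poisson v)%:E.
Proof.
have mc n (w : n.-tuple R) : measurable_fun setT (fun l => cos (2 * pi * dotp w l))%R.
  apply: (@measurableT_comp _ _ _ _ _ _ (@cos R)).
    exact: continuous_measurable_fun (@continuous_cos R).
  by apply: measurable_funM => //; exact: measurable_dotp.
have cos1 := @cos_max R; have sin1 := @sin_max R.
elim: d v => [|d IH] v.
  have mf0 : measurable_fun setT
      (fun l : 0.-tuple R => (tprod expabs l * cos (2 * pi * dotp v l))%:E).
    apply/measurable_EFinP; apply: measurable_funM; last exact: mc.
    exact: measurable_tprod measurable_expabs.
  rewrite integral_dirac//.
  by rewrite diracT mul1e /tprod /dotp !big_ord0 mulr0 cos0 mulr1.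
elim/(@tcons_ind R) : v => y v.
rewrite integral_tcons2; last exact: integrable_tprod_expabsM.
under eq_integral.
  move=> t _.
  rewrite (eq_integral (fun x : T =>
     (tprod expabs t * cos (2 * pi * dotp v t))%:E * (expabs x * cos (2 * pi * y * x))%:E -
     (tprod expabs t * sin (2 * pi * dotp v t))%:E *
       (expabs x * sin (2 * pi * y * x))%:E)); last first.
    move=> x _; rewrite tprod_tcons dotp_tcons mulrDr mulrA cosD -!EFinM -EFinB; congr EFin; ring.
  have i1 : leb.-integrable setT (fun x : T => (expabs x * cos (2 * pi * y * x))%:E).
    by apply: integrable_expabsM => //; exact: measurable_cos_scale.
  have i2 : leb.-integrable setT (fun x : T => (expabs x * sin (2 * pi * y * x))%:E).
    by apply: integrable_expabsM => //; exact: measurable_sin_scale.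
  rewrite integralB//; [|exact: integrableZl|exact: integrableZl].
  rewrite !integralZl// integral_expabs_cos integral_expabs_sin mule0 sube0 muleC.
  over.
rewrite /= integralZl//; last exact: integrable_tprod_expabsM.
by rewrite IH -EFinM tprod_tcons.
Qed.

End poisson_kernel.

(** * A Plancherel inequality *)

Section plancherel.
Context {R : realType}.
Local Open Scope ereal_scope.
Notation mu := (lebesgue_measureRd R).

Lemma taddC d (x y : d.-tuple R) : tadd x y = tadd y x.
Proof. by apply: eq_from_tnth => i; rewrite !tnth_mktuple addrC. Qed.

Lemma dotpC d (x y : d.-tuple R) : dotp x y = dotp y x.
Proof. by apply: eq_bigr => i _; rewrite mulrC. Qed.

Lemma dotp_taddl d (x y z : d.-tuple R) : dotp (tadd x y) z = (dotp x z + dotp y z)%R.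
Proof. by rewrite /dotp -big_split; apply: eq_bigr => i _; rewrite tnth_mktuple mulrDl. Qed.

Lemma dotp_tscalel d c (x y : d.-tuple R) : dotp (tscale c x) y = (c * dotp x y)%R.
Proof. by rewrite /dotp mulr_sumr; apply: eq_bigr => i _; rewrite tnth_mktuple mulrA. Qed.

Lemma dotp_tscaler d c (x y : d.-tuple R) : dotp x (tscale c y) = (c * dotp x y)%R.
Proof. by rewrite dotpC dotp_tscalel dotpC. Qed.

Definition phase d (x l : d.-tuple R) : R := (2 * pi * dotp x l)%R.

Lemma measurable_phase {disp} {X : measurableType disp} d (f g : X -> d.-tuple R) :
  measurable_fun setT f -> measurable_fun setT g ->
  measurable_fun setT (fun x => phase (f x) (g x)).
Proof. by move=> mf mg; apply: measurable_funM => //; exact: measurable_dotp. Qed.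

Lemma measurable_cos {disp} {X : measurableType disp} (f : X -> R) :
  measurable_fun setT f -> measurable_fun setT (fun x => cos (f x)).
Proof.
by apply: measurableT_comp; exact: continuous_measurable_fun (@continuous_cos R).
Qed.

Lemma measurable_sin {disp} {X : measurableType disp} (f : X -> R) :
  measurable_fun setT f -> measurable_fun setT (fun x => sin (f x)).
Proof.
by apply: measurableT_comp; exact: continuous_measurable_fun (@continuous_sin R).
Qed.

Lemma integrable_mul_le1 {disp} {X : measurableType disp} (m : {measure set X -> \bar R})
    (f g : X -> R) : m.-integrable setT (EFin \o f) -> measurable_fun setT g ->
  (forall x, `|g x| <= 1)%R -> m.-integrable setT (fun x => (f x * g x)%:E).
Proof.
move=> fi mg g1; have /measurable_EFinP mf := measurable_int _ fi.
apply: (le_integrable measurableT _ _ fi).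
  by apply/measurable_EFinP; exact: measurable_funM.
by move=> x _ /=; rewrite lee_fin normrM ler_piMr.
Qed.

(** Tonelli gives measurability for the positive and negative parts, and the integral is their
    difference. The transforms below have signed integrands. *)
Lemma measurable_integral_r d1 d2 (X : measurableType d1) (Y : measurableType d2)
    (m : {sigma_finite_measure set Y -> \bar R}) (f : X * Y -> \bar R) :
  measurable_fun setT f -> measurable_fun setT (fun x => \int[m]_y f (x, y)).
Proof.
move=> mf.
rewrite (_ : (fun x => _) = (fun x => \int[m]_y f^\+ (x, y) - \int[m]_y f^\- (x, y))); last first.
  apply/funext => x; rewrite integralE; congr (_ - _);
    by apply: eq_integral => y _; rewrite ?funeposE ?funenegE.
by apply: emeasurable_funB; apply: measurable_fun_fubini_tonelli_F => //;
  [exact: measurable_funepos|exact: measurable_funeneg].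
Qed.

Lemma integrable_prod d1 d2 (X : measurableType d1) (Y : measurableType d2)
    (m1 : {sigma_finite_measure set X -> \bar R})
    (m2 : {sigma_finite_measure set Y -> \bar R}) (f : X -> R) (g : Y -> R) :
  m1.-integrable setT (EFin \o f) -> m2.-integrable setT (EFin \o g) ->
  (m1 \x m2).-integrable setT (fun p => (f p.1 * g p.2)%:E).
Proof.
move=> fi gi.
have /measurable_EFinP mf := measurable_int _ fi.
have /measurable_EFinP mg := measurable_int _ gi.
have /integrableP[_ foo] := fi; have /integrableP[_ goo] := gi.
apply/integrable12ltyP.
  apply/measurable_EFinP; apply: measurable_funM.
    exact: measurableT_comp mf _.
  exact: measurableT_comp mg _.
under eq_integral.
  move=> x _.
  rewrite (eq_integral (fun y => (`|f x|)%:E * (`|g y|)%:E)); last first.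
    by move=> y _; rewrite /= normrM.
  rewrite ge0_integralZl_EFin//; last first.
    by apply/measurable_EFinP; exact: measurableT_comp.
  over.
rewrite /= ge0_integralZr//; last 2 first.
- by apply/measurable_EFinP; exact: measurableT_comp.
- exact: integral_ge0.
apply: lte_mul_pinfty => //; first exact: integral_ge0.
by rewrite ge0_fin_numE//; exact: integral_ge0.
Qed.

Lemma integrable_affine d (c : R) (v : d.-tuple R) (f : d.-tuple R -> \bar R) :
  (c != 0)%R -> (mu d).-integrable setT f ->
  (mu d).-integrable setT (fun x => f (tadd (tscale c x) v)).
Proof.
move=> c0 /integrableP[mf foo].
have ma : measurable_fun setT (fun x : d.-tuple R => tadd (tscale c x) v).
  by apply: measurable_tadd => //; exact: measurable_tscale.
apply/integrableP; split; first exact: (measurableT_comp mf ma).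
have := ge0_integral_affine v c0 (measurableT_comp (@abse_measurable R setT) mf)
  (fun x => abse_ge0 _).
rewrite /= => h; move: foo; rewrite -h.
apply: contraTT; rewrite -!leNgt !leye_eq => /eqP ->.
by rewrite gt0_muley// lte_fin exprn_gt0// normr_gt0.
Qed.

Lemma integral_affine d (c : R) (v : d.-tuple R) (f : d.-tuple R -> \bar R) :
  (c != 0)%R -> (mu d).-integrable setT f ->
  (`|c| ^+ d)%:E * \int[mu d]_x f (tadd (tscale c x) v) = \int[mu d]_x f x.
Proof.
move=> c0 fi; have mf := measurable_int _ fi.
have fi' := integrable_affine v c0 fi.
rewrite [in RHS]integralE.
rewrite -(ge0_integral_affine v c0 (measurable_funepos mf))//.
rewrite -(ge0_integral_affine v c0 (measurable_funeneg mf))//.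
rewrite -muleBr//; last first.
  apply: fin_num_adde_defl.
  rewrite fin_numN (eq_integral (fun x => (fun x => f (tadd (tscale c x) v))^\- x)).
    exact: integrable_neg_fin_num.
  by move=> x _; rewrite !funenegE.
by rewrite integralE; congr (_ * (_ - _)); apply: eq_integral => x _;
  rewrite ?funeposE ?funenegE.
Qed.

Section transform.
Context {d : nat} (F : d.-tuple R -> R).

(** For real F the Fourier transform is [cos_transform] minus i times [sin_transform], and
    [power_spectrum] is its squared modulus. For integrable F both integrals are finite, so [fine]
    loses nothing. *)
Definition cos_transform l : R := fine (\int[mu d]_x (F x * cos (phase x l))%:E).
Definition sin_transform l : R := fine (\int[mu d]_x (F x * sin (phase x l))%:E).
Definition power_spectrum l : R := (cos_transform l ^+ 2 + sin_transform l ^+ 2)%R.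

Lemma power_spectrum_ge0 l : (0 <= power_spectrum l)%R.
Proof. by rewrite addr_ge0// sqr_ge0. Qed.

Context (Fi : (mu d).-integrable setT (EFin \o F)).
Let mF : measurable_fun setT F.
Proof. exact/measurable_EFinP/measurable_int/Fi. Qed.

Let mph (l : d.-tuple R) : measurable_fun setT (fun x => phase x l).
Proof. exact: measurable_phase. Qed.

Lemma integrable_cos_transform l :
  (mu d).-integrable setT (fun x => (F x * cos (phase x l))%:E).
Proof.
apply: integrable_mul_le1 => //; [exact: measurable_cos|].
by move=> x; exact: cos_max.
Qed.

Lemma integrable_sin_transform l :
  (mu d).-integrable setT (fun x => (F x * sin (phase x l))%:E).
Proof.
apply: integrable_mul_le1 => //; [exact: measurable_sin|].
by move=> x; exact: sin_max.
Qed.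

Lemma cos_transformE l :
  (cos_transform l)%:E = \int[mu d]_x (F x * cos (phase x l))%:E.
Proof. by rewrite fineK//; apply: integrable_fin_num => //; exact: integrable_cos_transform. Qed.

Lemma sin_transformE l :
  (sin_transform l)%:E = \int[mu d]_x (F x * sin (phase x l))%:E.
Proof. by rewrite fineK//; apply: integrable_fin_num => //; exact: integrable_sin_transform. Qed.

Lemma measurable_power_spectrum : measurable_fun setT power_spectrum.
Proof.
have mph2 : measurable_fun setT (fun p : d.-tuple R * d.-tuple R => phase p.2 p.1).
  exact: measurable_phase.
have mF2 : measurable_fun setT (fun p : d.-tuple R * d.-tuple R => F p.2).
  exact: measurableT_comp.
apply: measurable_funD; apply: measurable_funX; apply/measurable_EFinP.
  rewrite (_ : _ \o _ = fun l => \int[mu d]_x (F x * cos (phase x l))%:E); last first.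
    by apply/funext => l; rewrite /= cos_transformE.
  apply: (@measurable_integral_r _ _ _ _ (mu d)
    (fun p : d.-tuple R * d.-tuple R => (F p.2 * cos (phase p.2 p.1))%:E)).
  by apply/measurable_EFinP; apply: measurable_funM => //; exact: measurable_cos.
rewrite (_ : _ \o _ = fun l => \int[mu d]_x (F x * sin (phase x l))%:E); last first.
  by apply/funext => l; rewrite /= sin_transformE.
apply: (@measurable_integral_r _ _ _ _ (mu d)
    (fun p : d.-tuple R * d.-tuple R => (F p.2 * sin (phase p.2 p.1))%:E)).
by apply/measurable_EFinP; apply: measurable_funM => //; exact: measurable_sin.
Qed.

Section dilation.
Context (s : R) (s0 : (0 < s)%R).

Let G (p : d.-tuple R * d.-tuple R) : R := (F p.1 * F (tadd (tscale s p.2) p.1))%R.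

Let mG : measurable_fun setT G.
Proof.
apply: measurable_funM; first exact: measurableT_comp.
by apply: (measurableT_comp mF); apply: measurable_tadd => //; exact: measurable_tscale.
Qed.

Let s_neq0 : (s != 0)%R. Proof. exact: lt0r_neq0. Qed.

(** Integrating over w first replaces the second factor by the L^1 norm of F divided by s^d,
    whatever x is. *)
Lemma integrable_autocorrelation : (mu d \x mu d).-integrable setT (EFin \o G).
Proof.
have /integrableP[_ Foo] := Fi.
have mnF : measurable_fun setT (fun x => (`|F x|)%:E).
  by apply/measurable_EFinP; exact: measurableT_comp.
have mnFa x : measurable_fun setT (fun w => (`|F (tadd (tscale s w) x)|)%:E).
  by apply: (measurableT_comp mnF); apply: measurable_tadd => //; exact: measurable_tscale.
apply/integrable12ltyP; first exact/measurable_EFinP.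
under eq_integral.
  move=> x _.
  rewrite (eq_integral (fun w => (`|F x|)%:E * (`|F (tadd (tscale s w) x)|)%:E)); last first.
    by move=> w _; rewrite /= /G normrM.
  rewrite ge0_integralZl_EFin//.
  have -> : \int[mu d]_w (`|F (tadd (tscale s w) x)|)%:E =
      ((s ^+ d)^-1)%:E * \int[mu d]_w (`|F w|)%:E.
    rewrite -(ge0_integral_affine x s_neq0 mnF)// gtr0_norm// muleA -EFinM.
    by rewrite mulVf ?mul1e// expf_neq0.
  over.
rewrite /= ge0_integralZr//; last first.
  by rewrite mule_ge0 ?integral_ge0// lee_fin invr_ge0 exprn_ge0// ltW.
rewrite lte_mul_pinfty//; [exact: integral_ge0|by rewrite ge0_fin_numE ?integral_ge0|].
rewrite lte_mul_pinfty//.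
by rewrite lee_fin invr_ge0 exprn_ge0// ltW.
Qed.

(** The power spectrum is the transform of the autocorrelation. Writing the increment as s w puts
    the spectrum at l / s and produces the Jacobian s^(-d). In the inner integral the phase of w is
    the difference of the phases of s w + x and of x at l / s, and s w + x becomes the new
    variable. *)
Lemma power_spectrum_dilate (l : d.-tuple R) :
  ((s ^+ d)^-1 * power_spectrum (tscale s^-1 l))%:E =
  \int[mu d]_x \int[mu d]_w (G (x, w) * cos (phase w l))%:E.
Proof.
set l' := tscale s^-1 l.
have phE x w : (phase (tadd (tscale s w) x) l' = phase w l + phase x l')%R.
  rewrite /phase dotp_taddl dotp_tscalel dotp_tscaler; field.
  exact: s_neq0.
have inner x : \int[mu d]_w (G (x, w) * cos (phase w l))%:E =
    ((s ^+ d)^-1 * (F x * cos (phase x l') * cos_transform l' +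
                    F x * sin (phase x l') * sin_transform l'))%:E.
  pose f y := (F x * cos (phase x l'))%:E * (F y * cos (phase y l'))%:E +
     (F x * sin (phase x l'))%:E * (F y * sin (phase y l'))%:E.
  have i1 : (mu d).-integrable setT
      (fun y => (F x * cos (phase x l'))%:E * (F y * cos (phase y l'))%:E).
    by apply: integrableZl => //; exact: integrable_cos_transform.
  have i2 : (mu d).-integrable setT
      (fun y => (F x * sin (phase x l'))%:E * (F y * sin (phase y l'))%:E).
    by apply: integrableZl => //; exact: integrable_sin_transform.
  have fi : (mu d).-integrable setT f by exact: integrableD.
  have -> : \int[mu d]_w (G (x, w) * cos (phase w l))%:E =
      \int[mu d]_w f (tadd (tscale s w) x).
    apply: eq_integral => w _; rewrite /f /G /= phE -!EFinM -EFinD; congr EFin.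
    rewrite cosD sinD.
    have := cos2Dsin2 (phase x l'); set c := cos (phase x l'); set c' := sin (phase x l') => h.
    (* Inserting c^2 + c'^2 = 1 turns the formula for the cosine of a difference into a polynomial
       identity. *)
    transitivity (F x * F (tadd (tscale s w) x) * cos (phase w l) * (c ^+ 2 + c' ^+ 2))%R.
      by rewrite h mulr1.
    ring.
  have e : \int[mu d]_y f y = (F x * cos (phase x l') * cos_transform l' +
                    F x * sin (phase x l') * sin_transform l')%:E.
    rewrite integralD// !integralZl//;
      [|exact: integrable_sin_transform|exact: integrable_cos_transform].
    by rewrite -cos_transformE -sin_transformE.
  rewrite EFinM -e -(integral_affine x s_neq0 fi) muleA -EFinM gtr0_norm//.
  by rewrite mulVf ?mul1e// expf_neq0.
rewrite (eq_integral (fun x => ((s ^+ d)^-1)%:E *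
    ((F x * cos (phase x l'))%:E * (cos_transform l')%:E +
     (F x * sin (phase x l'))%:E * (sin_transform l')%:E))); last first.
  move=> x _.
  by rewrite inner EFinM EFinD (EFinM _ (cos_transform l')) (EFinM _ (sin_transform l')).
rewrite integralZl//; last first.
  by apply: integrableD => //; apply: integrableZr => //;
    [exact: integrable_cos_transform|exact: integrable_sin_transform].
rewrite integralD//; last 2 first.
- by apply: integrableZr => //; exact: integrable_cos_transform.
- by apply: integrableZr => //; exact: integrable_sin_transform.
rewrite !integralZr//; [|exact: integrable_sin_transform|exact: integrable_cos_transform].
by rewrite -cos_transformE -sin_transformE EFinM /power_spectrum EFinD !expr2 !EFinM.
Qed.

End dilation.

Context (F2oo : \int[mu d]_x (F x ^+ 2)%:E < +oo).

Definition shift_diff w := \int[mu d]_x ((F (tadd x w) - F x) ^+ 2)%:E.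

Let mB w : measurable_fun setT (fun x => ((F (tadd x w) - F x) ^+ 2)%:E).
Proof.
apply/measurable_EFinP; apply: measurable_funX; apply: measurable_funB => //.
by apply: (measurableT_comp mF); exact: measurable_tadd.
Qed.

Let mF2 : measurable_fun setT (fun x => (F x ^+ 2)%:E).
Proof. by apply/measurable_EFinP; exact: measurable_funX. Qed.

Let F20 x : 0 <= (F x ^+ 2)%:E. Proof. by rewrite lee_fin sqr_ge0. Qed.

Lemma shift_diff_ge0 w : 0 <= shift_diff w.
Proof. by apply: integral_ge0 => x _; rewrite lee_fin sqr_ge0. Qed.

Lemma shift_diff_le w : shift_diff w <= 4%:E * \int[mu d]_x (F x ^+ 2)%:E.
Proof.
apply: (@le_integral_shift_sqr R _ (d.-tuple R) (mu d) (fun x => tadd x w) F) => //.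
- exact: measurable_tadd.
- by move=> g mg g0; exact: ge0_integral_tadd.
Qed.

Lemma shift_diff_fin_num w : shift_diff w \is a fin_num.
Proof.
rewrite ge0_fin_numE ?shift_diff_ge0//; apply: le_lt_trans (shift_diff_le w) _.
by rewrite lte_mul_pinfty.
Qed.

Let N2 : R := fine (\int[mu d]_x (F x ^+ 2)%:E).
Let N2E : N2%:E = \int[mu d]_x (F x ^+ 2)%:E.
Proof. by rewrite fineK// ge0_fin_numE// integral_ge0. Qed.

Lemma measurable_shift_diff disp (X : measurableType disp) (f : X -> d.-tuple R) :
  measurable_fun setT f -> measurable_fun setT (fun x => shift_diff (f x)).
Proof.
move=> mf.
apply: (@measurable_integral_r _ _ X _ (mu d)
  (fun p : X * d.-tuple R => ((F (tadd p.2 (f p.1)) - F p.2) ^+ 2)%:E)).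
apply/measurable_EFinP; apply: measurable_funX; apply: measurable_funB.
  apply: (measurableT_comp mF); apply: measurable_tadd => //.
  exact: measurableT_comp mf _.
exact: measurableT_comp.
Qed.

Let i2 : (mu d).-integrable setT (fun x => (F x ^+ 2)%:E).
Proof. by apply/integrableP; split => //; under eq_integral do rewrite gee0_abs//. Qed.

Let i2w w : (mu d).-integrable setT (fun x => (F (tadd x w) ^+ 2)%:E).
Proof.
apply/integrableP; split.
  by apply: (measurableT_comp mF2); exact: measurable_tadd.
under eq_integral do rewrite gee0_abs//.
by rewrite (ge0_integral_tadd w mF2).
Qed.

Let iD w : (mu d).-integrable setT (fun x => ((F (tadd x w) - F x) ^+ 2)%:E).
Proof.
apply/integrableP; split => //.
under eq_integral do rewrite gee0_abs ?lee_fin ?sqr_ge0//.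
by rewrite -ge0_fin_numE ?shift_diff_ge0//; exact: shift_diff_fin_num.
Qed.

(** Polarization, which ties the autocorrelation to [shift_diff]. *)
Let prodE w : (fun x => (F x * F (tadd x w))%:E) =
  (fun x => (2^-1)%:E * ((F x ^+ 2)%:E + (F (tadd x w) ^+ 2)%:E -
     ((F (tadd x w) - F x) ^+ 2)%:E)).
Proof.
apply/funext => x.
apply: (@congr1 _ _ EFin _ (2^-1 * (F x ^+ 2 + F (tadd x w) ^+ 2 -
     (F (tadd x w) - F x) ^+ 2))%R); by field.
Qed.

Lemma integrable_shift_prod w :
  (mu d).-integrable setT (fun x => (F x * F (tadd x w))%:E).
Proof.
by rewrite prodE; apply: integrableZl => //; apply: integrableB => //; exact: integrableD.
Qed.

Lemma integral_shift_prod w :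
  \int[mu d]_x (F x * F (tadd x w))%:E =
  (fine (\int[mu d]_x (F x ^+ 2)%:E) - fine (shift_diff w) / 2)%:E.
Proof.
rewrite prodE integralZl//; last by apply: integrableB => //; exact: integrableD.
rewrite integralB//; last exact: integrableD.
rewrite integralD// (ge0_integral_tadd w mF2)// -N2E.
rewrite -/(shift_diff w) -(fineK (shift_diff_fin_num w)).
apply: (@congr1 _ _ EFin (2^-1 * (N2 + N2 - fine (shift_diff w)))%R).
by rewrite /=; field.
Qed.

(* Fourier inversion against the product kernel [tprod expabs], whose transform
   is [tprod poisson]: the dilated kernel, integrated against the power spectrum,
   gives the autocorrelation of F averaged over [s w], and the autocorrelation at
   [w] is the squared norm of F minus half of [shift_diff w]. *)
Lemma plancherel_dilate (s : R) : (0 < s)%R ->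
  \int[mu d]_x (F x ^+ 2)%:E <= \int[mu d]_l (power_spectrum l)%:E +
    \int[mu d]_w (shift_diff (tscale s w) * (tprod poisson w)%:E).
Proof.
move=> s0.
have sd0 : (0 < (s ^+ d)^-1)%R by rewrite invr_gt0 exprn_gt0.
pose k := @tprod R expabs d.
have ki : (mu d).-integrable setT (EFin \o k) by exact: integrable_tprod_expabs.
have mk : measurable_fun setT k by apply: measurable_tprod; exact: measurable_expabs.
have k0 l : (0 <= k l)%R by apply: tprod_ge0; exact: expabs_ge0.
have k1 l : (k l <= 1)%R.
  have : (k l <= \prod_(i < d) 1)%R.
    apply: ler_prod => i _.
    by rewrite expabs_ge0/= /expabs -expR0 ler_expR oppr_le0.
  by rewrite big1_eq.
pose K := @tprod R poisson d.
have mK : measurable_fun setT K by apply: measurable_tprod; exact: measurable_poisson.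
have K0 l : (0 <= K l)%R by apply: tprod_ge0; exact: poisson_ge0.
have iK : \int[mu d]_w (K w)%:E = 1.
  have := @integral_tprod R poisson 1%R d measurable_poisson poisson_ge0.
  by rewrite expr1n; apply; exact: integral_poisson.
have Ki : (mu d).-integrable setT (EFin \o K).
  apply/integrableP; split; first exact/measurable_EFinP.
  rewrite (eq_integral (fun w => (K w)%:E)); first by rewrite iK ltry.
  by move=> w _; apply: gee0_abs; rewrite lee_fin.
(* The autocorrelation of F at s w, in the form given by [integral_shift_prod]. *)
pose A (w : d.-tuple R) : R := (N2 - fine (shift_diff (tscale s w)) / 2)%R.
have AE w : \int[mu d]_x (F x * F (tadd (tscale s w) x))%:E = (A w)%:E.
  by under eq_integral do rewrite taddC; rewrite integral_shift_prod.
have Ai : (mu d).-integrable setT (EFin \o A).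
  have Gi := integrable_autocorrelation s0.
  have mGi := measurable_int _ Gi.
  (* With the variables swapped, w comes first and Fubini gives integrability of the inner integral
     as a function of w. *)
  have : (mu d \x mu d).-integrable setT
      (fun p => (F p.2 * F (tadd (tscale s p.1) p.2))%:E).
    apply/integrable12ltyP; first exact: (measurableT_comp mGi (@measurable_swap _ _ _ _)).
    exact: ((@integrable21ltyP _ _ _ _ _ (mu d) (mu d) _ mGi).1 Gi).
  move=> /integrable_fubini_F; rewrite /fubini_F.
  by under eq_fun do rewrite /= AE.
(* The kernel is at most 1, and the dilation of l absorbs the factor s^(-d). *)
have step1 : \int[mu d]_l ((s ^+ d)^-1 * power_spectrum (tscale s^-1 l) * k l)%:E <=
    \int[mu d]_l (power_spectrum l)%:E.
  have mps := measurable_power_spectrum.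
  have mEps : measurable_fun setT (fun l => (power_spectrum l)%:E) by exact/measurable_EFinP.
  have si0 : (0 < s^-1)%R by rewrite invr_gt0.
  rewrite -[leRHS](ge0_integral_tscale si0 mEps); last first.
    by move=> l; rewrite lee_fin power_spectrum_ge0.
  have mpt : measurable_fun setT (fun l => power_spectrum (tscale s^-1 l)).
    by apply: (measurableT_comp mps); exact: measurable_tscale.
  rewrite exprVn -ge0_integralZl_EFin//; last 3 first.
  - by move=> l _; rewrite lee_fin power_spectrum_ge0.
  - exact/measurable_EFinP.
  - exact: ltW.
  apply: ge0_le_integral => //.
  - move=> l _; rewrite lee_fin mulr_ge0// mulr_ge0//; first exact: ltW.
    exact: power_spectrum_ge0.
  - by apply/measurable_EFinP; apply: measurable_funM => //; exact: measurable_funM.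
  - by apply/measurable_EFinP; exact: measurable_funM.
  - move=> l _; rewrite -EFinM lee_fin ler_piMr// mulr_ge0 ?power_spectrum_ge0//.
    exact: ltW.
have step2 l : ((s ^+ d)^-1 * power_spectrum (tscale s^-1 l))%:E =
    \int[mu d]_w (A w * cos (phase w l))%:E.
  rewrite power_spectrum_dilate//.
  rewrite (@Fubini _ _ (d.-tuple R) (d.-tuple R) R (mu d) (mu d)
    (fun p => (F p.1 * F (tadd (tscale s p.2) p.1) * cos (phase p.2 l))%:E)); last first.
    apply: (integrable_mul_le1 (integrable_autocorrelation s0)).
      by apply: measurable_cos; exact: measurable_phase.
    by move=> p; exact: cos_max.
  apply: eq_integral => w _ /=; rewrite EFinM -AE.
  have Gw : (mu d).-integrable setT (fun x => (F x * F (tadd (tscale s w) x))%:E).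
    under eq_fun do rewrite taddC; exact: integrable_shift_prod.
  rewrite -integralZr//.
have kAi : (mu d \x mu d).-integrable setT
    (fun p => (k p.1 * A p.2 * cos (phase p.2 p.1))%:E).
  apply: (integrable_mul_le1 (f := fun p => (k p.1 * A p.2)%R)).
  - exact: integrable_prod.
  - by apply: measurable_cos; exact: measurable_phase.
  - by move=> p; exact: cos_max.
(* Exchanging the integrals moves the transform from [A] to the kernel [k], whose transform is
   known. *)
have step3 : \int[mu d]_l ((s ^+ d)^-1 * power_spectrum (tscale s^-1 l) * k l)%:E =
    \int[mu d]_w (A w * K w)%:E.
  transitivity (\int[mu d]_l \int[mu d]_w (k l * A w * cos (phase w l))%:E).
    apply: eq_integral => l _; rewrite EFinM step2 muleC -integralZl//; last first.
      apply: integrable_mul_le1 => //; first by apply: measurable_cos; exact: measurable_phase.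
      by move=> w; exact: cos_max.
    by apply: eq_integral => w _; rewrite -EFinM mulrA.
  rewrite (Fubini kAi); apply: eq_integral => w _ /=.
  rewrite (eq_integral (fun l => (A w)%:E * (k l * cos (phase w l))%:E)); last first.
    by move=> l _; rewrite -EFinM; congr EFin; ring.
  rewrite integralZl//; last first.
    apply: integrable_mul_le1 => //; first by apply: measurable_cos; exact: measurable_phase.
    by move=> l; exact: cos_max.
  by rewrite integral_tprod_expabs_cos -EFinM.
apply: le_trans (leeD2r _ step1); rewrite step3.
have msd : measurable_fun setT (fun w => shift_diff (tscale s w)).
  by apply: measurable_shift_diff; exact: measurable_tscale.
have mA : measurable_fun setT A by exact/measurable_EFinP/measurable_int/Ai.
have mD : measurable_fun setT (fun w => (fine (shift_diff (tscale s w)))).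
  exact: measurableT_comp.
have D0 w : (0 <= fine (shift_diff (tscale s w)))%R by rewrite fine_ge0 ?shift_diff_ge0.
have N20 : (0 <= N2)%R by rewrite fine_ge0 ?integral_ge0.
have Dle w : (fine (shift_diff (tscale s w)) <= 4 * N2)%R.
  by rewrite -lee_fin fineK ?shift_diff_fin_num// EFinM N2E shift_diff_le.
have NKi : (mu d).-integrable setT (fun w => N2%:E * (K w)%:E) by exact: integrableZl.
have DKi : (mu d).-integrable setT (fun w => (fine (shift_diff (tscale s w)) * K w)%:E).
  apply: (le_integrable measurableT _ _ (integrableZl measurableT (4 * N2)%R Ki)).
    by apply/measurable_EFinP; exact: measurable_funM.
  move=> w _; rewrite /= lee_fin [leRHS]ger0_norm; last by rewrite !mulr_ge0.
  by rewrite ger0_norm ?mulr_ge0// ler_wpM2r.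
rewrite [X in _ <= X + _](eq_integral (fun w => N2%:E * (K w)%:E -
    (2^-1)%:E * (fine (shift_diff (tscale s w)) * K w)%:E)); last first.
  move=> w _; apply: (@congr1 _ _ EFin _
    (N2 * K w - 2^-1 * (fine (shift_diff (tscale s w)) * K w))%R).
  by rewrite /A; field.
rewrite integralB//; last exact: integrableZl.
rewrite !integralZl// iK mule1 N2E.
have e : \int[mu d]_w (shift_diff (tscale s w) * (tprod poisson w)%:E) =
    \int[mu d]_w (fine (shift_diff (tscale s w)) * K w)%:E.
  by apply: eq_integral => w _; rewrite EFinM fineK ?shift_diff_fin_num.
rewrite e; have fE := integrable_fin_num measurableT DKi.
rewrite -N2E -(fineK fE) -EFinM -EFinB -EFinD lee_fin.
(* Only half of the error integral occurs; being nonnegative, it is replaced by the whole. *)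
have : (0 <= fine (\int[mu d]_w (fine (shift_diff (tscale s w)) * K w)%:E))%R.
  by rewrite fine_ge0// integral_ge0// => w _; rewrite lee_fin mulr_ge0.
by lra.
Qed.

(** The dilation tends to 0 along 1 / (n + 1) in [plancherel_dilate]. The error integral vanishes in
    the limit: its integrand tends to 0 by [L2_translation] and is dominated by 4 times the squared
    norm times the Cauchy kernel, of mass 1. *)
Theorem plancherel_le :
  \int[mu d]_x (F x ^+ 2)%:E <= \int[mu d]_l (power_spectrum l)%:E.
Proof.
pose s (n : nat) : R := (n.+1%:R^-1)%R.
have s0 n : (0 < s n)%R by rewrite invr_gt0.
pose K := @tprod R poisson d.
have mK : measurable_fun setT K by apply: measurable_tprod; exact: measurable_poisson.
have K0 l : (0 <= K l)%R by apply: tprod_ge0; exact: poisson_ge0.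
have iK : \int[mu d]_w (K w)%:E = 1.
  have := @integral_tprod R poisson 1%R d measurable_poisson poisson_ge0.
  by rewrite expr1n; apply; exact: integral_poisson.
have sc : s n @[n --> \oo] --> (0:R)%R by exact: cvg_harmonic.
have E0 : \int[mu d]_w (shift_diff (tscale (s n) w) * (K w)%:E) @[n --> \oo] --> 0.
  apply: (cvg_integral0 (G := fun w => (4 * N2)%:E * (K w)%:E)).
  - move=> n; apply: emeasurable_funM; last exact/measurable_EFinP.
    by apply: measurable_shift_diff; exact: measurable_tscale.
  - by apply: measurable_funeM; exact/measurable_EFinP.
  - move=> n w; rewrite mule_ge0 ?shift_diff_ge0 ?lee_fin//=.
    by rewrite lee_wpmul2r ?lee_fin// EFinM N2E shift_diff_le.
  - rewrite ge0_integralZl_EFin//.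
    + by rewrite iK mule1 ltry.
    + by move=> w _; rewrite lee_fin.
    + exact/measurable_EFinP.
    + by rewrite mulr_ge0// fine_ge0 ?integral_ge0.
  - move=> w _; rewrite -[X in _ --> X](mul0e (K w)%:E).
    apply: cvgeZr => //; apply: L2_translation => //.
apply/lee_addgt0Pr => e e0.
have [N _ /(_ N (leqnn N)) /= EN] := cvge0_near e0 E0.
apply: le_trans (plancherel_dilate (s0 N)) _.
by apply: leeD.
Qed.

End transform.
End plancherel.

(** * Spectral bound for shifts *)

Section spectral_bound.
Context {R : realType}.
Local Open Scope ereal_scope.
Notation mu := (lebesgue_measureRd R).

Lemma norm_sin_le (x : R) : (`|sin x| <= `|x|)%R.
Proof.
wlog x0 : x / (0 <= x)%R.
  move=> H; have [|/ltW x0] := leP 0%R x; first exact: H.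
  by rewrite -normrN -[leRHS]normrN -sinN; apply: H; rewrite oppr_ge0.
have [c _] := @MVT_segment R sin cos 0%R x x0 (fun y _ => is_derive_sin y)
  (continuous_subspaceT (@continuous_sin R)).
by rewrite sin0 !subr0 => ->; rewrite normrM ler_piMl// cos_max.
Qed.

(** The left side is four times the squared sine of x / 2. *)
Lemma sub_cos_le_sqr (x : R) : (2 - 2 * cos x <= x ^+ 2)%R.
Proof.
have := norm_sin_le (x / 2)%R; rewrite -ler_sqr ?nnegrE// -!normrX !ger0_norm ?sqr_ge0//.
rewrite sin2cos2 => h.
have -> : cos x = (cos (x / 2) ^+ 2 *+ 2 - 1)%R.
  by rewrite -cos_mulr2n; congr cos; rewrite -mulr_natr; field.
have e : ((x / 2) ^+ 2 = x ^+ 2 / 4)%R by field.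
rewrite e in h; lra.
Qed.

Lemma dotp_ge0 d (x : d.-tuple R) : (0 <= dotp x x)%R.
Proof. by apply: sumr_ge0 => i _; rewrite -expr2 sqr_ge0. Qed.

Lemma enorm_sqr d (x : d.-tuple R) : (enorm x ^+ 2 = dotp x x)%R.
Proof. by rewrite sqr_sqrtr// dotp_ge0. Qed.

Lemma cauchy_schwarz d (x y : d.-tuple R) : (dotp x y ^+ 2 <= dotp x x * dotp y y)%R.
Proof.
have [y0|y0] := eqVneq (dotp y y) 0%R.
  have yi i : tnth y i = 0%R.
    apply/eqP; rewrite -sqrf_eq0 expr2; apply/eqP.
    have /psumr_eq0P := y0; apply => // j _.
    by rewrite -expr2 sqr_ge0.
  by rewrite y0 mulr0 /dotp big1 ?expr0n// => i _; rewrite yi mulr0.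
have yp : (0 < dotp y y)%R by rewrite lt_neqAle eq_sym y0 dotp_ge0.
(* The component of x orthogonal to y, multiplied by <y, y> to avoid a division. *)
have := dotp_ge0 (tadd (tscale (dotp y y) x) (tscale (- dotp x y) y)).
rewrite dotp_taddl !dotp_tscalel ![dotp _ (tadd _ _)]dotpC !dotp_taddl !dotp_tscalel.
rewrite (dotpC y x) => h.
have : (0 <= dotp y y * (dotp x x * dotp y y - dotp x y ^+ 2))%R by apply: le_trans h _; lra.
by rewrite pmulr_rge0// subr_ge0.
Qed.

Context {d : nat} (h : d.-tuple R -> R) (hi : (mu d).-integrable setT (EFin \o h)).
Context (h2 : \int[mu d]_x (h x ^+ 2)%:E < +oo).

Let mh : measurable_fun setT h.
Proof. exact/measurable_EFinP/measurable_int/hi. Qed.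

Let tscale1 (x : d.-tuple R) : tscale 1%R x = x.
Proof. by apply: eq_from_tnth => i; rewrite tnth_mktuple mul1r. Qed.

Lemma integral_tadd (f : d.-tuple R -> \bar R) (u : d.-tuple R) :
  (mu d).-integrable setT f -> \int[mu d]_x f (tadd x u) = \int[mu d]_x f x.
Proof.
move=> fi; rewrite -[RHS](integral_affine u (oner_neq0 R) fi) normr1 expr1n mul1e.
by under [RHS]eq_integral do rewrite tscale1.
Qed.

Lemma integrable_tadd (f : d.-tuple R -> \bar R) (u : d.-tuple R) :
  (mu d).-integrable setT f -> (mu d).-integrable setT (fun x => f (tadd x u)).
Proof.
move=> fi; have := integrable_affine u (oner_neq0 R) fi.
by under eq_fun do rewrite tscale1.
Qed.

Let hu_i u : (mu d).-integrable setT (EFin \o (fun x => h (tadd x u))).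
Proof. exact: (integrable_tadd u hi). Qed.

Let F u x := (h (tadd x u) - h x)%R.

Let Fi u : (mu d).-integrable setT (EFin \o F u).
Proof.
rewrite (_ : _ \o _ = fun x => (EFin \o (fun x => h (tadd x u))) x - (EFin \o h) x)//.
exact: integrableB.
Qed.

Let phase_tadd (x u l : d.-tuple R) : (phase (tadd x u) l = phase x l + phase u l)%R.
Proof. by rewrite /phase dotp_taddl mulrDr. Qed.

(** Translation by u multiplies the transform of h by exp(i phase u l); this is the real part of the
    product of that factor minus 1 with the transform of h. [sin_transform_shift] is the imaginary
    part, up to sign. *)
Lemma cos_transform_shift u l : cos_transform (F u) l =
  (cos_transform h l * (cos (phase u l) - 1) + sin_transform h l * sin (phase u l))%R.
Proof.
set c := cos (phase u l); set s := sin (phase u l).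
(* Chosen so that g (x + u) is h (x + u) times the cosine of the unshifted phase; its integral does
   not see the shift. *)
pose g y := c%:E * (h y * cos (phase y l))%:E + s%:E * (h y * sin (phase y l))%:E.
have ic := integrable_cos_transform hi l; have is' := integrable_sin_transform hi l.
have gi : (mu d).-integrable setT g by apply: integrableD => //; exact: integrableZl.
have ge : \int[mu d]_y g y = (c * cos_transform h l + s * sin_transform h l)%:E.
  rewrite integralD//; [|exact: integrableZl|exact: integrableZl].
  by rewrite !integralZl// -(cos_transformE hi) -(sin_transformE hi) -!EFinM.
apply: EFin_inj; rewrite (cos_transformE (Fi u)).
rewrite (eq_integral (fun x => g (tadd x u) - (h x * cos (phase x l))%:E)); last first.
  move=> x _; apply: (@congr1 _ _ EFin _ (c * (h (tadd x u) * cos (phase (tadd x u) l)) +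
    s * (h (tadd x u) * sin (phase (tadd x u) l)) - h x * cos (phase x l))%R).
  rewrite phase_tadd cosD sinD -/c -/s /F.
  have := cos2Dsin2 (phase u l); rewrite -/c -/s => e.
  transitivity (h (tadd x u) * cos (phase x l) * (c ^+ 2 + s ^+ 2) - h x * cos (phase x l))%R.
    by rewrite e; ring.
  ring.
rewrite integralB//; last exact: integrable_tadd.
rewrite integral_tadd// ge -(cos_transformE hi) -EFinB; congr EFin; ring.
Qed.

Lemma sin_transform_shift u l : sin_transform (F u) l =
  (sin_transform h l * (cos (phase u l) - 1) - cos_transform h l * sin (phase u l))%R.
Proof.
set c := cos (phase u l); set s := sin (phase u l).
pose g y := c%:E * (h y * sin (phase y l))%:E - s%:E * (h y * cos (phase y l))%:E.
have ic := integrable_cos_transform hi l; have is' := integrable_sin_transform hi l.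
have gi : (mu d).-integrable setT g by apply: integrableB => //; exact: integrableZl.
have ge : \int[mu d]_y g y = (c * sin_transform h l - s * cos_transform h l)%:E.
  rewrite integralB//; [|exact: integrableZl|exact: integrableZl].
  by rewrite !integralZl// -(cos_transformE hi) -(sin_transformE hi) -!EFinM.
apply: EFin_inj; rewrite (sin_transformE (Fi u)).
rewrite (eq_integral (fun x => g (tadd x u) - (h x * sin (phase x l))%:E)); last first.
  move=> x _; apply: (@congr1 _ _ EFin _ (c * (h (tadd x u) * sin (phase (tadd x u) l)) -
    s * (h (tadd x u) * cos (phase (tadd x u) l)) - h x * sin (phase x l))%R).
  rewrite phase_tadd cosD sinD -/c -/s /F.
  have := cos2Dsin2 (phase u l); rewrite -/c -/s => e.
  transitivity (h (tadd x u) * sin (phase x l) * (c ^+ 2 + s ^+ 2) - h x * sin (phase x l))%R.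
    by rewrite e; ring.
  ring.
rewrite integralB//; last exact: integrable_tadd.
rewrite integral_tadd// ge -(sin_transformE hi) -EFinB; congr EFin; ring.
Qed.

(** The factor is the squared modulus of exp(i phase u l) - 1. *)
Lemma power_spectrum_shift u l : power_spectrum (F u) l =
  (power_spectrum h l * (2 - 2 * cos (phase u l)))%R.
Proof.
rewrite /power_spectrum cos_transform_shift sin_transform_shift.
have := sin2cos2 (phase u l); set c := cos _; set s := sin _ => e.
transitivity ((cos_transform h l ^+ 2 + sin_transform h l ^+ 2) *
  ((c - 1) ^+ 2 + s ^+ 2))%R; first ring.
by rewrite e; ring.
Qed.

Lemma shift_diff_le_spectrum u : shift_diff h u <=
  \int[mu d]_l (power_spectrum h l * (2 - 2 * cos (phase u l)))%:E.
Proof.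
have := plancherel_le (Fi u).
under [X in _ -> _ <= X]eq_integral do rewrite -power_spectrum_shift.
apply; apply: le_lt_trans (shift_diff_le hi u) _.
by rewrite lte_mul_pinfty.
Qed.

(** Multiplied by r^d, this is the bracket of the theorem. *)
Definition spectral_energy (r : R) : \bar R :=
  (r ^- 2)%:E * \int[mu d]_(l in [set l | (enorm l <= r)%R])
     (power_spectrum h l * enorm l ^+ 2)%:E +
  \int[mu d]_(l in [set l | (r <= enorm l)%R]) (power_spectrum h l)%:E.

Lemma measurable_enorm : measurable_fun setT (@enorm R d).
Proof.
apply: (@measurableT_comp _ _ _ _ _ _ (@Num.sqrt R)); last exact: measurable_dotp.
exact: continuous_measurable_fun (@sqrt_continuous R).
Qed.

Lemma measurable_enorm_le r : measurable [set l : d.-tuple R | (enorm l <= r)%R].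
Proof.
rewrite -[X in measurable X]setTI.
by have := measurable_enorm measurableT (measurable_itv `]-oo, r]); rewrite set_itvE.
Qed.

Lemma measurable_enorm_ge r : measurable [set l : d.-tuple R | (r <= enorm l)%R].
Proof.
rewrite -[X in measurable X]setTI.
by have := measurable_enorm measurableT (measurable_itv `[r, +oo[); rewrite set_itvE.
Qed.

Lemma shift_diff_le_energy (r : R) (v : d.-tuple R) : (0 < r)%R ->
  shift_diff h (tscale r^-1 v) <= (4 * pi ^+ 2 * dotp v v + 4)%:E * spectral_energy r.
Proof.
move=> r0; apply: le_trans (shift_diff_le_spectrum _) _.
(* One constant for both ranges: the first term serves low frequencies, through [sub_cos_le_sqr] and
   [cauchy_schwarz], and the 4 serves high ones, where 2 - 2 cos is at most 4. *)
set M : R := (4 * pi ^+ 2 * dotp v v + 4)%R; set u := tscale r^-1 v.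
have mth := measurable_power_spectrum hi.
have mE : measurable_fun setT (fun l => (power_spectrum h l)%:E) by exact/measurable_EFinP.
have mEn : measurable_fun setT (fun l => (power_spectrum h l * enorm l ^+ 2)%:E).
  by apply/measurable_EFinP; apply: measurable_funM => //; apply: measurable_funX;
    exact: measurable_enorm.
have th0 l := power_spectrum_ge0 h l.
have M0 : (4 <= M)%R.
  by rewrite lerDr mulr_ge0 ?dotp_ge0// mulr_ge0// sqr_ge0.
have M0' : (0 <= M)%R by apply: le_trans M0.
pose f l := (power_spectrum h l * (2 - 2 * cos (phase u l)))%:E.
have mf : measurable_fun setT f.
  apply/measurable_EFinP; apply: measurable_funM => //; apply: measurable_funB => //.
  by apply: measurable_funM => //; apply: measurable_cos; exact: measurable_phase.
have f0 l : 0 <= f l.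
  by rewrite lee_fin mulr_ge0// subr_ge0 ler_piMr// cos_le1.
have mD := measurable_enorm_le r; set D := [set l | _] in mD.
have mD2 := measurable_enorm_ge r; set D2 := [set l | _] in mD2.
rewrite -(setUv D) ge0_integral_setU//=; last 4 first.
- exact: measurableC.
- by rewrite setUv.
- by move=> l _; exact: f0.
- by rewrite disj_set2E setICr eqxx.
rewrite /spectral_energy -/D -/D2 ge0_muleDr ?mule_ge0 ?integral_ge0//; last 3 first.
- by rewrite lee_fin invr_ge0 exprn_ge0// ltW.
- by move=> l _; rewrite lee_fin mulr_ge0// sqr_ge0.
- by move=> l _; rewrite lee_fin.
apply: leeD.
  rewrite muleA -EFinM -ge0_integralZl_EFin//; last 3 first.
  - by move=> l _; rewrite lee_fin mulr_ge0// sqr_ge0.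
  - exact: measurable_funTS.
  - by rewrite mulr_ge0// invr_ge0 exprn_ge0// ltW.
  apply: ge0_le_integral => //.
  - by move=> l _; exact: f0.
  - exact: measurable_funTS.
  - by apply: measurable_funeM; exact: measurable_funTS.
  - move=> l _; rewrite -EFinM lee_fin mulrCA ler_wpM2l//.
    apply: le_trans (sub_cos_le_sqr _) _.
    rewrite /phase /u dotp_tscalel enorm_sqr !exprMn exprVn.
    have cs := cauchy_schwarz v l.
    have ri0 : (0 <= r ^- 2)%R by rewrite invr_ge0 sqr_ge0.
    have p0 : (0 <= 4 * pi ^+ 2 * r ^- 2 :> R)%R.
      by apply: mulr_ge0 => //; apply: mulr_ge0 => //; exact: sqr_ge0.
    have := ler_wpM2l p0 cs.
    have : (0 <= 4 * r ^- 2 * dotp l l)%R.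
      by apply: mulr_ge0; [apply: mulr_ge0|exact: dotp_ge0].
    rewrite /M; set q := (r ^- 2)%R; set w := pi; lra.
(* The complement of the closed ball is enlarged by its sphere, which belongs to both ranges of
   [spectral_energy]. *)
apply: (@le_trans _ _ (\int[mu d]_(l in D2) (M%:E * (power_spectrum h l)%:E))).
  apply: (@le_trans _ _ (\int[mu d]_(l in ~` D) (M%:E * (power_spectrum h l)%:E))).
    apply: ge0_le_integral => //.
    - exact: measurableC.
    - by move=> l _; exact: f0.
    - exact: measurable_funTS.
    - by apply: measurable_funeM; exact: measurable_funTS.
    - move=> l _; rewrite -EFinM lee_fin mulrC ler_wpM2r//.
      apply: le_trans M0; have := cos_geN1 (phase u l); lra.
  apply: ge0_subset_integral => //.
  - exact: measurableC.
  - by apply: measurable_funeM; exact: measurable_funTS.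
  - by move=> l _; rewrite mule_ge0// lee_fin.
  - by move=> l /negP; rewrite -ltNge => /ltW.
rewrite ge0_integralZl_EFin//.
- by move=> l _; rewrite lee_fin.
- exact: measurable_funTS.
Qed.

End spectral_bound.

(** * Lattice sums of Gaussians *)

Section lattice_gauss.
Context {R : realType}.
Local Open Scope ereal_scope.
Notation leb := (@lebesgue_measure R).
Notation mu := (lebesgue_measureRd R).
Local Notation T := (measurableTypeR R).

Definition gauss1 (c : R) (x : R) : R := expR (- (c * x ^+ 2)).
(** The square root of pi / c, the total mass of [gauss1 c]. *)
Definition gauss1_integral (c : R) : R := ((Num.sqrt c)^-1 * Num.sqrt pi)%R.
Definition gauss (c : R) d (x : d.-tuple R) : R := expR (- (c * dotp x x)).

Lemma gauss_ge0 c d (x : d.-tuple R) : (0 <= gauss c x)%R.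
Proof. exact: expR_ge0. Qed.

Lemma measurable_gauss1 c : measurable_fun setT (gauss1 c : T -> R).
Proof.
apply: (measurableT_comp (@measurable_expR R)); apply: measurable_funN.
by apply: measurable_funM => //; exact: measurable_funX.
Qed.

Lemma measurable_gauss {disp} {X : measurableType disp} c d (f : X -> d.-tuple R) :
  measurable_fun setT f -> measurable_fun setT (fun x => gauss c (f x)).
Proof.
move=> mf; apply: (measurableT_comp (@measurable_expR R)); apply: measurable_funN.
by apply: measurable_funM => //; exact: measurable_dotp.
Qed.

Lemma integral_gauss1 c : (0 < c)%R ->
  \int[leb]_x (gauss1 c x)%:E = (gauss1_integral c)%:E.
Proof.
move=> c0; have sc0 : (0 < Num.sqrt c)%R by rewrite sqrtr_gt0.
have mg : measurable_fun setT (fun x : T => (gauss_fun x)%:E).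
  by apply/measurable_EFinP; exact: measurable_gauss_fun.
have := @ge0_integral_affine1 R (Num.sqrt c) 0%R _ (lt0r_neq0 sc0) mg.
rewrite integralT_gauss => /(_ (fun x => gauss_fun_ge0 x)).
rewrite gtr0_norm// /gauss1_integral EFinM => <-; rewrite muleA -EFinM mulVf ?lt0r_neq0//.
rewrite mul1e; apply: eq_integral => x _.
by rewrite /gauss1 /gauss_fun addr0 exprMn sqr_sqrtr// ltW.
Qed.

Lemma gauss_tprod c d (x : d.-tuple R) : gauss c x = tprod (gauss1 c) x.
Proof.
rewrite /gauss /tprod /dotp mulr_sumr -sumrN (big_morph (@expR R) (@expRD R) (@expR0 R)).
by apply: eq_bigr => i _; rewrite /gauss1 expr2.
Qed.

Lemma integral_gauss c d : (0 < c)%R ->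
  \int[mu d]_x (gauss c x)%:E = (gauss1_integral c ^+ d)%:E.
Proof.
move=> c0; rewrite (eq_integral (fun x => (tprod (gauss1 c) x)%:E)).
  apply: integral_tprod; [exact: measurable_gauss1| |exact: integral_gauss1].
  by move=> x; exact: expR_ge0.
by move=> x _; rewrite gauss_tprod.
Qed.

(** Half of the exponent absorbs the quadratic factor, because t exp(-t) is at most 1 at t = c |x|^2
    / 2; the other half remains for integration. *)
Lemma gauss_moment_le c d (A B : R) (x : d.-tuple R) : (0 < c)%R -> (0 <= A)%R -> (0 <= B)%R ->
  (gauss c x * (A * dotp x x + B) <= (2 * A / c + B) * gauss (c / 2) x)%R.
Proof.
move=> c0 A0 B0; set q := dotp x x; have q0 : (0 <= q)%R := dotp_ge0 x.
have -> : gauss c x = (gauss (c / 2) x * gauss (c / 2) x)%R.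
  by rewrite /gauss -expRD -/q; congr expR; field.
set g := gauss (c / 2) x; have g0 : (0 <= g)%R by exact: expR_ge0.
have g1 : (g <= 1)%R.
  by rewrite -expR0 ler_expR oppr_le0 mulr_ge0// divr_ge0// ltW.
have gq : (g * (c / 2 * q) <= 1)%R.
  have e1 := expR_ge1Dx (c / 2 * q).
  rewrite /g /gauss -/q expRN mulrC ler_pdivrMr ?expR_gt0// mul1r.
  by apply: le_trans e1; rewrite lerDr.
have gq' : (g * q <= 2 / c)%R.
  have -> : (g * q = g * (c / 2 * q) * (2 / c))%R by field; exact: lt0r_neq0.
  by rewrite ler_piMl// divr_ge0// ltW.
rewrite -mulrA mulrC; apply: ler_wpM2r => //.
rewrite mulrDr; apply: lerD; last by rewrite ler_piMl.
have -> : (2 * A / c = A * (2 / c))%R by ring.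
by rewrite mulrCA ler_wpM2l.
Qed.

Definition lattice d (n : d.-tuple int) : d.-tuple R :=
  [tuple (tnth n i)%:~R | i < d].
Definition tsub d (x y : d.-tuple R) : d.-tuple R := tadd x (tscale (-1) y).

Lemma tnth_tsub d (x y : d.-tuple R) i : tnth (tsub x y) i = (tnth x i - tnth y i)%R.
Proof. by rewrite !tnth_mktuple mulN1r. Qed.

Lemma taddK d (x y : d.-tuple R) : tsub (tadd x y) y = x.
Proof. by apply: eq_from_tnth => i; rewrite tnth_tsub tnth_mktuple addrK. Qed.

Lemma measurable_tsub {disp} {X : measurableType disp} d (f g : X -> d.-tuple R) :
  measurable_fun setT f -> measurable_fun setT g ->
  measurable_fun setT (fun x => tsub (f x) (g x)).
Proof. by move=> mf mg; apply: measurable_tadd => //; exact: measurable_tscale. Qed.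

Let unit_itv (k : int) : set R := `[k%:~R, (k%:~R + 1)%R[%classic.

Let cell d (n : d.-tuple int) : set (d.-tuple R) :=
  [set x | forall i, unit_itv (tnth n i) (tnth x i)].

Let measurable_cell d (n : d.-tuple int) : measurable (cell n).
Proof.
rewrite (_ : cell n = \bigcap_(i in [set: 'I_d])
   (@tnth d R ^~ i @^-1` unit_itv (tnth n i))).
  apply: fin_bigcap_measurable => // i _.
  by rewrite -[X in measurable X]setTI; apply: measurable_tnth => //; exact: measurable_itv.
by apply/seteqP; split => x /= xA => [i _|i]; exact: xA.
Qed.

Let mu_cell d (n : d.-tuple int) : mu d (cell n) = 1.
Proof.
rewrite (@lebesgue_measureRd_box R d (fun i => unit_itv (tnth n i))); last first.
  by move=> i; exact: measurable_itv.
rewrite big1// => i _.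
rewrite /unit_itv lebesgue_measure_itv /= lte_fin ltrDl ltr01 -EFinB; congr EFin; ring.
Qed.

Let cell_floor d (n : d.-tuple int) x : cell n x -> n = [tuple Num.floor (tnth x i) | i < d].
Proof.
move=> nx; apply: eq_from_tnth => i; rewrite tnth_mktuple; apply/esym/floor_def.
by have := nx i; rewrite /unit_itv /= in_itv /= intrD.
Qed.

(** The total mass of the wider Gaussian that dominates the lattice sum; it does not depend on the
    centre. *)
Definition lattice_gauss_bound (c : R) d : R :=
  (expR (c * d%:R) * gauss1_integral (c / 2) ^+ d)%R.

(* For x in the unit cell at n, |z - x|^2 <= 2 |z - n|^2 + 2 d, so each summand is
   at most the integral over its cell of a wider Gaussian. *)
Lemma lattice_gauss_sum_le (c : R) d (s : seq (d.-tuple int)) (z : d.-tuple R) :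
  (0 < c)%R -> uniq s ->
  (\sum_(n <- s) gauss c (tsub z (lattice n)) <= lattice_gauss_bound c d)%R.
Proof.
move=> c0 us.
have c20 : (0 < c / 2)%R by rewrite divr_gt0.
pose H x : R := (expR (c * d%:R) * gauss (c / 2) (tsub z x))%R.
have H0 x : (0 <= H x)%R by rewrite mulr_ge0 ?expR_ge0.
have mgz : measurable_fun setT (fun x => gauss (c / 2) (tsub z x)).
  by apply: measurable_gauss; exact: measurable_tsub.
have IH : \int[mu d]_x (H x)%:E = (lattice_gauss_bound c d)%:E.
  under eq_integral do rewrite EFinM.
  rewrite ge0_integralZl_EFin ?expR_ge0//; last 2 first.
  - by move=> x _; rewrite lee_fin gauss_ge0.
  - exact/measurable_EFinP.
  rewrite /lattice_gauss_bound EFinM -(integral_gauss d c20); congr (_ * _).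
  have N10 : (-1 != 0 :> R)%R by rewrite oppr_eq0 oner_neq0.
  rewrite -[RHS](ge0_integral_affine z N10); last 2 first.
  - by apply/measurable_EFinP; exact: measurable_gauss.
  - by move=> x; rewrite lee_fin gauss_ge0.
  rewrite normrN normr1 expr1n mul1e; apply: eq_integral => x _.
  by rewrite /tsub taddC.
(* Per coordinate, (z_i - x_i)^2 is at most 2 (z_i - n_i)^2 + 2. Multiplied by c / 2 and summed, the
   last term gives the factor exp(c d). *)
have key n x : cell n x -> (gauss c (tsub z (lattice n)) <= H x)%R.
  move=> nx; rewrite /H /gauss -expRD ler_expR.
  suff : (c / 2 * dotp (tsub z x) (tsub z x) <=
      c * d%:R + c * dotp (tsub z (lattice n)) (tsub z (lattice n)))%R by lra.
  have -> : (c * d%:R + c * dotp (tsub z (lattice n)) (tsub z (lattice n)) =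
     c / 2 * \sum_(i < d) (2 + 2 * (tnth z i - tnth (lattice n) i) ^+ 2))%R.
    rewrite big_split /= sumr_const card_ord -mulr_sumr.
    under [X in _ = (_ * (_ + 2 * X))%R]eq_bigr do rewrite -tnth_tsub expr2.
    by rewrite -/(dotp (tsub z (lattice n)) (tsub z (lattice n))) -mulr_natr; field.
  apply: ler_wpM2l; first exact: ltW.
  apply: ler_sum => i _; rewrite !tnth_tsub.
  have := nx i; rewrite /unit_itv /= in_itv /= => /andP[h1 h2].
  rewrite [tnth (lattice n) i]tnth_mktuple; set m := ((tnth n i)%:~R : R) in h1 h2 *.
  set y := tnth x i in h1 h2 *; set w := tnth z i.
  have : ((y - m) ^+ 2 <= 1)%R by rewrite expr_le1// ?subr_ge0//; lra.
  have := sqr_ge0 ((w - m) + (y - m))%R; lra.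
rewrite -lee_fin -sumEFin -IH.
have -> : (\sum_(n <- s) (gauss c (tsub z (lattice n)))%:E)%R =
    \int[mu d]_x (\sum_(n <- s) ((gauss c (tsub z (lattice n)))%:E * (\1_(cell n) x)%:E)).
  rewrite ge0_integral_sum//.
  - apply: eq_bigr => n _; rewrite ge0_integralZl_EFin ?gauss_ge0//.
      rewrite integral_indic//; last exact: measurable_cell.
      by rewrite [X in _ * X](_ : _ = 1) ?mule1// setIT; exact: mu_cell.
    by apply/measurable_EFinP; apply: measurable_indic; exact: measurable_cell.
  - move=> n; apply: measurable_funeM; apply/measurable_EFinP.
    by apply: measurable_indic; exact: measurable_cell.
  - by move=> n x _; rewrite mule_ge0// lee_fin ?gauss_ge0.
apply: ge0_le_integral => //.
- by move=> x _; apply: sume_ge0 => n _; rewrite mule_ge0// lee_fin ?gauss_ge0.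
- apply: emeasurable_sum => n; apply: measurable_funeM.
  by apply/measurable_EFinP; apply: measurable_indic; exact: measurable_cell.
- by apply/measurable_EFinP; exact: measurable_funM.
- move=> x _; rewrite (eq_bigr (fun n => ((gauss c (tsub z (lattice n))) * \1_(cell n) x)%:E))//.
  (* Only the cell indexed by the coordinatewise floor contains x, so at most one summand survives
     in a duplicate-free list. *)
  rewrite sumEFin lee_fin; set a := [tuple Num.floor (tnth x i) | i < d].
  apply: (@le_trans _ _ (\sum_(n <- s) (if n == a then H x else 0)))%R.
    apply: ler_sum => n _; rewrite indicE.
    have [/set_mem nx|_] := boolP (x \in cell n).
      have -> : n == a by apply/eqP; exact: cell_floor.
      by rewrite mulr1; exact: key.
    by rewrite mulr0; case: ifP.
  rewrite -big_mkcond big_const_seq count_uniq_mem//.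
  by case: (_ \in _) => //=; rewrite addr0.
Qed.

Context (a : R) (a0 : (0 < a)%R).

Definition gauss_density_const d : R := ((a * pi) `^ (- (d%:R / 2)))%R.

Lemma gaussian_densityE d (x : d.-tuple R) :
  gaussian_density a x = (gauss_density_const d * gauss a^-1 x)%R.
Proof. by rewrite /gaussian_density enorm_sqr /gauss mulrC [in RHS]mulrC [(a^-1 * _)%R]mulrC. Qed.

Lemma gauss_density_const_gt0 d : (0 < gauss_density_const d)%R.
Proof. by rewrite powR_gt0// mulr_gt0// pi_gt0. Qed.

Lemma gaussian_density_ge0 d (x : d.-tuple R) : (0 <= gaussian_density a x)%R.
Proof. by rewrite gaussian_densityE mulr_ge0 ?gauss_ge0// ltW// gauss_density_const_gt0. Qed.

Lemma measurable_gaussian_density {disp} {X : measurableType disp} d (f : X -> d.-tuple R) :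
  measurable_fun setT f -> measurable_fun setT (fun x => gaussian_density a (f x)).
Proof.
move=> mf; under eq_fun do rewrite gaussian_densityE.
by apply: measurable_funM => //; exact: measurable_gauss.
Qed.

Lemma lattice_density_sum_le d (s : seq (d.-tuple int)) (x : d.-tuple R) : uniq s ->
  (\sum_(n <- s) gaussian_density a (tsub x (lattice n)) <=
   gauss_density_const d * lattice_gauss_bound a^-1 d)%R.
Proof.
move=> us; under eq_bigr do rewrite gaussian_densityE.
rewrite -mulr_sumr ler_wpM2l//; first exact: ltW (gauss_density_const_gt0 d).
by apply: lattice_gauss_sum_le => //; rewrite invr_gt0.
Qed.

(** The squared distances of x and y to z add up to half of |x - y|^2 plus twice the squared
    distance of the midpoint to z; division by [a] gives the two exponents. *)
Lemma gauss_parallelogram d (x y z : d.-tuple R) :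
  (gauss a^-1 (tsub x z) * gauss a^-1 (tsub y z) =
   gauss (2 * a)^-1 (tsub x y) * gauss (2 / a) (tsub (tscale 2^-1 (tadd x y)) z))%R.
Proof.
rewrite /gauss -!expRD; congr expR.
rewrite /dotp !mulr_sumr -!sumrN -!big_split; apply: eq_bigr => i _ /=.
rewrite !tnth_tsub [tnth (tscale _ _) i]tnth_mktuple [tnth (tadd _ _) i]tnth_mktuple.
by field; exact: lt0r_neq0.
Qed.

Lemma lattice_density_pair_sum_le d (s : seq (d.-tuple int)) (x y : d.-tuple R) : uniq s ->
  (\sum_(n <- s) gaussian_density a (tsub x (lattice n)) * gaussian_density a (tsub y (lattice n))
   <= gauss_density_const d ^+ 2 * lattice_gauss_bound (2 / a) d *
      gauss (2 * a)^-1 (tsub x y))%R.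
Proof.
move=> us; pose m := tscale 2^-1 (tadd x y).
rewrite (eq_bigr (fun n => gauss_density_const d ^+ 2 * gauss (2 * a)^-1 (tsub x y) *
    gauss (2 / a) (tsub m (lattice n))))%R; last first.
  by move=> n _; rewrite !gaussian_densityE mulrACA gauss_parallelogram expr2 mulrA.
rewrite -mulr_sumr [leRHS]mulrAC; apply: ler_wpM2l.
  by rewrite mulr_ge0 ?gauss_ge0// sqr_ge0.
by apply: lattice_gauss_sum_le => //; rewrite divr_gt0.
Qed.

End lattice_gauss.

(** * Spectral bound for sums of double integrals over lattice points *)

Section pair_variance.
Context {R : realType}.
Local Open Scope ereal_scope.
Notation mu := (lebesgue_measureRd R).
Context (a : R) (a0 : (0 < a)%R) {d : nat} (h : d.-tuple R -> R).
Context (hi : (mu d).-integrable setT (EFin \o h)).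
Context (h2 : \int[mu d]_x (h x ^+ 2)%:E < +oo).

Let mh : measurable_fun setT h.
Proof. exact/measurable_EFinP/measurable_int/hi. Qed.

Definition lattice_point (r : R) (n : d.-tuple int) (x : d.-tuple R) : d.-tuple R :=
  tscale r^-1 (tadd (lattice n) x).

Definition pair_const : R := (gauss_density_const a d ^+ 2 * lattice_gauss_bound (2 / a) d)%R.

(** [pair_const] comes from the lattice sum. The middle factor is that of [gauss_moment_le] with A =
    4 pi^2, B = 4 and c = 1 / (2 a), and the last is the mass of the Gaussian left over. *)
Definition variance_const : R :=
  (pair_const * (2 * (4 * pi ^+ 2) / (2 * a)^-1 + 4) * gauss1_integral ((2 * a)^-1 / 2) ^+ d)%R.

Lemma pair_const_ge0 : (0 <= pair_const)%R.
Proof.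
apply: mulr_ge0; first exact: sqr_ge0.
apply: mulr_ge0; first exact: expR_ge0.
by apply: exprn_ge0; apply: mulr_ge0; rewrite ?invr_ge0 sqrtr_ge0.
Qed.

(** Origin of the factor r^d of the theorem: the substitution of r x for x. *)
Lemma integral_scaled_shift (r : R) (v : d.-tuple R) : (0 < r)%R ->
  \int[mu d]_x ((h (tscale r^-1 x) - h (tscale r^-1 (tadd v x))) ^+ 2)%:E =
  (r ^+ d)%:E * shift_diff h (tscale r^-1 v).
Proof.
move=> r0.
have mg : measurable_fun setT (fun x => h (tscale r^-1 x)).
  by apply: (measurableT_comp mh); exact: measurable_tscale.
have mf : measurable_fun setT
    (fun x => ((h (tscale r^-1 x) - h (tscale r^-1 (tadd v x))) ^+ 2)%:E).
  apply/measurable_EFinP; apply: measurable_funX; apply: measurable_funB => //.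
  by apply: (measurableT_comp mg); exact: measurable_tadd.
rewrite -(ge0_integral_tscale r0 mf); last by move=> x; rewrite lee_fin sqr_ge0.
congr (_ * _); apply: eq_integral => x _.
have -> : tscale r^-1 (tscale r x) = x.
  by apply: eq_from_tnth => i; rewrite !tnth_mktuple mulKf// lt0r_neq0.
have -> : tscale r^-1 (tadd v (tscale r x)) = tadd x (tscale r^-1 v).
  apply: eq_from_tnth => i; rewrite !tnth_mktuple.
  by field; exact: lt0r_neq0.
by rewrite -opprB sqrrN.
Qed.

(** [shift_diff_le_energy] grows like |v|^2; the Gaussian weight absorbs this growth and still has
    finite mass. *)
Lemma integral_gauss_shift_diff_le (K c r : R) : (0 <= K)%R -> (0 < c)%R -> (0 < r)%R ->
  \int[mu d]_v ((K * gauss c v)%:E * ((r ^+ d)%:E * shift_diff h (tscale r^-1 v))) <=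
  (K * (2 * (4 * pi ^+ 2) / c + 4) * gauss1_integral (c / 2) ^+ d * r ^+ d)%:E *
    spectral_energy h r.
Proof.
move=> K0 c0 r0.
have rd0 : (0 <= r ^+ d)%R by rewrite exprn_ge0// ltW.
have SE0 : 0 <= spectral_energy h r.
  apply: adde_ge0.
    rewrite mule_ge0//; first by rewrite lee_fin invr_ge0 sqr_ge0.
    by apply: integral_ge0 => l _; rewrite lee_fin; apply: mulr_ge0;
      [exact: power_spectrum_ge0|exact: sqr_ge0].
  by apply: integral_ge0 => l _; rewrite lee_fin power_spectrum_ge0.
pose M : R := (2 * (4 * pi ^+ 2) / c + 4)%R.
have A0 : (0 <= 4 * pi ^+ 2 :> R)%R by apply: mulr_ge0 => //; exact: sqr_ge0.
have M0 : (0 <= M)%R.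
  by apply: addr_ge0 => //; apply: divr_ge0; [exact: mulr_ge0|exact: ltW].
have mgs (c' : R) : measurable_fun setT (fun v : d.-tuple R => (gauss c' v)%:E).
  by apply/measurable_EFinP; exact: measurable_gauss.
have -> : (K * M * gauss1_integral (c / 2) ^+ d * r ^+ d)%:E * spectral_energy h r =
    \int[mu d]_v ((K * M * r ^+ d)%:E * (gauss (c / 2) v)%:E * spectral_energy h r).
  rewrite ge0_integralZr//; last 2 first.
  - by apply: measurable_funeM; exact: mgs.
  - by move=> v _; rewrite mule_ge0// lee_fin ?gauss_ge0// !mulr_ge0.
  rewrite ge0_integralZl_EFin//; last 2 first.
  - by move=> v _; rewrite lee_fin gauss_ge0.
  - by rewrite !mulr_ge0.
  rewrite integral_gauss ?divr_gt0// -EFinM; congr (_%:E * _).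
  ring.
apply: ge0_le_integral => //.
- move=> v _; rewrite mule_ge0 ?lee_fin ?mulr_ge0 ?gauss_ge0//.
  by rewrite mule_ge0 ?lee_fin// shift_diff_ge0.
- apply: emeasurable_funM.
    by apply/measurable_EFinP; apply: measurable_funM => //; exact: measurable_gauss.
  apply: measurable_funeM.
  by apply: measurable_shift_diff; [exact: hi|exact: measurable_tscale].
- by apply: emeasurable_funM => //; apply: measurable_funeM; exact: mgs.
move=> v _.
have sle := shift_diff_le_energy hi h2 v r0.
apply: (@le_trans _ _ ((K * gauss c v)%:E *
    ((r ^+ d)%:E * ((4 * pi ^+ 2 * dotp v v + 4)%:E * spectral_energy h r)))).
  apply: lee_wpmul2l; first by rewrite lee_fin mulr_ge0 ?gauss_ge0.
  exact: lee_wpmul2l.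
rewrite !muleA; apply: lee_wpmul2r => //.
rewrite -!EFinM lee_fin.
have gm := gauss_moment_le v c0 A0 (ler0n R 4).
have := ler_wpM2l (mulr_ge0 K0 rd0) gm; rewrite -/M => H.
by apply: le_trans (le_trans H _); rewrite le_eqVlt; apply/orP; left; apply/eqP; ring.
Qed.

Lemma pair_variance_le (r : R) (s : seq (d.-tuple int)) : (0 < r)%R -> uniq s ->
  \sum_(n <- s) \int[mu d]_x \int[mu d]_y
    ((h (lattice_point r n x) - h (lattice_point r n y)) ^+ 2 *
     (gaussian_density a x * gaussian_density a y))%:E
  <= (variance_const * r ^+ d)%:E * spectral_energy h r.
Proof.
move=> r0 us.
have pair_sum x y : (\sum_(n <- s) gaussian_density a (tsub x (lattice n)) *
    gaussian_density a (tsub y (lattice n)) <= pair_const * gauss (2 * a)^-1 (tsub x y))%R.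
  exact: lattice_density_pair_sum_le.
have c0 : (0 < (2 * a)^-1)%R by rewrite invr_gt0 mulr_gt0.
rewrite /variance_const.
move: (2 * a)%R^-1%R c0 pair_sum => c c0 pair_sum.
move: pair_const pair_const_ge0 pair_sum => K K0 pair_sum.
have gd0 (x : d.-tuple R) := gaussian_density_ge0 a0 x.
pose g x := h (tscale r^-1 x).
have mg disp (X : measurableType disp) (f : X -> d.-tuple R) : measurable_fun setT f ->
    measurable_fun setT (fun x => g (f x)).
  by move=> mf; apply: (measurableT_comp mh); exact: measurable_tscale.
have mgg disp (X : measurableType disp) (f f' : X -> d.-tuple R) :
    measurable_fun setT f -> measurable_fun setT f' ->
    measurable_fun setT (fun x => (g (f x) - g (f' x)) ^+ 2)%R.
  by move=> mf mf'; apply: measurable_funX; apply: measurable_funB; exact: mg.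
(* Recentring at n moves the lattice point from h to the densities, so the sum over n acts on the
   densities alone. *)
pose q (n : d.-tuple int) (p : d.-tuple R * d.-tuple R) : \bar R := ((g p.1 - g p.2) ^+ 2 *
  (gaussian_density a (tsub p.1 (lattice n)) * gaussian_density a (tsub p.2 (lattice n))))%:E.
have q0 n p : 0 <= q n p by rewrite lee_fin; apply: mulr_ge0; [exact: sqr_ge0|exact: mulr_ge0].
have mq n : measurable_fun setT (q n).
  apply/measurable_EFinP; apply: measurable_funM; first exact: mgg.
  by apply: measurable_funM; apply: measurable_gaussian_density => //; exact: measurable_tsub.
have mqx n x : measurable_fun setT (fun y => q n (x, y)).
  exact: (measurableT_comp (mq n) (measurable_pair1 x)).
have mqF n : measurable_fun setT (fun x => \int[mu d]_y q n (x, y)).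
  exact: (measurable_integral_r (mu d) (mq n)).
have T1 n : \int[mu d]_x \int[mu d]_y
    ((h (lattice_point r n x) - h (lattice_point r n y)) ^+ 2 *
     (gaussian_density a x * gaussian_density a y))%:E =
    \int[mu d]_x \int[mu d]_y q n (x, y).
  rewrite -[RHS](ge0_integral_tadd (lattice n) (mqF n)); last first.
    by move=> x; exact: integral_ge0.
  apply: eq_integral => x _.
  rewrite -[RHS](ge0_integral_tadd (lattice n) (mqx n _) (fun y => q0 n _)).
  apply: eq_integral => y _; rewrite /q /= !taddK /g /lattice_point.
  by rewrite ![tadd (lattice n) _]taddC.
under eq_bigr do rewrite T1.
rewrite -ge0_integral_sum//; last by move=> n x _; exact: integral_ge0.
under eq_integral => x _ do rewrite -ge0_integral_sum//.
pose Phi (p : d.-tuple R * d.-tuple R) : \bar R :=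
  ((g p.1 - g p.2) ^+ 2 * (K * gauss c (tsub p.1 p.2)))%:E.
have Phi0 p : 0 <= Phi p.
  rewrite lee_fin; apply: mulr_ge0; first exact: sqr_ge0.
  by apply: mulr_ge0 => //; exact: gauss_ge0.
have mPhi : measurable_fun setT Phi.
  apply/measurable_EFinP; apply: measurable_funM; first exact: mgg.
  by apply: measurable_funM => //; apply: measurable_gauss; exact: measurable_tsub.
have mPhix x : measurable_fun setT (fun y => Phi (x, y)).
  exact: (measurableT_comp mPhi (measurable_pair1 x)).
have T3 : \int[mu d]_x \int[mu d]_y (\sum_(n <- s) q n (x, y)) <=
    \int[mu d]_x \int[mu d]_y Phi (x, y).
  apply: ge0_le_integral => //.
  - by move=> x _; apply: integral_ge0 => y _; exact: sume_ge0.
  - apply: (@measurable_integral_r _ _ _ _ _ (mu d) (fun p => \sum_(n <- s) q n p)).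
    exact: emeasurable_sum.
  - exact: (measurable_integral_r (mu d) mPhi).
  move=> x _; apply: ge0_le_integral => //.
  - by move=> y _; exact: sume_ge0.
  - exact: emeasurable_sum.
  move=> y _; rewrite /q sumEFin lee_fin -mulr_sumr.
  by apply: ler_wpM2l; [exact: sqr_ge0|exact: pair_sum].
apply: le_trans T3 _.
(* With v = y - x as second variable the Gaussian weight no longer involves x, and integrating over
   x first produces [shift_diff]. *)
pose Psi (p : d.-tuple R * d.-tuple R) : \bar R :=
  ((g p.1 - g (tadd p.2 p.1)) ^+ 2 * (K * gauss c p.2))%:E.
have Psi0 p : 0 <= Psi p.
  rewrite lee_fin; apply: mulr_ge0; first exact: sqr_ge0.
  by apply: mulr_ge0 => //; exact: gauss_ge0.
have mPsi : measurable_fun setT Psi.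
  apply/measurable_EFinP; apply: measurable_funM.
    by apply: mgg => //; exact: measurable_tadd.
  by apply: measurable_funM => //; exact: measurable_gauss.
have T4 : \int[mu d]_x \int[mu d]_y Phi (x, y) = \int[mu d]_x \int[mu d]_v Psi (x, v).
  apply: eq_integral => x _; rewrite -(ge0_integral_tadd x (mPhix x) (fun y => Phi0 _)).
  apply: eq_integral => v _; rewrite /Phi /Psi /=; congr ((_ * (_ * _))%R%:E).
  rewrite /gauss; congr (expR (- (_ * _)))%R.
  by apply: eq_bigr => i _; rewrite !tnth_tsub tnth_mktuple; ring.
rewrite T4 (fubini_tonelli Psi mPsi Psi0).
under eq_integral.
  move=> v _; rewrite /Psi /=.
  under eq_integral do rewrite mulrC EFinM.
  rewrite ge0_integralZl_EFin; last 4 first.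
  - exact: measurableT.
  - by move=> x _; rewrite lee_fin sqr_ge0.
  - apply/measurable_EFinP; apply: (mgg _ _ (fun x => x) (fun x => tadd v x)).
      exact: measurable_id.
    exact: measurable_tadd.
  - exact: mulr_ge0 K0 (gauss_ge0 c v).
  rewrite /g integral_scaled_shift; last exact: r0.
  over.
exact: integral_gauss_shift_diff_le.
Qed.

End pair_variance.

(** * Densities, independence and countable sums *)

Section probability_lemmas.
Context {R : realType}.
Local Open Scope ereal_scope.

(** Fatou for almost everywhere limits: [g] is replaced by the lower limit, which is measurable and
    equal to it almost everywhere. *)
Lemma fatou_le disp (X : measurableType disp) (m : {measure set X -> \bar R})
    (f : nat -> X -> \bar R) (g : X -> \bar R) (B : \bar R) :
  (forall n, measurable_fun setT (f n)) -> (forall n x, 0 <= f n x) ->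
  measurable_fun setT g -> (forall x, 0 <= g x) ->
  {ae m, forall x, f n x @[n --> \oo] --> g x} ->
  (forall n, \int[m]_x f n x <= B) -> \int[m]_x g x <= B.
Proof.
move=> mf f0 mg g0 fg fB.
have ce x : einfs (f ^~ x) n @[n --> \oo] --> limn_einf (f ^~ x).
  by rewrite limn_einf_lim; exact: is_cvg_einfs.
have e0 n x : 0 <= einfs (f ^~ x) n.
  by apply: le_ereal_inf_tmp => _ [k /= _ <-]; exact: f0.
have ml : measurable_fun setT (fun x => limn_einf (f ^~ x)).
  apply: (emeasurable_fun_cvg (fun n x => einfs (f ^~ x) n)) => //.
  by move=> n; apply: measurable_fun_einfs.
rewrite (ge0_ae_eq_integral (g := fun x => limn_einf (f ^~ x)))//; last 2 first.
- move=> x _; rewrite limn_einf_lim; apply: lime_ge; first exact: is_cvg_einfs.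
  exact: nearW.
- by apply: filterS fg => x fgx _; have [-> _] := cvg_limn_einf_sup fgx.
apply: le_trans (fatou m measurableT mf (fun n x _ => f0 n x)) _.
apply: le_trans (limn_einf_sup _) _.
rewrite limn_esup_lim; apply: lime_le; first exact: is_cvg_esups.
by apply: nearW => n; apply: ge_ereal_sup => _ [k /= _ <-]; exact: fB.
Qed.

Section density.
Context {disp : measure_display} {Omega : measurableType disp} (P : probability Omega R).
Context {disp' : measure_display} {T : measurableType disp'} (m : {measure set T -> \bar R}).
Context (X : {RV P >-> T}) (p : T -> R).
Context (mp : measurable_fun setT p) (p0 : forall x, (0 <= p x)%R) (Xp : has_density m X p).

Import HBNNSimple.

Let integral_density_indic (A : set T) : measurable A ->
  \int[P]_w (\1_A (X w))%:E = \int[m]_x ((\1_A x)%:E * (p x)%:E).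
Proof.
move=> mA.
rewrite -(ge0_integral_distribution X (f := fun x => (\1_A x)%:E)); last 2 first.
- by apply/measurable_EFinP; exact: measurable_indic.
- by move=> x; rewrite lee_fin.
transitivity (distribution P X A); first by rewrite integral_indic// setIT.
rewrite (Xp mA) integral_mkcond.
apply: eq_integral => x _; rewrite patchE indicE; case: ifP => _; first by rewrite mul1e.
by rewrite mul0e.
Qed.

(** [has_density] speaks of sets only; linearity extends it to simple functions, and monotone
    convergence on both sides to nonnegative ones. *)
Lemma ge0_integral_density (f : T -> \bar R) :
  measurable_fun setT f -> (forall x, 0 <= f x) ->
  \int[P]_w f (X w) = \int[m]_x (f x * (p x)%:E).
Proof.
move=> mf f0.
pose g := nnsfun_approx measurableT mf.
have mX : measurable_fun setT X by exact: measurable_funP.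
have mEp : measurable_fun setT (fun x => (p x)%:E) by exact/measurable_EFinP.
have mg n : measurable_fun setT (fun x => (g n x)%:E) by exact/measurable_EFinP.
have gX n : measurable_fun setT (fun w => (g n (X w))%:E).
  exact: (measurableT_comp (mg n) mX).
have step n : \int[P]_w (g n (X w))%:E = \int[m]_x ((g n x)%:E * (p x)%:E).
  pose l := fset_set (g n @` setT).
  have gE x : (g n x)%:E = \sum_(i < #|` l|) ((l`_i)%:E * (\1_(g n @^-1` [set l`_i]) x)%:E).
    by rewrite fimfunEord -sumEFin.
  have mA (y : R) : measurable (g n @^-1` [set y]) by exact: measurable_sfunP.
  have mi (y : R) : measurable_fun setT (fun x => (\1_(g n @^-1` [set y]) x)%:E : \bar R).
    by apply/measurable_EFinP; exact: measurable_indic.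
  have l0 (i : 'I_#|` l|) : (0 <= l`_i)%R.
    have : l`_i \in l by exact: mem_nth.
    by rewrite in_fset_set// inE => -[x _ <-].
  transitivity (\int[P]_w \sum_(i < #|` l|)
      ((l`_i)%:E * (\1_(g n @^-1` [set l`_i]) (X w))%:E)).
    by apply: eq_integral => w _; rewrite gE.
  rewrite ge0_integral_sum//; last 2 first.
  - by move=> i; apply: measurable_funeM; exact: (measurableT_comp (mi _) mX).
  - by move=> i w _; rewrite mule_ge0// lee_fin.
  rewrite [RHS](eq_integral (fun x => \sum_(i < #|` l|)
      ((l`_i)%:E * ((\1_(g n @^-1` [set l`_i]) x)%:E * (p x)%:E)))); last first.
    move=> x _; rewrite gE ge0_sume_distrl; last by move=> i _; rewrite mule_ge0// lee_fin.
    by apply: eq_bigr => i _; rewrite muleA.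
  rewrite ge0_integral_sum//; last 2 first.
  - by move=> i; apply: measurable_funeM; exact: emeasurable_funM.
  - by move=> i w _; rewrite !mule_ge0// lee_fin.
  apply: eq_bigr => i _.
  rewrite ge0_integralZl_EFin//; last exact: (measurableT_comp (mi _) mX).
  rewrite [RHS]ge0_integralZl_EFin//; last 2 first.
  - by move=> w _; rewrite mule_ge0// lee_fin.
  - exact: emeasurable_funM.
  by rewrite integral_density_indic.
have gcvg x : (g n x)%:E @[n --> \oo] --> f x.
  by apply: cvg_nnsfun_approx => // y _.
have gnd x : {homo (fun n => (g n x)%:E) : a b / (a <= b)%N >-> a <= b}.
  by move=> a b ab; rewrite lee_fin; exact/lefP/nd_nnsfun_approx.
have c1 : \int[P]_w (g n (X w))%:E @[n --> \oo] --> \int[P]_w f (X w).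
  have -> : (fun w => f (X w)) = (fun w => limn (fun n => (g n (X w))%:E)).
    by apply/funext => w; apply/esym/cvg_lim => //; exact: gcvg.
  apply: cvg_monotone_convergence => //.
  by move=> n w _; rewrite lee_fin.
have c2 : \int[m]_x ((g n x)%:E * (p x)%:E) @[n --> \oo] --> \int[m]_x (f x * (p x)%:E).
  have -> : (fun x => f x * (p x)%:E) = (fun x => limn (fun n => (g n x)%:E * (p x)%:E)).
    by apply/funext => x; apply/esym/cvg_lim => //; apply: cvgeZr => //; exact: gcvg.
  apply: cvg_monotone_convergence => //.
  - by move=> n; apply: emeasurable_funM => //; exact/measurable_EFinP.
  - by move=> n x _; rewrite mule_ge0// lee_fin.
  - by move=> x _ a b ab; rewrite lee_wpmul2r ?lee_fin//; exact/lefP/nd_nnsfun_approx.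
rewrite -(cvg_lim _ c1)// -(cvg_lim _ c2)//.
by under eq_fun do rewrite step.
Qed.

End density.

Section independence.
Context {disp : measure_display} {Omega : measurableType disp} (P : probability Omega R).
Context {I : choiceType} {disp' : measure_display} {T : measurableType disp'}.
Context (X : I -> {RV P >-> T}) (indep : mutually_independent X).

Lemma independent_pair i j (A B : set T) : i != j -> measurable A -> measurable B ->
  P (X i @^-1` A `&` X j @^-1` B) = P (X i @^-1` A) * P (X j @^-1` B).
Proof.
move=> ij mA mB.
(* Independence takes a family of sets over all indices; only its values at i and j enter. *)
have mAB k : measurable (if k == i then A else B) by case: ifP.
have := indep [fset i; j]%fset mAB.
rewrite big_fsetU1 ?inE//= big_seq_fset1 eqxx eq_sym (negbTE ij) => <-.
congr (P _); apply/seteqP; split => [w [/= wA wB] k /=|w H].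
  rewrite !inE => /orP[/eqP ->|/eqP ->]; first by rewrite eqxx.
  by rewrite eq_sym (negbTE ij).
split.
  by have := H i; rewrite /= !inE eqxx => /(_ isT).
by have := H j; rewrite /= !inE eqxx orbT eq_sym (negbTE ij) => /(_ isT).
Qed.

(** The joint law of the pair agrees with the product of the laws on rectangles, hence everywhere,
    and Fubini factors the integral. *)
Lemma independent_integralM i j (f g : T -> R) : i != j ->
  P.-integrable setT (fun w => (f (X i w))%:E) -> measurable_fun setT f ->
  P.-integrable setT (fun w => (g (X j w))%:E) -> measurable_fun setT g ->
  \int[P]_w (f (X i w) * g (X j w))%:E =
  \int[P]_w (f (X i w))%:E * \int[P]_w (g (X j w))%:E.
Proof.
move=> ij fi mf gi mg.
have mEf : measurable_fun setT (EFin \o f) by exact/measurable_EFinP.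
have mEg : measurable_fun setT (EFin \o g) by exact/measurable_EFinP.
have mi : measurable_fun setT (X i) by exact: measurable_funP.
have mj : measurable_fun setT (X j) by exact: measurable_funP.
have mZ : measurable_fun setT (fun w => (X i w, X j w)) by exact: measurable_fun_pair.
have fi' : (distribution P (X i)).-integrable setT (EFin \o f).
  exact: integrable_pushforward.
have gi' : (distribution P (X j)).-integrable setT (EFin \o g).
  exact: integrable_pushforward.
pose F p := (f p.1 * g p.2)%:E.
have mF : measurable_fun setT F.
  apply/measurable_EFinP; apply: measurable_funM.
    exact: measurableT_comp mf _.
  exact: measurableT_comp mg _.
have Fi := integrable_prod fi' gi'.
have pE A : measurable A ->
    (distribution P (X i) \x distribution P (X j)) A = pushforward P (fun w => (X i w, X j w)) A.
  move=> mA; apply: product_measure_unique => // B C mB mC.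
  exact: independent_pair.
have Fi2 : P.-integrable setT (F \o (fun w => (X i w, X j w))).
  apply/integrableP; split; first exact: measurableT_comp mF mZ.
  have /integrableP[_] := Fi.
  rewrite (eq_measure_integral (pushforward P (fun w => (X i w, X j w)))); last first.
    by move=> A mA _; exact: pE.
  by rewrite ge0_integral_pushforward//; exact: measurableT_comp.
transitivity (\int[distribution P (X i) \x distribution P (X j)]_p F p).
  rewrite (eq_measure_integral (pushforward P (fun w => (X i w, X j w)))); last first.
    by move=> A mA _; exact: pE.
  by rewrite integral_pushforward.
rewrite -integral12_prod_meas1// /fubini_F /F /=.
have gfin := integrable_fin_num measurableT gi.
have gE := integral_distribution mEg gi.
under eq_integral do under eq_integral do rewrite EFinM.
transitivity (\int[distribution P (X i)]_x ((f x)%:E * \int[P]_w (g (X j w))%:E)).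
  by apply: eq_integral => x _; rewrite integralZl// gE.
by rewrite -(fineK gfin) integralZr// (integral_distribution mEf fi).
Qed.

End independence.

(** Pythagoras for orthogonal functions. Cross products are integrable because they are dominated by
    the sum of the two squares. *)
Lemma integral_sum_sqr disp (X : measurableType disp) (m : {measure set X -> \bar R})
    (I : eqType) (s : seq I) (Y : I -> X -> R) : uniq s ->
  (forall i, measurable_fun setT (Y i)) ->
  (forall i, m.-integrable setT (fun x => (Y i x ^+ 2)%:E)) ->
  (forall i j, i != j -> \int[m]_x (Y i x * Y j x)%:E = 0) ->
  \int[m]_x ((\sum_(i <- s) Y i x) ^+ 2)%:E = \sum_(i <- s) \int[m]_x (Y i x ^+ 2)%:E.
Proof.
move=> us mY Y2 YY.
have Yij i j : m.-integrable setT (fun x => (Y i x * Y j x)%:E).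
  apply: (le_integrable measurableT _ _ (integrableD measurableT (Y2 i) (Y2 j))).
    by apply/measurable_EFinP; exact: measurable_funM.
  move=> x _; rewrite -EFinD /= lee_fin [leRHS]ger0_norm ?addr_ge0 ?sqr_ge0//.
  rewrite ler_norml; have := sqr_ge0 (Y i x + Y j x); have := sqr_ge0 (Y i x - Y j x).
  have := sqr_ge0 (Y i x); have := sqr_ge0 (Y j x).
  by move=> *; apply/andP; split; lra.
rewrite (eq_integral (fun x => \sum_(i <- s) \sum_(j <- s) (Y i x * Y j x)%:E)); last first.
  move=> x _; rewrite expr2 big_distrl/= -sumEFin; apply: eq_bigr => i _.
  by rewrite big_distrr/= -sumEFin.
rewrite integral_sum//; last by move=> i; exact: integrable_sum.
apply: eq_big_seq => i si; rewrite integral_sum//.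
rewrite (bigD1_seq i)//= big1 ?adde0//; last by move=> j ji; rewrite YY// eq_sym.
Qed.

Lemma double_variance disp (T : measurableType disp) (P : probability T R) (F : T -> R) :
  measurable_fun setT F -> P.-integrable setT (fun x => (F x)%:E) ->
  P.-integrable setT (fun x => (F x ^+ 2)%:E) ->
  2%:E * \int[P]_x ((F x - fine (\int[P]_y (F y)%:E)) ^+ 2)%:E =
  \int[P]_x \int[P]_y ((F x - F y) ^+ 2)%:E.
Proof.
move=> mF F1 F2.
(* Each of the three integrals is that of a monic quadratic polynomial in F; both sides reduce to 2
   (q - m^2). *)
have iexp (A B : R) : \int[P]_y (F y ^+ 2 + A * F y + B)%:E =
    (fine (\int[P]_y (F y ^+ 2)%:E) + A * fine (\int[P]_y (F y)%:E) + B)%:E.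
  rewrite (eq_integral (fun y => (F y ^+ 2)%:E + A%:E * (F y)%:E + cst B%:E y))//.
  rewrite integralD//; last 2 first.
  - by apply: integrableD => //; exact: integrableZl.
  - exact: finite_measure_integrable_cst.
  rewrite integralD//; last exact: integrableZl.
  rewrite integralZl// integral_cst//= probability_setT mule1.
  by rewrite -[in LHS](fineK (integrable_fin_num _ F2))//
    -[in LHS](fineK (integrable_fin_num _ F1)).
set q := fine (\int[P]_y (F y ^+ 2)%:E) in iexp *.
set m := fine (\int[P]_y (F y)%:E) in iexp *.
rewrite (eq_integral (fun y => (F y ^+ 2 + (- (2 * m)) * F y + m ^+ 2)%:E)); last first.
  by move=> y _; congr EFin; ring.
rewrite iexp -EFinM.
rewrite (eq_integral (fun x => (F x ^+ 2 + (- (2 * m)) * F x + q)%:E)); last first.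
  move=> x _; rewrite (eq_integral (fun y => (F y ^+ 2 + (- (2 * F x)) * F y + F x ^+ 2)%:E)).
    by rewrite iexp; congr EFin; ring.
  by move=> y _; congr EFin; ring.
by rewrite iexp; congr EFin; ring.
Qed.

Section enumeration.
Context {I : countType}.

(** The indices with code below k. These finite lists turn a sum over I into a limit of a sequence,
    as Fatou and dominated convergence require. *)
Definition enum_upto (k : nat) : seq I := pmap (@pickle_inv I) (iota 0 k).

Lemma enum_upto_uniq k : uniq (enum_upto k).
Proof. by apply: (pmap_uniq (@pickle_invK I)); exact: iota_uniq. Qed.

Lemma cvg_esum_enum_upto (u : I -> \bar R) : (forall i, 0 <= u i) ->
  \sum_(i <- enum_upto k) u i @[k --> \oo] --> \esum_(i in [set: I]) u i.
Proof.
move=> u0; pose e : I -> nat := choice.pickle.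
(* Codes that belong to no index contribute 0. *)
pose b (j : nat) := oapp u 0 (@pickle_inv I j).
have b0 j : 0 <= b j by rewrite /b; case: pickle_inv => /=.
have -> : \esum_(i in [set: I]) u i = \sum_(j <oo) b j.
  rewrite nneseries_esumT//.
  have -> : \esum_(i in [set: nat]) b i = \esum_(i in e @` setT) b i.
    rewrite [RHS]esum_mkcond; apply: eq_esum => j _; case: ifPn => // /negP jr.
    rewrite /b; case ej : (pickle_inv j) => [i|]//=; exfalso; apply: jr.
    by rewrite inE; exists i => //; have := @pickle_invK I j; rewrite ej.
  have einj : set_inj [set: I] e by move=> i j _ _; exact: (pcan_inj (@pickleK_inv I)).
  rewrite (esum_image [set: I] e b einj).
  by apply: eq_esum => i _; rewrite /b /e pickleK_inv.
rewrite (_ : (fun k => _) = (fun k => \sum_(0 <= j < k) b j)); last first.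
  by apply/funext => k; rewrite /enum_upto big_pmap /index_iota subn0.
exact: (@is_cvg_nneseries R b xpredT 0%N (fun j _ _ => b0 j)).
Qed.

End enumeration.
End probability_lemmas.

(** * Variance of the linear statistic *)

Section linear_statistic_variance.
Context {R : realType}.
Local Open Scope ereal_scope.
Notation mu := (lebesgue_measureRd R).
Context (a : R) (a0 : (0 < a)%R) {d : nat} (h : d.-tuple R -> R).
Context (hi : (mu d).-integrable setT (EFin \o h)).
Context (h2 : \int[mu d]_x (h x ^+ 2)%:E < +oo).
Context {disp : measure_display} {Omega : measurableType disp} (P : probability Omega R).
Context (xi : d.-tuple int -> {RV P >-> d.-tuple R}) (indep : mutually_independent xi).
Context (dens : forall n, has_density (mu d) (xi n) (gaussian_density a (d := d))).
Context (r : R) (r0 : (0 < r)%R).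

Let mh : measurable_fun setT h.
Proof. exact/measurable_EFinP/measurable_int/hi. Qed.

Let mxi n : measurable_fun setT (xi n). Proof. exact: measurable_funP. Qed.

Let mgd : measurable_fun setT (fun x : d.-tuple R => gaussian_density a x).
Proof. exact: measurable_gaussian_density. Qed.

Let gd0 (x : d.-tuple R) : (0 <= gaussian_density a x)%R.
Proof. exact: gaussian_density_ge0. Qed.

Let Z := gauss_density_const a d.

Let gdZ (x : d.-tuple R) : (gaussian_density a x <= Z)%R.
Proof.
rewrite gaussian_densityE -/Z ler_piMr//; first exact: ltW (gauss_density_const_gt0 a0 d).
by rewrite -expR0 ler_expR oppr_le0 mulr_ge0 ?dotp_ge0// invr_ge0 ltW.
Qed.

Let mlp (n : d.-tuple int) : measurable_fun setT (lattice_point r n).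
Proof. by apply: measurable_tscale; exact: measurable_tadd. Qed.

Lemma integral_lattice_point n (f : d.-tuple R -> \bar R) :
  measurable_fun setT f -> (forall x, 0 <= f x) ->
  \int[mu d]_x f (lattice_point r n x) = (r ^+ d)%:E * \int[mu d]_x f x.
Proof.
move=> mf f0; have ri0 : (r^-1 != 0)%R by rewrite invr_neq0// lt0r_neq0.
rewrite -(ge0_integral_affine (tscale r^-1 (lattice n)) ri0 mf f0).
rewrite muleA -EFinM gtr0_norm ?invr_gt0// exprVn mulfV ?mul1e; last first.
  by rewrite expf_neq0// lt0r_neq0.
apply: eq_integral => x _; congr f.
by apply: eq_from_tnth => i; rewrite !tnth_mktuple; ring.
Qed.

Let F n x := h (lattice_point r n x).
Let X n w := F n (xi n w).

Let mF n : measurable_fun setT (F n). Proof. exact: measurableT_comp. Qed.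
Let mX n : measurable_fun setT (X n). Proof. exact: measurableT_comp. Qed.

(** The density is at most its value [Z] at 0, so the mean is bounded by Z r^d times an integral of
    [f \o h]. Thus h in L^1 and L^2 gives each term two moments. *)
Let integral_X_lty n (f : R -> R) : measurable_fun setT f -> (forall x, 0 <= f x)%R ->
  \int[mu d]_x (f (h x))%:E < +oo -> \int[P]_w (f (X n w))%:E < +oo.
Proof.
move=> mf f0 foo.
have mfh : measurable_fun setT (fun x => (f (h x))%:E).
  by apply/measurable_EFinP; exact: measurableT_comp.
have mfF : measurable_fun setT (fun x => (f (F n x))%:E).
  by apply/measurable_EFinP; exact: measurableT_comp.
have fF0 x : 0 <= (f (F n x))%:E by rewrite lee_fin.
rewrite (ge0_integral_density mgd gd0 (dens n) mfF fF0).
apply: (@le_lt_trans _ _ (\int[mu d]_x (Z%:E * (f (F n x))%:E))).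
  apply: ge0_le_integral => //.
  - by move=> x _; rewrite mule_ge0// lee_fin.
  - by apply: emeasurable_funM => //; exact/measurable_EFinP.
  - exact: measurable_funeM.
  - by move=> x _; rewrite muleC lee_wpmul2r// lee_fin.
rewrite ge0_integralZl_EFin//; last exact: ltW (gauss_density_const_gt0 a0 d).
have -> : \int[mu d]_x (f (F n x))%:E = (r ^+ d)%:E * \int[mu d]_x (f (h x))%:E.
  by rewrite -(integral_lattice_point n mfh)// => x; rewrite lee_fin.
by rewrite muleA -EFinM lte_mul_pinfty// lee_fin mulr_ge0 ?exprn_ge0 ?ltW// gauss_density_const_gt0.
Qed.

Let X1 n : P.-integrable setT (fun w => (X n w)%:E).
Proof.
apply/integrableP; split; first exact/measurable_EFinP.
have /integrableP[_ hoo] := hi.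
exact: (integral_X_lty n (@normr_measurable R setT) (fun x => normr_ge0 x) hoo).
Qed.

Let X2 n : P.-integrable setT (fun w => (X n w ^+ 2)%:E).
Proof.
apply/integrableP; split; first by apply/measurable_EFinP; exact: measurable_funX.
under eq_integral do rewrite gee0_abs ?lee_fin ?sqr_ge0//.
apply: (integral_X_lty n (f := fun x => x ^+ 2)%R _ _ h2); last by move=> x; exact: sqr_ge0.
exact: measurable_funX.
Qed.

Let m n : R := fine (\int[P]_w (X n w)%:E).

Let mE n : \int[P]_w (X n w)%:E = (m n)%:E.
Proof. by rewrite fineK//; apply: integrable_fin_num. Qed.

Let integral_distributionE n (f : d.-tuple R -> \bar R) :
  measurable_fun setT f -> (forall x, 0 <= f x) ->
  \int[distribution P (xi n)]_x f x = \int[mu d]_x (f x * (gaussian_density a x)%:E).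
Proof.
by move=> mf f0; rewrite ge0_integral_distribution//
  (ge0_integral_density mgd gd0 (dens n) mf f0).
Qed.

(** [double_variance] is applied to the law of [xi n] on R^d, where the density can then be inserted
    in each variable. *)
Let variance_pair n : 2%:E * \int[P]_w ((X n w - m n) ^+ 2)%:E =
  \int[mu d]_x \int[mu d]_y ((F n x - F n y) ^+ 2 *
     (gaussian_density a x * gaussian_density a y))%:E.
Proof.
pose nu := distribution P (xi n).
have mEF : measurable_fun setT (fun x => (F n x)%:E) by exact/measurable_EFinP.
have mEF2 : measurable_fun setT (fun x => (F n x ^+ 2)%:E).
  by apply/measurable_EFinP; exact: measurable_funX.
have F1 : nu.-integrable setT (fun x => (F n x)%:E).
  exact: (integrable_pushforward (mxi n) mEF (X1 n)).
have F2 : nu.-integrable setT (fun x => (F n x ^+ 2)%:E).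
  exact: (integrable_pushforward (mxi n) mEF2 (X2 n)).
have mnu : fine (\int[nu]_x (F n x)%:E) = m n.
  by rewrite /m /nu (integral_distribution mEF (X1 n)).
have := double_variance (mF n) F1 F2.
rewrite mnu ge0_integral_distribution; last 2 first.
- by apply/measurable_EFinP; apply: measurable_funX; exact: measurable_funB.
- by move=> x; rewrite lee_fin sqr_ge0.
move=> ->.
have m2 : measurable_fun setT
    (fun p : d.-tuple R * d.-tuple R => ((F n p.1 - F n p.2) ^+ 2)%:E).
  apply/measurable_EFinP; apply: measurable_funX; apply: measurable_funB.
    exact: measurableT_comp (mF n) _.
  exact: measurableT_comp (mF n) _.
have m3 : measurable_fun setT (fun p : d.-tuple R * d.-tuple R =>
    ((F n p.1 - F n p.2) ^+ 2)%:E * (gaussian_density a p.2)%:E).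
  apply: emeasurable_funM => //; apply/measurable_EFinP.
  exact: measurable_gaussian_density.
have inner x : \int[nu]_y ((F n x - F n y) ^+ 2)%:E =
    \int[mu d]_y (((F n x - F n y) ^+ 2)%:E * (gaussian_density a y)%:E).
  rewrite integral_distributionE//.
    exact: (measurableT_comp m2 (measurable_pair1 x)).
  by move=> y; rewrite lee_fin sqr_ge0.
under eq_integral do rewrite inner.
rewrite integral_distributionE; last 2 first.
- exact: (measurable_integral_r (mu d) m3).
- by move=> x; apply: integral_ge0 => y _; rewrite mule_ge0// lee_fin// sqr_ge0.
apply: eq_integral => x _; rewrite muleC -ge0_integralZl_EFin//; last 2 first.
- by move=> y _; rewrite mule_ge0// lee_fin// sqr_ge0.
- exact: (measurableT_comp m3 (measurable_pair1 x)).
by apply: eq_integral => y _; rewrite -!EFinM; congr EFin; ring.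
Qed.

Let B : \bar R := (@variance_const R a d * r ^+ d)%:E * spectral_energy h r.

(** Independence removes the cross terms of the centred sum. The bound is the same for all finite
    sets of lattice points, which is what the limit needs. *)
Lemma finite_variance_le (s : seq (d.-tuple int)) : uniq s ->
  \int[P]_w ((\sum_(n <- s) (X n w - m n)) ^+ 2)%:E <= B.
Proof.
move=> us.
have Ym (n : d.-tuple int) : measurable_fun setT (fun x => F n x - m n)%R.
  exact: measurable_funB.
have Y1 n : P.-integrable setT (fun w => (F n (xi n w) - m n)%:E).
  apply: (eq_integrable measurableT ((fun w => (X n w)%:E) \- cst (m n)%:E)).
    by move=> w _.
  by apply: integrableB; [|exact: X1|exact: finite_measure_integrable_cst].
have Y0 n : \int[P]_w (F n (xi n w) - m n)%:E = 0.
  under eq_integral do rewrite EFinB.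
  rewrite integralB//; [|exact: X1|exact: finite_measure_integrable_cst].
  by rewrite mE integral_cst//= probability_setT mule1 subee.
have Y2 n : P.-integrable setT (fun w => ((X n w - m n) ^+ 2)%:E).
  rewrite (_ : (fun w => _) = (fun w => (X n w ^+ 2)%:E + (- (2 * m n))%:E * (X n w)%:E +
      cst (m n ^+ 2)%:E w)).
    apply: integrableD => //; last exact: finite_measure_integrable_cst.
    by apply: integrableD => //; exact: integrableZl.
  apply/funext => w.
  by apply: (@congr1 _ _ EFin _ (X n w ^+ 2 + (- (2 * m n)) * X n w + m n ^+ 2)%R); ring.
rewrite (integral_sum_sqr us (Y := fun n w => (X n w - m n)%R))//; last 2 first.
- by move=> n; exact: measurable_funB.
- move=> i j ij; have := independent_integralM indep ij (Y1 i) (Ym i) (Y1 j) (Ym j).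
  by rewrite !Y0 mule0.
have V0 n : 0 <= \int[P]_w ((X n w - m n) ^+ 2)%:E.
  by apply: integral_ge0 => w _; rewrite lee_fin sqr_ge0.
apply: le_trans (pair_variance_le a0 hi h2 r0 us).
(* The double integral is twice the variance; the factor 2 is given away. *)
apply: lee_sum => n _; rewrite -variance_pair -[leLHS]mul1e.
by apply: lee_wpmul2r => //; rewrite lee_fin ler1n.
Qed.

Let M1 : \bar R := (gauss_density_const a d * lattice_gauss_bound a^-1 d)%:E *
  \int[mu d]_x (`|h (tscale r^-1 x)|)%:E.

Let M1_lty : M1 < +oo.
Proof.
have /integrableP[_ hoo] := hi.
have mnh : measurable_fun setT (fun x => (`|h x|)%:E).
  by apply/measurable_EFinP; exact: measurableT_comp.
have ri : (0 < r^-1)%R by rewrite invr_gt0.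
have K0 : (0 <= gauss_density_const a d * lattice_gauss_bound a^-1 d)%R.
  (* The constant is nonnegative because it bounds the empty sum. *)
  apply: le_trans (lattice_density_sum_le a0 [tuple 0 | i < d]%R (isT : uniq [::])).
  by rewrite big_nil.
rewrite /M1 lte_mul_pinfty//.
have := ge0_integral_tscale ri mnh (fun x => normr_ge0 _ : 0 <= (`|h x|)%:E).
move: hoo => /[swap] <-; apply: contraTT; rewrite -!leNgt !leye_eq => /eqP ->.
by rewrite gt0_muley// lte_fin exprn_gt0.
Qed.

(** After recentring, all terms share the factor |h(x/r)| and the shifted densities sum to at most a
    constant. *)
Lemma finite_abs_sum_le (s : seq (d.-tuple int)) : uniq s ->
  \int[P]_w (\sum_(n <- s) (`|X n w|)%:E) <= M1.
Proof.
move=> us.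
pose g x := h (tscale r^-1 x).
have mg : measurable_fun setT g by apply: (measurableT_comp mh); exact: measurable_tscale.
have mng : measurable_fun setT (fun x => (`|g x|)%:E).
  by apply/measurable_EFinP; exact: measurableT_comp.
have mgds (n : d.-tuple int) :
    measurable_fun setT (fun x => (gaussian_density a (tsub x (lattice n)))%:E).
  by apply/measurable_EFinP; apply: measurable_gaussian_density; exact: measurable_tsub.
have T1 n : \int[P]_w (`|X n w|)%:E =
    \int[mu d]_x ((`|g x|)%:E * (gaussian_density a (tsub x (lattice n)))%:E).
  have mnF : measurable_fun setT (fun x => (`|F n x|)%:E).
    by apply/measurable_EFinP; exact: measurableT_comp.
  rewrite (ge0_integral_density mgd gd0 (dens n) mnF (fun x => normr_ge0 _ : 0 <= (`|F n x|)%:E)).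
  rewrite -(ge0_integral_tadd (lattice n)
    (f := fun x => (`|g x|)%:E * (gaussian_density a (tsub x (lattice n)))%:E)).
  - apply: eq_integral => x _; rewrite taddK /F /g /lattice_point.
    by rewrite [tadd (lattice n) x]taddC.
  - exact: emeasurable_funM.
  - by move=> x; rewrite mule_ge0// lee_fin.
rewrite ge0_integral_sum//; last first.
  by move=> n; apply/measurable_EFinP; exact: measurableT_comp.
under eq_bigr do rewrite T1.
rewrite -ge0_integral_sum//; last 2 first.
- by move=> n; exact: emeasurable_funM.
- by move=> n x _; rewrite mule_ge0// lee_fin.
have K0 : (0 <= gauss_density_const a d * lattice_gauss_bound a^-1 d)%R.
  apply: le_trans (lattice_density_sum_le a0 [tuple 0 | i < d]%R (isT : uniq [::])).
  by rewrite big_nil.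
rewrite /M1 -ge0_integralZl_EFin//.
apply: ge0_le_integral => //.
- by move=> x _; apply: sume_ge0 => n _; rewrite mule_ge0// lee_fin.
- by apply: emeasurable_sum => n; exact: emeasurable_funM.
- exact: measurable_funeM.
- move=> x _; rewrite -ge0_sume_distrr; last by move=> n _; rewrite lee_fin.
  rewrite sumEFin muleC; apply: lee_wpmul2r => //.
  by rewrite lee_fin; exact: lattice_density_sum_le.
Qed.

Let N w := linear_statistic xi h r w.

Let NE w : N w = fine (\esum_(n in [set: d.-tuple int]) (fun n => (X n w)%:E)^\+ n -
  \esum_(n in [set: d.-tuple int]) (fun n => (X n w)%:E)^\- n).
Proof.
rewrite /N /linear_statistic /rsum.
rewrite (_ : (fun n => h _) = (fun n => X n w))//.
apply/funext => n; rewrite /X /F; congr h.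
by apply: eq_from_tnth => i; rewrite !tnth_mktuple mulrC.
Qed.

Let s k := @enum_upto (d.-tuple int) k.
Let us k : uniq (s k). Proof. exact: enum_upto_uniq. Qed.

Let S w := \esum_(n in [set: d.-tuple int]) (`|X n w|)%:E.
Let U w := \esum_(n in [set: d.-tuple int]) (fun n => (X n w)%:E)^\+ n.
Let V w := \esum_(n in [set: d.-tuple int]) (fun n => (X n w)%:E)^\- n.

Let S_cvg w : \sum_(n <- s k) (`|X n w|)%:E @[k --> \oo] --> S w.
Proof. by apply: cvg_esum_enum_upto => n; rewrite lee_fin. Qed.
Let U_cvg w : \sum_(n <- s k) (fun n => (X n w)%:E)^\+ n @[k --> \oo] --> U w.
Proof. exact: cvg_esum_enum_upto. Qed.
Let V_cvg w : \sum_(n <- s k) (fun n => (X n w)%:E)^\- n @[k --> \oo] --> V w.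
Proof. exact: cvg_esum_enum_upto. Qed.

Let mnX n : measurable_fun setT (fun w => (`|X n w|)%:E).
Proof. by apply/measurable_EFinP; exact: measurableT_comp. Qed.

Let mEX n : measurable_fun setT (fun w => (X n w)%:E).
Proof. exact/measurable_EFinP. Qed.

Let mS : measurable_fun setT S.
Proof.
apply: (emeasurable_fun_cvg (fun k w => \sum_(n <- s k) (`|X n w|)%:E)) => //.
by move=> k; exact: emeasurable_sum.
Qed.

Let mU : measurable_fun setT U.
Proof.
apply: (emeasurable_fun_cvg (fun k w => \sum_(n <- s k) (fun n => (X n w)%:E)^\+ n));
  last by move=> w _; exact: U_cvg.
move=> k; apply: emeasurable_sum => n; 
rewrite (_ : (fun w => _) = (fun w => (X n w)%:E)^\+); first exact: measurable_funepos.
by apply/funext => w; rewrite !funeposE.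
Qed.

Let mV : measurable_fun setT V.
Proof.
apply: (emeasurable_fun_cvg (fun k w => \sum_(n <- s k) (fun n => (X n w)%:E)^\- n));
  last by move=> w _; exact: V_cvg.
move=> k; apply: emeasurable_sum => n; 
rewrite (_ : (fun w => _) = (fun w => (X n w)%:E)^\-); first exact: measurable_funeneg.
by apply/funext => w; rewrite !funenegE.
Qed.

Let mN : measurable_fun setT N.
Proof.
rewrite (_ : N = fun w => fine (U w - V w)); last by apply/funext => w; exact: NE.
have mf : measurable_fun setT (@fine R) by [].
exact: (measurableT_comp mf (emeasurable_funB mU mV)).
Qed.

Let S0 w : 0 <= S w. Proof. by apply: esum_ge0 => n _; rewrite lee_fin. Qed.

(** Makes the family almost surely absolutely summable, so that the default value of [rsum] can
    occur only on a null set. *)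
Let S_lty : \int[P]_w S w < +oo.
Proof.
apply: le_lt_trans M1_lty.
apply: (fatou_le (f := fun k w => \sum_(n <- s k) (`|X n w|)%:E)) => //.
- by move=> k; exact: emeasurable_sum.
- by move=> k w; apply: sume_ge0 => n _; rewrite lee_fin.
- exact: aeW.
- by move=> k; exact: finite_abs_sum_le.
Qed.

Let S_i : P.-integrable setT S.
Proof. by apply/integrableP; split => //; under eq_integral do rewrite gee0_abs//. Qed.

(** Where [S] is finite, so are the sums of positive and of negative parts, and [fine (U w - V w)]
    is a genuine difference of limits. *)
Let N_cvg w : S w \is a fin_num -> (\sum_(n <- s k) X n w)%R @[k --> \oo] --> N w.
Proof.
move=> Sfin.
have US : U w <= S w.
  by apply: le_esum => n _; rewrite funeposE ge_max lee_fin ler_norm lee_fin normr_ge0.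
have VS : V w <= S w.
  by apply: le_esum => n _; rewrite funenegE ge_max !lee_fin -normrN ler_norm normr_ge0.
have U0 : 0 <= U w by exact: esum_ge0.
have V0 : 0 <= V w by exact: esum_ge0.
have Soo : S w < +oo by rewrite -ge0_fin_numE.
have Ufin : U w \is a fin_num by rewrite ge0_fin_numE// (le_lt_trans US).
have Vfin : V w \is a fin_num by rewrite ge0_fin_numE// (le_lt_trans VS).
rewrite NE -/(U w) -/(V w).
have Ep (k : nat) : \sum_(n <- s k) (fun n => (X n w)%:E)^\+ n =
    (\sum_(n <- s k) Num.max (X n w) 0)%R%:E.
  by rewrite -sumEFin; apply: eq_bigr => n _; rewrite funeposE EFin_max.
have En (k : nat) : \sum_(n <- s k) (fun n => (X n w)%:E)^\- n =
    (\sum_(n <- s k) Num.max (- X n w) 0)%R%:E.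
  by rewrite -sumEFin; apply: eq_bigr => n _; rewrite funenegE EFin_max.
have H : ((\sum_(n <- s k) X n w)%R)%:E @[k --> \oo] --> (fine (U w - V w))%:E.
  rewrite fineK; last by rewrite fin_numB Ufin.
  rewrite (_ : (fun k => _) = (fun k => \sum_(n <- s k) (fun n => (X n w)%:E)^\+ n -
     \sum_(n <- s k) (fun n => (X n w)%:E)^\- n)).
    by apply: cvgeB; [rewrite fin_num_adde_defr|exact: U_cvg|exact: V_cvg].
  apply/funext => k; rewrite Ep En -EFinB; congr EFin.
  rewrite -sumrB; apply: eq_bigr => n _.
  case: (leP (X n w) 0%R) => x0.
    by rewrite max_l ?oppr_ge0// sub0r opprK.
  by rewrite max_r ?oppr_le0 1?ltW// subr0.
exact: (fine_cvg H).
Qed.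

(* The partial sums converge almost everywhere, dominated by the integrable [S],
   so their means converge; Fatou then passes the variance bound to the limit. *)
Lemma variance_linear_statistic_le : 'V_P[N] <= B.
Proof.
have Sae : {ae P, forall w, S w \is a fin_num}.
  by have := integrable_ae measurableT S_i; apply: filterS => w; exact.
pose c k : R := (\sum_(n <- s k) m n)%R.
have mNk k : measurable_fun setT (fun w => (\sum_(n <- s k) X n w)%R).
  exact: measurable_sum.
have cE k : \int[P]_w ((\sum_(n <- s k) X n w)%R)%:E = (c k)%:E.
  under eq_integral do rewrite -sumEFin.
  by rewrite integral_sum//; under eq_bigr do rewrite mE; rewrite sumEFin.
have mEN : measurable_fun setT (fun w => (N w)%:E) by exact/measurable_EFinP.
have cvgE : {ae P, forall w, setT w ->
    ((\sum_(n <- s k) X n w)%R)%:E @[k --> \oo] --> (N w)%:E}.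
  apply: filterS Sae => w Sw _; apply: cvg_EFin; first exact: nearW.
  exact: N_cvg.
have dom : {ae P, forall w k, setT w -> `|((\sum_(n <- s k) X n w)%R)%:E| <= S w}.
  apply: aeW => w k _; apply: (@le_trans _ _ (\sum_(n <- s k) (`|X n w|)%:E)).
    by rewrite sumEFin lee_fin; exact: ler_norm_sum.
  apply: esum_ge; exists [set` s k]; first by split => //; exact: finite_seq.
  by rewrite fsbig_seq.
(* Besides the limit of the means this gives integrability of [N], so [mu_N] is its true
   expectation. *)
have [Ni _ cN] := dominated_convergence measurableT
  (fun k => (measurable_EFinP _ _).2 (mNk k)) mEN cvgE S_i dom.
pose mu_N : R := fine 'E_P[N].
have EN : 'E_P[N] = mu_N%:E.
  by rewrite /mu_N fineK// unlock; exact: integrable_fin_num.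
have ccvg : c k @[k --> \oo] --> mu_N.
  have H : (c k)%:E @[k --> \oo] --> mu_N%:E.
    by rewrite -EN unlock; under eq_cvg do rewrite -cE.
  exact: (fine_cvg H).
have -> : 'V_P[N] = \int[P]_w ((N w - mu_N) ^+ 2)%:E.
  rewrite /variance unlock unlock; apply: eq_integral => w _; rewrite expr2.
  by rewrite /mu_N unlock.
apply: (fatou_le (f := fun k w => ((\sum_(n <- s k) (X n w - m n)) ^+ 2)%:E)).
- move=> k; apply/measurable_EFinP; apply: measurable_funX.
  by apply: measurable_sum => n; exact: measurable_funB.
- by move=> k w; rewrite lee_fin sqr_ge0.
- by apply/measurable_EFinP; apply: measurable_funX; exact: measurable_funB.
- by move=> w; rewrite lee_fin sqr_ge0.
- apply: filterS Sae => w Sw; apply: cvg_EFin; first exact: nearW.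
  have D : ((\sum_(n <- s k) X n w) - c k)%R @[k --> \oo] --> (N w - mu_N)%R.
    by apply: cvgB => //; exact: N_cvg.
  rewrite expr2 (_ : fine \o _ =
    (fun k => (\sum_(n <- s k) X n w - c k) * (\sum_(n <- s k) X n w - c k))%R); first exact: cvgM.
  by apply/funext => k; rewrite /= sumrB expr2.
- by move=> k; exact: finite_variance_le.
Qed.

End linear_statistic_variance.

(** The minus sign in the exponent makes the imaginary part the negative of [sin_transform], and
    squaring removes it. *)
Lemma normc_fourier_sqr {R : realType} (d : nat) (h : d.-tuple R -> R) (l : d.-tuple R) :
  (lebesgue_measureRd R d).-integrable setT (EFin \o h) ->
  normc (fourier (fun x => (h x)%:C%C) l) ^+ 2 = power_spectrum h l.
Proof.
move=> hi; rewrite /fourier /cintegral /= sqr_sqrtr ?addr_ge0 ?sqr_ge0//.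
rewrite /power_spectrum; congr (_ ^+ 2 + _).
  rewrite /cos_transform /Rintegral; congr fine; apply: eq_integral => x _.
  by rewrite /= mul0r subr0 cosN.
rewrite -[RHS]sqrrN /sin_transform -fineN -integralN; last first.
  exact: (integrable_add_def measurableT (integrable_sin_transform hi l)).
rewrite /Rintegral; congr (fine _ ^+ 2); apply: eq_integral => x _.
by rewrite /= mul0r addr0 sinN mulrN.
Qed.

Theorem theorem2 (R : realType) (d : nat) (a : R) (hd : (1 <= d)%N)
    (ha : 0 < a) :
  exists2 C : R, 0 < C &
    forall (disp : measure_display) (Omega : measurableType disp)
      (P : probability Omega R) (xi : d.-tuple int -> {RV P >-> d.-tuple R}),
    mutually_independent xi ->
    (forall n, has_density (lebesgue_measureRd R d) (xi n)
                 (gaussian_density a (d := d))) ->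
    forall h : d.-tuple R -> R,
    h \in Lfun (lebesgue_measureRd R d) 1%E ->
    h \in Lfun (lebesgue_measureRd R d) 2%:E ->
    \forall r \near +oo,
      ('V_P[linear_statistic xi h r] <=
       C%:E *
       ((r ^ (d%:Z - 2))%:E *
          \int[lebesgue_measureRd R d]_(lambda in [set l | (enorm l <= r)%R])
            (normc (fourier (fun x => (h x)%:C%C) lambda) ^+ 2
             * enorm lambda ^+ 2)%:E
        + (r ^+ d)%:E *
          \int[lebesgue_measureRd R d]_(lambda in [set l | (r <= enorm l)%R])
            (normc (fourier (fun x => (h x)%:C%C) lambda) ^+ 2)%:E))%E.
Proof.
(* The absolute value plus 1 is positive by its form and still bounds [variance_const]. *)
exists (`|@variance_const R a d| + 1); first by rewrite ltr_pwDr.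
move=> disp Omega P xi indep dens h h1 h2.
have hi := (Lfun1_integrable _ _).1 h1.
have h2_lty : (\int[lebesgue_measureRd R d]_x (h x ^+ 2)%:E < +oo)%E.
  have /integrableP[_] := Lfun2_integrable_sqr h2.
  by under eq_integral do rewrite /= ger0_norm ?sqr_ge0//.
(* The threshold for r is 0. *)
apply: filterS (nbhs_pinfty_gt (num_real (0 : R))) => r r0.
apply: (le_trans (variance_linear_statistic_le ha hi h2_lty indep dens r0)).
under eq_integral do rewrite normc_fourier_sqr//.
under [X in (_ + _ * X)%E]eq_integral do rewrite normc_fourier_sqr//.
set I1 := (\int[_]_(_ in _) _)%E; set I2 := (\int[_]_(_ in _) _)%E.
have I10 : (0 <= I1)%E.
  apply: integral_ge0 => l _; rewrite lee_fin; apply: mulr_ge0.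
    exact: power_spectrum_ge0.
  exact: sqr_ge0.
have I20 : (0 <= I2)%E by apply: integral_ge0 => l _; rewrite lee_fin power_spectrum_ge0.
(* The exponent is an integer, negative for d = 1; the splitting uses that r is nonzero. *)
have -> : r ^ (d%:Z - 2) = r ^+ d * r ^- 2 by rewrite expfzDr ?lt0r_neq0.
have rd0 : (0 <= r ^+ d) by rewrite exprn_ge0 ?ltW.
have ri0 : 0 <= r ^- 2 by rewrite invr_ge0 sqr_ge0.
rewrite [in leRHS]EFinM -muleA -ge0_muleDr ?mule_ge0 ?lee_fin//.
rewrite EFinM -muleA lee_wpmul2r//.
  by rewrite mule_ge0 ?lee_fin// adde_ge0 ?mule_ge0 ?lee_fin.
by rewrite lee_fin (le_trans (ler_norm _))// lerDl.
Qed.
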